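(* Let $G$ and $H$ be simple graphs with $|V(G)|=|V(H)|$ and let $k\in\mathbb{N}$, $k\ge 1$. The following are equivalent: (i) there exists a certificate for the $k^{\text{th}}$ level of the NPA hierarchy for the $(G,H)$-isomorphism game; (ii) there exists a level-$k$ quantum isomorphism map from $G$ to $H$; (iii) $G$ and $H$ are algebraically $k$-equivalent; (iv) $G$ and $H$ are homomorphism indistinguishable over $\mathcal{P}_k$, i.e. $\hom(F,G)=\hom(F,H)$ for every graph $F$ that is the underlying graph of some member of $\mathcal{P}_k$.
   Context: All graphs are finite, undirected, without multiple edges; $G,H$ are simple (loopless). A homomorphism $F\to G$ is a map $h:V(F)\to V(G)$ with $h(u)h(v)\in E(G)$ for all $uv\in E(F)$; $\hom(F,G)$ is their number. For $g,g'\in V(G)$, $\mathrm{rel}_G(g,g')$ records whether $g=g'$, $g\sim g'$ (adjacent), or $g\ne g'$ non-adjacent; $\mathrm{rel}_G(g,g')=\mathrm{rel}_H(h,h')$ means both pairs are in the same one of these three cases. Bilabelled graphs: for $k,l\ge1$ a $(k,l)$-bilabelled graph is $\boldsymbol F=(F,\boldsymbol u,\boldsymbol v)$ with $F$ a graph, $\boldsymbol u\in V(F)^k$ (in-labels), $\boldsymbol v\in V(F)^l$ (out-labels); $F$ is its underlying graph. Its homomorphism tensor $\boldsymbol F_G\in\mathbb{C}^{V(G)^k\times V(G)^l}$ has $(\boldsymbol x,\boldsymbol y)$-entry the number of homomorphisms $h:F\to G$ with $h(u_i)=x_i$, $h(v_j)=y_j$ for all $i,j$. Series composition: for $(k,l)$-bilabelled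 $\boldsymbol F$ and $(l,n)$-bilabelled $\boldsymbol F'=(F',\boldsymbol u',\boldsymbol v')$, $\boldsymbol F\cdot\boldsymbol F'$ is the disjoint union of $F,F'$ with $v_i$ identified with $u'_i$ for all $i$, multiple edges removed, in-labels $\boldsymbol u$, out-labels $\boldsymbol v'$. Parallel composition: for two $(k,l)$-bilabelled graphs, $\boldsymbol F\odot\boldsymbol F'$ is the disjoint union with $u_i$ identified with $u'_i$ and $v_j$ with $v'_j$, multiple edges removed, labels $\boldsymbol u,\boldsymbol v$. For a $(k,k)$-bilabelled $\boldsymbol F$ and $\sigma\in\mathfrak S_{2k}$, let $\boldsymbol w=(u_1,\dots,u_k,v_1,\dots,v_k)$ and $\boldsymbol F^\sigma=(F,\boldsymbol x,\boldsymbol y)$ with $x_i=w_{\sigma(i)}$, $y_j=w_{\sigma(k+j)}$. For a matrix $X$ indexed by $V^k\times V^k$ (viewing an index pair as $\boldsymbol z\in V^{2k}$), $X^\sigma$ is defined by $(X^\sigma)_{\boldsymbol z}=X_{\boldsymbol w}$ where $w_{\sigma(i)}=z_i$; thus $(\boldsymbol F^\sigma)_G=(\boldsymbol F_G)^\sigma$. Let $\mathscr C_k\le\mathfrak S_{2k}$ be the cyclic group of rotations of the cyclic sequence $(1,2,\dots,k,2k,2k-1,\dots,k+1)$ (generated by the permutation sending each entry of this sequence to the next one, and the last to the first). A bilabelled minor of $\boldsymbol F$ is a bilabelled graph obtained by a sequence of edge contractions, edge deletions and deletions of unlabelled vertices (labels stay on their vertices). Atomic graphs: $\boldsymbol C_k=(C_k,(1,\dots,k),(k+1,\dots,2k))$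 with $V(C_k)=[2k]$ and $E(C_k)=\{\{i,i+1\}: i\in[2k]\setminus\{k,2k\}\}\cup\{\{1,k+1\},\{k,2k\}\}$; $\boldsymbol M_k=(M_k,(1,\dots,k),(k+1,\dots,2k))$ with $V(M_k)=[2k]$, $E(M_k)=\{\{i,i+k\}:i\in[k]\}$. $\mathcal Q_k^P$ is the set of bilabelled minors of $\boldsymbol C_k$, $\mathcal Q_k^S$ the set of bilabelled minors of $\boldsymbol M_k$, $\mathcal Q_k=\mathcal Q_k^P\cup\mathcal Q_k^S$. $\mathcal P_k$ is the smallest class of $(k,k)$-bilabelled graphs containing $\mathcal Q_k$ and closed under series composition, under $\boldsymbol F\mapsto \boldsymbol F\odot\boldsymbol Q$ for $\boldsymbol Q\in\mathcal Q_k^P$, and under $\boldsymbol F\mapsto\boldsymbol F^\sigma$ for $\sigma\in\mathscr C_k$. NPA certificate: let $\Sigma=V(G)\times V(H)$, $\Sigma^{\le k}$ the words of length at most $k$ over $\Sigma$, $\epsilon$ the empty word, $s^R$ the reversal of $s$, $st$ concatenation. Let $\sim$ be the coarsest equivalence relation on words with $s\,a\,a\,t\sim s\,a\,t$ for every letter $a\in\Sigma$ and words $s,t$, and $st\sim ts$ for all words $s,t$. A certificate for the $k^{\text{th}}$ level of the NPA hierarchy for the $(G,H)$-isomorphism game is a positive semidefinite matrix $\mathcal R\in\mathbb{C}^{\Sigma^{\le k}\times\Sigma^{\le k}}$ with: (1) $\mathcal R_{\epsilon,\epsilon}=1$; (2) $\mathcal R_{s,t}=\mathcal R_{s',t'}$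 whenever $s^Rt\sim s'^Rt'$; (3) for all words $s,s'$, $g\in V(G)$, $h\in V(H)$ with $s(g,h)s'\in\Sigma^{\le k}$ and all $t\in\Sigma^{\le k}$: $\sum_{h'\in V(H)}\mathcal R_{s(g,h')s',t}=\mathcal R_{ss',t}$, $\sum_{g'\in V(G)}\mathcal R_{s(g',h)s',t}=\mathcal R_{ss',t}$, $\sum_{h'}\mathcal R_{t,s(g,h')s'}=\mathcal R_{t,ss'}$, $\sum_{g'}\mathcal R_{t,s(g',h)s'}=\mathcal R_{t,ss'}$; (4) if $s^Rt$ contains consecutive letters $(g,h),(g',h')$ with $\mathrm{rel}_G(g,g')\ne\mathrm{rel}_H(h,h')$ then $\mathcal R_{s,t}=0$. Level-$k$ quantum isomorphism map: a linear map $\Phi:\mathbb{C}^{V(G)^k\times V(G)^k}\to\mathbb{C}^{V(H)^k\times V(H)^k}$ that is completely positive, satisfies $\Phi(\boldsymbol F_G\odot X)=\boldsymbol F_H\odot\Phi(X)$ for all $\boldsymbol F\in\mathcal Q_k^P$ and all $X$ ($\odot$ = entrywise product), $\Phi(I)=I=\Phi^*(I)$, $\Phi(J)=J=\Phi^*(J)$ ($I$ identity, $J$ all-ones, $\Phi^*$ the adjoint w.r.t. $\langle A,B\rangle=\mathrm{tr}(A^*B)$), $\Phi(\boldsymbol F_G)=\boldsymbol F_H$ for all $\boldsymbol F\in\mathcal Q_k$, and $\Phi(X^\sigma)=\Phi(X)^\sigma$ for all $X$ and $\sigma\in\mathscr C_k$. Algebraic $k$-equivalence: $\widehat{\mathcal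 Q}^k_G$ is the smallest subalgebra of $\mathbb{C}^{V(G)^k\times V(G)^k}$ that contains $I$ and $J$, is closed under conjugate transpose, under $X\mapsto\boldsymbol F_G\odot X$ for $\boldsymbol F\in\mathcal Q_k^P$ and under $X\mapsto X^\sigma$ for $\sigma\in\mathscr C_k$, and contains $\boldsymbol F_G$ for all $\boldsymbol F\in\mathcal Q_k$; similarly $\widehat{\mathcal Q}^k_H$. $G,H$ are algebraically $k$-equivalent if there is a vector space isomorphism $\varphi:\widehat{\mathcal Q}^k_G\to\widehat{\mathcal Q}^k_H$ with $\varphi(M^* )=\varphi(M)^*$, $\varphi(MN)=\varphi(M)\varphi(N)$, $\varphi(\boldsymbol F_G\odot M)=\boldsymbol F_H\odot\varphi(M)$ for $\boldsymbol F\in\mathcal Q_k^P$, $\varphi(I)=I$, $\varphi(J)=J$, $\varphi(\boldsymbol F_G)=\boldsymbol F_H$ for $\boldsymbol F\in\mathcal Q_k$, $\varphi(M^\sigma)=\varphi(M)^\sigma$ for $\sigma\in\mathscr C_k$, and $\mathrm{tr}(\varphi(M))=\mathrm{tr}(M)$, for all $M,N\in\widehat{\mathcal Q}^k_G$.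
   Formalization: The relation ~ on words is taken to be the finest (generated) equivalence relation with saat ~ sat and st ~ ts; read literally, the ''coarsest'' such relation identifies all words, and then (i) fails already for G = H = K_2 while (iv) holds. *)

(* Defs.v *)
(* (+ mathcomp-real-closed's complex numbers R[i] over a realType R). *)
From HB Require Import structures.
From mathcomp Require Import all_boot all_order all_algebra all_fingroup.
From mathcomp Require Import complex reals.
From Stdlib Require Import Relations.

Set Implicit Arguments.
Unset Strict Implicit.
Unset Printing Implicit Defensive.

Import Order.TTheory GRing.Theory Num.Theory.
Local Open Scope ring_scope.

(* Graphs: a graph is given by a finite vertex type and an adjacency relation *)
(* (G, H are additionally assumed symmetric and irreflexive in the theorem).  *)

Definition is_hom (A B : finType) (eA : rel A) (eB : rel B) (h : A -> B) : bool :=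
  [forall a, forall b, eA a b ==> eB (h a) (h b)].

(* hom(F, G) *)
Definition hom_count (A B : finType) (eA : rel A) (eB : rel B) : nat :=
  #|[set h : {ffun A -> B} | is_hom eA eB h]|.

(* rel_G(g,g') : 0 = equal, 1 = adjacent, 2 = distinct non-adjacent *)
Definition rel3 (V : finType) (e : rel V) (x y : V) : nat :=
  if x == y then 0%N else if e x y then 1%N else 2%N.

(* (k,k)-bilabelled graphs                                                    *)

Record bgraph (k : nat) := BGraph {
  bV : finType;               (* vertex set of the underlying graph *)
  bE : rel bV;                (* adjacency of the underlying graph  *)
  bI : k.-tuple bV;           (* in-labels  u *)
  bO : k.-tuple bV            (* out-labels v *)
}.

Arguments bV {k} b.
Arguments bE {k} b _ _.
Arguments bI {k} b.
Arguments bO {k} b.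

(* quotient of a finite type by the equivalence relation generated by r *)
Section Quotient.
Variables (A : finType) (r : rel A).
Definition symr : rel A := fun a b => r a b || r b a.
Definition qcls (a : A) : {set A} := [set b | connect symr a b].
Definition qtype := {C : {set A} | C \in qcls @: [set: A]}.
Definition qproj (a : A) : qtype := exist _ (qcls a) (imset_f qcls (in_setT a)).
(* edges of the quotient graph (multiple edges automatically merged) *)
Definition qadj (eA : rel A) : rel qtype :=
  fun C D => [exists a, exists b, [&& eA a b, qproj a == C & qproj b == D]].
End Quotient.
Arguments qproj {A} r a.
Arguments qadj {A} r eA _ _.
Arguments qcls {A} r a.

Definition sum_adj (A B : finType) (eA : rel A) (eB : rel B) : rel (A + B)%type :=
  fun a b => match a, b with
             | inl x, inl y => eA x y
             | inr x, inr y => eB x y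
             | _, _ => false
             end.

(* series composition F . F' *)
Definition series k (F F' : bgraph k) : bgraph k :=
  let r : rel (bV F + bV F')%type := fun a b =>
    [exists i, (a == inl (tnth (bO F) i)) && (b == inr (tnth (bI F') i))] in
  @BGraph k (qtype r) (qadj r (sum_adj (bE F) (bE F')))
    (map_tuple (fun x => qproj r (inl x)) (bI F))
    (map_tuple (fun x => qproj r (inr x)) (bO F')).

(* parallel composition F (.) F' *)
Definition parallel k (F F' : bgraph k) : bgraph k :=
  let r : rel (bV F + bV F')%type := fun a b =>
    [exists i, ((a == inl (tnth (bI F) i)) && (b == inr (tnth (bI F') i)))
            || ((a == inl (tnth (bO F) i)) && (b == inr (tnth (bO F') i)))] in
  @BGraph k (qtype r) (qadj r (sum_adj (bE F) (bE F')))
    (map_tuple (fun x => qproj r (inl x)) (bI F))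
    (map_tuple (fun x => qproj r (inl x)) (bO F)).

(* F^sigma, sigma a permutation of [2k] (0-based: 'I_(k+k)) *)
Definition bperm k (F : bgraph k) (s : {perm 'I_(k + k)}) : bgraph k :=
  let w := cat_tuple (bI F) (bO F) in
  @BGraph k (bV F) (bE F)
    [tuple tnth w (s (lshift k i)) | i < k]
    [tuple tnth w (s (rshift k i)) | i < k].

(* the cyclic group C_k: generated by the map sending each entry of the cyclic
   sequence (1,..,k,2k,2k-1,..,k+1) to the next one (0-based here) *)
Definition cseq (k : nat) : seq nat := iota 0 k ++ rev (iota k k).
Definition cnext (k : nat) (a : 'I_(k + k)) : 'I_(k + k) :=
  insubd a (nth 0%N (cseq k) ((index (val a) (cseq k)).+1 %% (k + k))).
Definition in_Ck (k : nat) (s : {perm 'I_(k + k)}) : Prop :=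
  exists m : nat, forall a, s a = iter m (@cnext k) a.

(* Bilabelled minors                                                          *)

Definition del_edge k (F : bgraph k) (x y : bV F) : bgraph k :=
  @BGraph k (bV F)
    (fun a b => bE F a b && ~~ (((a == x) && (b == y)) || ((a == y) && (b == x))))
    (bI F) (bO F).

Definition keepv k (F : bgraph k) (v w : bV F) : bool :=
  [|| w != v, w \in bI F | w \in bO F].

Arguments keepv {k} F v w.
Arguments del_edge {k} F x y.

Lemma keepv_I k (F : bgraph k) (v : bV F) i : keepv F v (tnth (bI F) i).
Proof. by rewrite /keepv mem_tnth orbT. Qed.

Lemma keepv_O k (F : bgraph k) (v : bV F) i : keepv F v (tnth (bO F) i).
Proof. by rewrite /keepv mem_tnth !orbT. Qed.

(* deletion of the vertex v (used only when v is unlabelled, in which case the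
   vertex type is exactly {w | w != v}) *)
Definition del_vert k (F : bgraph k) (v : bV F) : bgraph k :=
  @BGraph k {w : bV F | keepv F v w} (fun a b => bE F (val a) (val b))
    [tuple exist _ (tnth (bI F) i) (keepv_I v i) | i < k]
    [tuple exist _ (tnth (bO F) i) (keepv_O v i) | i < k].

Arguments del_vert {k} F v.

(* contraction of the edge xy: delete it, then identify x and y *)
Definition contract k (F : bgraph k) (x y : bV F) : bgraph k :=
  let r : rel (bV F) := fun a b => (a == x) && (b == y) in
  @BGraph k (qtype r) (qadj r (bE (del_edge F x y)))
    (map_tuple (qproj r) (bI F)) (map_tuple (qproj r) (bO F)).

Arguments contract {k} F x y.

(* minor F F' : F' is a bilabelled minor of F *)
Inductive minor k (F : bgraph k) : bgraph k -> Prop :=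
| minor_refl : minor F F
| minor_dele (F' : bgraph k) (x y : bV F') :
    minor F F' -> bE F' x y -> minor F (del_edge F' x y)
| minor_delv (F' : bgraph k) (v : bV F') :
    minor F F' -> v \notin bI F' -> v \notin bO F' -> minor F (del_vert F' v)
| minor_contr (F' : bgraph k) (x y : bV F') :
    minor F F' -> x != y -> bE F' x y -> minor F (contract F' x y).

(* Atomic graphs C_k, M_k and the classes Q_k^P, Q_k^S, Q_k, P_k             *)
(* (vertex set [2k] is represented 0-based by 'I_(k+k))                      *)

Definition Ck_e (k a b : nat) : bool :=
  [|| [&& b == a.+1, a != k.-1 & a != (k + k).-1],
      (a == 0%N) && (b == k) | (a == k.-1) && (b == (k + k).-1)].

Definition Ck_graph (k : nat) : bgraph k :=
  @BGraph k 'I_(k + k)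
    (fun a b => Ck_e k a b || Ck_e k b a)
    [tuple lshift k i | i < k] [tuple rshift k i | i < k].

Definition Mk_graph (k : nat) : bgraph k :=
  @BGraph k 'I_(k + k)
    (fun a b => ((b : nat) == a + k)%N || ((a : nat) == b + k)%N)
    [tuple lshift k i | i < k] [tuple rshift k i | i < k].

Definition inQP k (F : bgraph k) : Prop := minor (Ck_graph k) F.
Definition inQS k (F : bgraph k) : Prop := minor (Mk_graph k) F.
Definition inQ k (F : bgraph k) : Prop := inQP F \/ inQS F.

Inductive inP k : bgraph k -> Prop :=
| inP_Q (F : bgraph k) : inQ F -> inP F
| inP_series (F F' : bgraph k) : inP F -> inP F' -> inP (series F F')
| inP_parallel (F Q : bgraph k) : inP F -> inQP Q -> inP (parallel F Q)
| inP_perm (F : bgraph k) (s : {perm 'I_(k + k)}) : inP F -> in_Ck s -> inP (bperm F s).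

(* homomorphism indistinguishability over P_k *)
Definition hom_indist_P (k : nat) (VG VH : finType) (eG : rel VG) (eH : rel VH) : Prop :=
  forall F : bgraph k, inP F -> hom_count (bE F) eG = hom_count (bE F) eH.

(* Matrices indexed by V^k x V^k, with complex entries (C = R[i])            *)

Section Matrices.
Variable R : realType.
Local Notation C := R[i].

Definition dimk (k : nat) (V : finType) : nat := #|{: k.-tuple V}|.

Definition ent k (V : finType) (A : 'M[C]_(dimk k V)) (x y : k.-tuple V) : C :=
  A (enum_rank x) (enum_rank y).

Definition mkmx k (V : finType) (f : k.-tuple V -> k.-tuple V -> C) : 'M[C]_(dimk k V) :=
  \matrix_(i, j) f (enum_val i) (enum_val j).

(* homomorphism tensor F_G *)
Definition hom_entry k (F : bgraph k) (V : finType) (e : rel V) (x y : k.-tuple V) : nat :=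
  #|[set h : {ffun bV F -> V} | is_hom (bE F) e h &&
      [forall i, (h (tnth (bI F) i) == tnth x i) && (h (tnth (bO F) i) == tnth y i)]]|.

Definition htens k (F : bgraph k) (V : finType) (e : rel V) : 'M[C]_(dimk k V) :=
  mkmx (fun x y => (hom_entry F e x y)%:R).

(* X^sigma *)
Definition tperm2 k (V : finType) (s : {perm 'I_(k + k)}) (x y : k.-tuple V)
  : k.-tuple V * k.-tuple V :=
  let z := cat_tuple x y in
  let w := [tuple tnth z ((s^-1)%g j) | j < k + k] in
  ([tuple tnth w (lshift k i) | i < k], [tuple tnth w (rshift k i) | i < k]).

Definition mperm k (V : finType) (s : {perm 'I_(k + k)}) (X : 'M[C]_(dimk k V))
  : 'M[C]_(dimk k V) :=
  mkmx (fun x y => ent X (tperm2 s x y).1 (tperm2 s x y).2).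

Definition hadam n (A B : 'M[C]_n) : 'M[C]_n := \matrix_(i, j) (A i j * B i j).
Definition adjmx n (A : 'M[C]_n) : 'M[C]_n := (map_mx Num.conj A)^T.
Definition Jmx n : 'M[C]_n := const_mx 1.
Definition hs n (A B : 'M[C]_n) : C := \tr (adjmx A *m B).

(* positive semidefiniteness of a block matrix (X a b)_{a,b < m} with blocks
   of size n, i.e. of a matrix in M_m (x) M_n *)
Definition blockpsd m n (X : 'I_m -> 'I_m -> 'M[C]_n) : Prop :=
  (forall a b i j, X b a j i = (X a b i j)^*) /\
  (forall v : 'I_m -> 'I_n -> C,
     0 <= \sum_a \sum_b \sum_i \sum_j ((v a i)^* * X a b i j * v b j)).

(* complete positivity: id_m (x) Phi is positive for every m *)
Definition completely_positive n p (Phi : 'M[C]_n -> 'M[C]_p) : Prop :=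
  forall m (X : 'I_m -> 'I_m -> 'M[C]_n), blockpsd X -> blockpsd (fun a b => Phi (X a b)).

Definition is_adjoint n p (Phi : 'M[C]_n -> 'M[C]_p) (Psi : 'M[C]_p -> 'M[C]_n) : Prop :=
  forall A B, hs (Phi A) B = hs A (Psi B).

(* level-k quantum isomorphism map *)
Record qi_map (k : nat) (VG VH : finType) (eG : rel VG) (eH : rel VH)
  (Phi : {linear 'M[C]_(dimk k VG) -> 'M[C]_(dimk k VH)}) : Prop := {
  qi_cp : completely_positive Phi;
  qi_had : forall (F : bgraph k) X, inQP F ->
             Phi (hadam (htens F eG) X) = hadam (htens F eH) (Phi X);
  qi_I : Phi 1%:M = 1%:M;
  qi_J : Phi (Jmx _) = Jmx _;
  qi_adj : exists Psi, is_adjoint Phi Psi /\ Psi 1%:M = 1%:M /\ Psi (Jmx _) = Jmx _;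
  qi_hom : forall F : bgraph k, inQ F -> Phi (htens F eG) = htens F eH;
  qi_perm : forall s X, in_Ck s -> Phi (mperm s X) = mperm s (Phi X)
}.

(* the algebra \hat Q^k_G *)
Inductive inQhat (k : nat) (V : finType) (e : rel V) : 'M[C]_(dimk k V) -> Prop :=
| qh_I : inQhat e 1%:M
| qh_J : inQhat e (Jmx _)
| qh_add A B : inQhat e A -> inQhat e B -> inQhat e (A + B)
| qh_scale (a : C) A : inQhat e A -> inQhat e (a *: A)
| qh_mul A B : inQhat e A -> inQhat e B -> inQhat e (A *m B)
| qh_adj A : inQhat e A -> inQhat e (adjmx A)
| qh_had (F : bgraph k) A : inQP F -> inQhat e A -> inQhat e (hadam (htens F e) A)
| qh_perm s A : in_Ck s -> inQhat e A -> inQhat e (mperm s A)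
| qh_hom (F : bgraph k) : inQ F -> inQhat e (htens F e).

(* phi : \hat Q^k_G -> \hat Q^k_H witnessing algebraic k-equivalence *)
Record alg_iso (k : nat) (VG VH : finType) (eG : rel VG) (eH : rel VH)
  (phi : 'M[C]_(dimk k VG) -> 'M[C]_(dimk k VH)) : Prop := {
  ai_into : forall M, inQhat eG M -> inQhat eH (phi M);
  ai_lin : forall (a : C) M N, inQhat eG M -> inQhat eG N ->
             phi (a *: M + N) = a *: phi M + phi N;
  ai_inj : forall M N, inQhat eG M -> inQhat eG N -> phi M = phi N -> M = N;
  ai_surj : forall M', inQhat eH M' -> exists2 M, inQhat eG M & phi M = M';
  ai_adj : forall M, inQhat eG M -> phi (adjmx M) = adjmx (phi M);
  ai_mul : forall M N, inQhat eG M -> inQhat eG N -> phi (M *m N) = phi M *m phi N;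
  ai_had : forall (F : bgraph k) M, inQP F -> inQhat eG M ->
             phi (hadam (htens F eG) M) = hadam (htens F eH) (phi M);
  ai_I : phi 1%:M = 1%:M;
  ai_J : phi (Jmx _) = Jmx _;
  ai_hom : forall F : bgraph k, inQ F -> phi (htens F eG) = htens F eH;
  ai_perm : forall s M, in_Ck s -> inQhat eG M -> phi (mperm s M) = mperm s (phi M);
  ai_tr : forall M, inQhat eG M -> \tr (phi M) = \tr M
}.

Definition alg_equiv (k : nat) (VG VH : finType) (eG : rel VG) (eH : rel VH) : Prop :=
  exists phi, @alg_iso k VG VH eG eH phi.

(* NPA certificates                                                           *)

(* sum over all words of length at most k *)
Definition wsum (k : nat) (S : finType) (f : seq S -> C) : C :=
  \sum_(n < k.+1) \sum_(t : n.-tuple S) f (tval t).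

Inductive wstep (S : Type) : seq S -> seq S -> Prop :=
| ws_dup s a t : wstep (s ++ a :: a :: t) (s ++ a :: t)
| ws_rot s t : wstep (s ++ t) (t ++ s).

(* ~ : the equivalence relation generated by wstep *)
Definition wequiv (S : Type) : seq S -> seq S -> Prop := clos_refl_sym_trans (seq S) (@wstep S).

(* a certificate M : Sigma^{<=k} x Sigma^{<=k} -> C (values on longer words
   are irrelevant) *)
Record npa_cert (k : nat) (VG VH : finType) (eG : rel VG) (eH : rel VH)
  (M : seq (VG * VH) -> seq (VG * VH) -> C) : Prop := {
  npa_herm : forall s t, (size s <= k)%N -> (size t <= k)%N -> M t s = (M s t)^*;
  npa_psd : forall x : seq (VG * VH) -> C,
      0 <= wsum k (fun s => wsum k (fun t => (x s)^* * M s t * x t));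
  npa_one : M [::] [::] = 1;
  npa_equiv : forall s t s' t', (size s <= k)%N -> (size t <= k)%N ->
      (size s' <= k)%N -> (size t' <= k)%N ->
      wequiv (rev s ++ t) (rev s' ++ t') -> M s t = M s' t';
  npa_sumH_l : forall s s' g h t, (size (s ++ (g, h) :: s') <= k)%N -> (size t <= k)%N ->
      \sum_(h' : VH) M (s ++ (g, h') :: s') t = M (s ++ s') t;
  npa_sumG_l : forall s s' g h t, (size (s ++ (g, h) :: s') <= k)%N -> (size t <= k)%N ->
      \sum_(g' : VG) M (s ++ (g', h) :: s') t = M (s ++ s') t;
  npa_sumH_r : forall s s' g h t, (size (s ++ (g, h) :: s') <= k)%N -> (size t <= k)%N ->
      \sum_(h' : VH) M t (s ++ (g, h') :: s') = M t (s ++ s');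
  npa_sumG_r : forall s s' g h t, (size (s ++ (g, h) :: s') <= k)%N -> (size t <= k)%N ->
      \sum_(g' : VG) M t (s ++ (g', h) :: s') = M t (s ++ s');
  npa_zero : forall s t p q g h g' h', (size s <= k)%N -> (size t <= k)%N ->
      rev s ++ t = p ++ (g, h) :: (g', h') :: q ->
      rel3 eG g g' <> rel3 eH h h' -> M s t = 0
}.

End Matrices.

(* Main.v *)
From HB Require Import structures.
From mathcomp Require Import all_boot all_order all_algebra all_fingroup.
From mathcomp Require Import complex reals boolp ring zify.
Require Import Defs.

(** The pairs of tensors [(F_G, F_H)] with [F] in [P_k] span a space [W] closed
    under products, adjoints, Schur products with [Q_k^P] and the rotations.
    If [G] and [H] are indistinguishable over [P_k], both components of an
    element of [W] have the same sum of entries, hence the same trace, so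
    [W] is the graph of a trace-preserving *-isomorphism. For an orthonormal
    basis [(A_l, B_l)] of [W], the kernel [P = sum_l conj(A_l) (x) B_l]
    satisfies [P^2 = P (1 (x) sum_l B_l^* B_l)], hence is positive semidefinite,
    and moving operators from one tensor factor to the other yields the NPA
    conditions on words of length [2k]; shorter words are obtained by averaging
    over the missing letters. Conversely, an NPA certificate is the Choi matrix
    of a quantum isomorphism map, and the Kraus operators of such a map [Phi]
    intertwine every [Z] of [\hat Q^k_G] with [Phi Z], which makes [Phi]
    multiplicative there. *)

Set Implicit Arguments.
Unset Strict Implicit.
Unset Printing Implicit Defensive.

Import Order.TTheory GRing.Theory Num.Theory.
Local Open Scope ring_scope.

(** * Positive semidefinite kernels *)

(** The obstacle in passing from counts to a certificate is positivity. [P] is the Choi matrix of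
    [X |-> sum_l <A_l, X> B_l], that is, of the orthogonal projection onto the first components
    followed by the isomorphism; the relation for [P^2] gives its positivity without conditional
    expectations or block decompositions of the algebra. The trace is a second difficulty: closing
    up a graph by identifying its in-labels with its out-labels is not an operation of [P_k], so the
    trace is reached from the sum of entries by a chain of identities, one pair of labels at a time.
    Closure of [W] under adjoints is not built in either: transposition is a reflection of the
    cyclic sequence, and [P_k] has to be shown stable under it. Finally, two words of length at most
    [2k] may be equivalent through longer words, on which no functional is available; condition (2)
    is therefore derived from a normal form of cyclic words. *)

Section PsdKernels.
Variable C : numClosedFieldType.

Definition hermk (T : finType) (K : T -> T -> C) := forall s t, K t s = (K s t)^*.

Definition qform (T : finType) (K : T -> T -> C) (v : T -> C) : C :=
  \sum_s \sum_t (v s)^* * K s t * v t.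

Definition psdk (T : finType) (K : T -> T -> C) :=
  hermk K /\ forall v, 0 <= qform K v.

Lemma sum_delta (T : finType) (t0 : T) (F : T -> C) :
  \sum_t (t == t0)%:R * F t = F t0.
Proof.
rewrite (bigD1 t0) //= eqxx mul1r big1 ?addr0 // => i /negbTE->.
by rewrite mul0r.
Qed.

(** The spectral theorem for the normal matrix of [K]. The rows of the unitary matrix are the [u i],
    so the eigenvectors of [K] are their conjugates, as [hermk_eigen] records. *)
Lemma hermk_spectral (T : finType) (K : T -> T -> C) : hermk K ->
  exists (l : 'I_#|T| -> C) (u : 'I_#|T| -> T -> C),
    (forall i j, \sum_t u i t * (u j t)^* = (i == j)%:R) /\
    (forall s t, K s t = \sum_i (u i s)^* * l i * u i t).
Proof.
move=> hK.
pose A : 'M[C]_#|T| := \matrix_(i, j) K (enum_val i) (enum_val j).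
have An : A \is normalmx.
  apply/normalmxP; suff -> : map_mx Num.conj A^T = A by [].
  by apply/matrixP => i j; rewrite !mxE -hK.
have /orthomx_spectralP := An.
have U := spectral_unitarymx A.
move: (spectralmx A) (spectral_diag A) U => P d PU.
rewrite invmx_unitary // => EA.
exists (fun i => d 0 i), (fun i t => P i (enum_rank t)); split=> [i j|s t].
  have /unitarymxP /matrixP /(_ i j) := PU.
  rewrite !mxE => <-.
  rewrite (reindex (@enum_rank T)) /=; last first.
    by exists enum_val => x _; rewrite ?enum_rankK ?enum_valK.
  by apply: eq_bigr => t _; rewrite !mxE.
have /matrixP /(_ (enum_rank s) (enum_rank t)) := EA.
rewrite !mxE !enum_rankK => ->; apply: eq_bigr => i _.
rewrite !mxE (bigD1 i) //= !mxE eqxx mulr1n big1 ?addr0 // => j /negbTE nij.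
by rewrite !mxE nij mulr0n mulr0.
Qed.

Lemma qform_gram (T : finType) m (l : 'I_m -> C) (u : 'I_m -> T -> C) v :
  qform (fun s t => \sum_i (u i s)^* * l i * u i t) v =
  \sum_i l i * ((\sum_t u i t * v t)^* * (\sum_t u i t * v t)).
Proof.
rewrite /qform.
under eq_bigr do under eq_bigr do rewrite mulr_sumr mulr_suml.
under eq_bigr do rewrite exchange_big /=.
rewrite exchange_big /=; apply: eq_bigr => i _.
rewrite rmorph_sum big_distrl mulr_sumr; apply: eq_bigr => s _.
rewrite big_distrr mulr_sumr; apply: eq_bigr => t _.
by rewrite rmorphM /=; ring.
Qed.

Lemma eq_qform (T : finType) (K K' : T -> T -> C) v :
  (forall s t, K s t = K' s t) -> qform K v = qform K' v.
Proof. by move=> E; apply: eq_bigr => s _; apply: eq_bigr => t _; rewrite E. Qed.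

Lemma hermk_eigen (T : finType) (K : T -> T -> C) m (l : 'I_m -> C) u :
  (forall i j, \sum_t u i t * (u j t)^* = (i == j)%:R) ->
  (forall s t, K s t = \sum_i (u i s)^* * l i * u i t) ->
  forall i s, \sum_t K s t * (u i t)^* = l i * (u i s)^*.
Proof.
move=> hu hK i s; under eq_bigr do rewrite hK mulr_suml.
rewrite exchange_big /=.
under eq_bigr do under eq_bigr do rewrite -mulrA.
under eq_bigr do rewrite -mulr_sumr hu mulrC.
by rewrite sum_delta mulrC.
Qed.

(** Testing the form on the eigenvectors shows that the eigenvalues are nonnegative; their square
    roots are absorbed into the vectors. This is the source of all Kraus operators below. *)
Lemma psdk_gram (T : finType) (K : T -> T -> C) : psdk K ->
  exists (c : 'I_#|T| -> T -> C), forall s t, K s t = \sum_i (c i s)^* * c i t.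
Proof.
case=> hK pK; have [l [u [hu hlu]]] := hermk_spectral hK.
have l_ge0 i : 0 <= l i.
  have := pK (fun t => (u i t)^*).
  rewrite (eq_qform _ hlu) qform_gram (bigD1 i) //= hu eqxx conjC1 !mulr1.
  rewrite big1 ?addr0 // => j /negbTE nij.
  by rewrite hu nij mulr0 mulr0.
exists (fun i t => sqrtC (l i) * u i t) => s t; rewrite hlu.
apply: eq_bigr => i _; rewrite rmorphM /= (conj_Creal (x := sqrtC (l i))).
  by rewrite mulrACA -expr2 sqrtCK; ring.
by apply: ger0_real; rewrite sqrtC_ge0.
Qed.

Lemma psdk_of_gram (T : finType) m (l : 'I_m -> C) (u : 'I_m -> T -> C) :
  (forall i, 0 <= l i) -> psdk (fun s t => \sum_i (u i s)^* * l i * u i t).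
Proof.
move=> l_ge0; split=> [s t|v].
  rewrite rmorph_sum; apply: eq_bigr => i _.
  rewrite !rmorphM /= conjCK (conj_Creal (ger0_real (l_ge0 i))).
  by ring.
rewrite qform_gram; apply: sumr_ge0 => i _; apply: mulr_ge0 => //.
by rewrite mulrC mul_conjC_ge0.
Qed.

(* On an eigenvector of eigenvalue [l], the relation [KK = KB] reads
   [l ^ 2 = l * b] with [b >= 0], so [l >= 0]. *)
Lemma psdk_of_sqr (T : finType) (K B : T -> T -> C) :
  hermk K -> (forall s r, \sum_t K s t * K t r = \sum_t K s t * B t r) ->
  (forall v, 0 <= qform B v) -> psdk K.
Proof.
move=> hK KB pB; have [l [u [hu hlu]]] := hermk_spectral hK.
have ev := hermk_eigen hu hlu.
have l_real i : (l i)^* = l i.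
  have E : qform K (fun t => (u i t)^*) = l i.
    rewrite (eq_qform _ hlu) qform_gram (bigD1 i) //= hu eqxx conjC1 !mulr1.
    rewrite big1 ?addr0 // => j /negbTE nij.
    by rewrite hu nij mulr0 mulr0.
  rewrite -E /qform rmorph_sum /= exchange_big /=.
  under eq_bigr do rewrite rmorph_sum /=.
  apply: eq_bigr => s _; apply: eq_bigr => t _.
  by rewrite !rmorphM /= -hK !conjCK; ring.
suff l_ge0 i : 0 <= l i.
  have [h1 h2] := psdk_of_gram u l_ge0; split=> // v.
  by rewrite (eq_qform _ hlu).
pose v t := (u i t)^*.
(* [v] is an eigenvector from the left as well, because [K] is hermitian and [l i] is real. *)
have vKE r : \sum_s (v s)^* * K s r = l i * (v r)^*.
  apply: (can_inj conjCK); rewrite rmorph_sum /= rmorphM /= l_real conjCK -ev.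
  by apply: eq_bigr => t _; rewrite rmorphM /= conjCK -hK mulrC.
(* Two evaluations of the form of [KK = KB] at the unit vector [v]. *)
have : l i * l i = l i * qform B v.
  transitivity (\sum_s \sum_r (v s)^* * (\sum_t K s t * K t r) * v r).
    transitivity (\sum_s (v s)^* * (l i * (l i * v s))).
      under eq_bigr do rewrite mulrCA [X in _ * X]mulrCA.
      rewrite -!mulr_sumr; under eq_bigr do rewrite conjCK.
      by rewrite hu eqxx mulr1.
    apply: eq_bigr => s _.
    under [RHS]eq_bigr do rewrite -mulrA.
    rewrite -mulr_sumr; congr (_ * _).
    under [RHS]eq_bigr do rewrite mulr_suml.
    rewrite exchange_big /=.
    under [RHS]eq_bigr do under eq_bigr do rewrite -mulrA.
    under [RHS]eq_bigr do rewrite -mulr_sumr ev mulrCA.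
    by rewrite -mulr_sumr ev.
  under eq_bigr do under eq_bigr do rewrite KB mulr_sumr mulr_suml.
  under eq_bigr do rewrite exchange_big /=.
  rewrite exchange_big /= /qform mulr_sumr; apply: eq_bigr => t _.
  rewrite exchange_big /= mulr_sumr; apply: eq_bigr => r _.
  under eq_bigr do rewrite !mulrA -mulrA.
  by rewrite -mulr_suml vKE !mulrA.
have [->//|l0 /(mulfI l0) ->] := eqVneq (l i) 0.
exact: pB.
Qed.

End PsdKernels.

(** * Entries, labels and the rotation group *)

(** Rotations mix in-labels and out-labels, so a pair of matrix indices is handled as one function
    on the [2k] label positions; [lz] and [rz] are its halves. *)
Definition zf k (V : Type) (x y : k.-tuple V) : 'I_(k + k) -> V :=
  tnth (cat_tuple x y).

Definition lz k (V : Type) (z : 'I_(k + k) -> V) : k.-tuple V :=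
  [tuple z (lshift k i) | i < k].

Definition rz k (V : Type) (z : 'I_(k + k) -> V) : k.-tuple V :=
  [tuple z (rshift k i) | i < k].

Section PairIndex.
Variables (k : nat) (V : Type).
Implicit Types (x y : k.-tuple V) (z : 'I_(k + k) -> V).

Lemma zf_l x y i : zf x y (lshift k i) = tnth x i.
Proof. by rewrite /zf tnth_lshift. Qed.

Lemma zf_r x y i : zf x y (rshift k i) = tnth y i.
Proof. by rewrite /zf tnth_rshift. Qed.

Lemma lz_zf x y : lz (zf x y) = x.
Proof. by apply: eq_from_tnth => i; rewrite tnth_mktuple zf_l. Qed.

Lemma rz_zf x y : rz (zf x y) = y.
Proof. by apply: eq_from_tnth => i; rewrite tnth_mktuple zf_r. Qed.

Lemma zf_lrz z : zf (lz z) (rz z) = z.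
Proof.
apply: funext => a; case: (split_ordP a) => i ->.
  by rewrite zf_l tnth_mktuple.
by rewrite zf_r tnth_mktuple.
Qed.

End PairIndex.

Section Entries.
Variables (R : realType) (k : nat).
Local Notation C := R[i].

Section OneType.
Variable V : finType.
Implicit Types (A B : 'M[C]_(dimk k V)) (x y : k.-tuple V) (z : 'I_(k + k) -> V).

Lemma ent_mkmx f x y : ent (mkmx f : 'M[C]_(dimk k V)) x y = f x y.
Proof. by rewrite /ent mxE !enum_rankK. Qed.

Lemma ent_inj A B : (forall x y, ent A x y = ent B x y) -> A = B.
Proof.
move=> E; apply/matrixP => i j.
by have := E (enum_val i) (enum_val j); rewrite /ent !enum_valK.
Qed.

Lemma sum_dimk (F : 'I_(dimk k V) -> C) :
  \sum_i F i = \sum_(x : k.-tuple V) F (enum_rank x).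
Proof.
rewrite (reindex (@enum_rank {: k.-tuple V})) //=.
by exists enum_val => x _; rewrite ?enum_rankK ?enum_valK.
Qed.

Lemma ent_mul A B x y : ent (A *m B) x y = \sum_t ent A x t * ent B t y.
Proof. by rewrite /ent mxE sum_dimk. Qed.

Lemma trE A : \tr A = \sum_x ent A x x.
Proof. by rewrite /mxtrace sum_dimk. Qed.

Lemma ent_add A B x y : ent (A + B) x y = ent A x y + ent B x y.
Proof. by rewrite /ent mxE. Qed.

Lemma ent_scale c A x y : ent (c *: A) x y = c * ent A x y.
Proof. by rewrite /ent mxE. Qed.

Lemma ent0 x y : ent (0 : 'M[C]_(dimk k V)) x y = 0.
Proof. by rewrite /ent mxE. Qed.

Lemma ent_sum I (r : seq I) (F : I -> 'M[C]_(dimk k V)) x y :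
  ent (\sum_(i <- r) F i) x y = \sum_(i <- r) ent (F i) x y.
Proof.
elim/big_rec2: _ => [|i a b _ <-]; first exact: ent0.
by rewrite ent_add.
Qed.

Lemma ent_hadam A B x y : ent (hadam A B) x y = ent A x y * ent B x y.
Proof. by rewrite /ent mxE. Qed.

Lemma ent_adj A x y : ent (adjmx A) x y = (ent A y x)^*.
Proof. by rewrite /ent !mxE. Qed.

Lemma ent_1 x y : ent (1%:M : 'M[C]_(dimk k V)) x y = (x == y)%:R.
Proof. by rewrite /ent mxE (inj_eq enum_rank_inj). Qed.

Lemma ent_J x y : ent (@Jmx R (dimk k V)) x y = 1.
Proof. by rewrite /ent mxE. Qed.

Lemma ent_htens F (e : rel V) x y : ent (htens R F e) x y = (hom_entry F e x y)%:R.
Proof. exact: ent_mkmx. Qed.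

Definition entz A z := ent A (lz z) (rz z).

Lemma entz_zf A x y : entz A (zf x y) = ent A x y.
Proof. by rewrite /entz lz_zf rz_zf. Qed.

Lemma tperm2E (s : {perm 'I_(k + k)}) x y :
  tperm2 s x y = (lz (zf x y \o (s^-1)%g), rz (zf x y \o (s^-1)%g)).
Proof.
rewrite /tperm2; congr pair; apply: eq_from_tnth => i;
by rewrite !tnth_mktuple.
Qed.

Lemma ent_mperm s A x y : ent (mperm s A) x y = entz A (zf x y \o (s^-1)%g).
Proof. by rewrite ent_mkmx tperm2E. Qed.

Lemma entz_mperm s A z : entz (mperm s A) z = entz A (z \o (s^-1)%g).
Proof. by rewrite {1}/entz ent_mperm zf_lrz. Qed.

Lemma entz_inj A B : (forall z, entz A z = entz B z) -> A = B.
Proof. by move=> E; apply: ent_inj => x y; rewrite -!entz_zf E. Qed.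

Lemma sum_lrz (s : {perm 'I_(k + k)}) (F : ('I_(k + k) -> V) -> C) :
  \sum_x \sum_y F (zf x y \o s) = \sum_x \sum_y F (zf x y).
Proof.
rewrite !pair_bigA /= [RHS](reindex (fun p : k.-tuple V * k.-tuple V =>
   (lz (zf p.1 p.2 \o s), rz (zf p.1 p.2 \o s)))) /=; last first.
  exists (fun p => (lz (zf p.1 p.2 \o (s^-1)%g), rz (zf p.1 p.2 \o (s^-1)%g)));
    move=> [x y] _ /=; rewrite zf_lrz.
    rewrite (_ : (_ \o _) = zf x y) ?lz_zf ?rz_zf //.
    by apply: funext => a /=; rewrite permKV.
  rewrite (_ : (_ \o _) = zf x y) ?lz_zf ?rz_zf //.
  by apply: funext => a /=; rewrite permK.
by apply: eq_bigr => p _; rewrite zf_lrz.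
Qed.

Lemma hsE A B : hs A B = \sum_x \sum_y (ent A x y)^* * ent B x y.
Proof.
rewrite /hs trE exchange_big; apply: eq_bigr => y _.
by rewrite ent_mul; apply: eq_bigr => x _; rewrite ent_adj.
Qed.

Lemma hs_mperm s A B : hs (mperm s A) B = hs A (mperm (s^-1)%g B).
Proof.
pose F z := (entz A (z \o (s^-1)%g))^* * entz B z.
rewrite !hsE (_ : \sum_x _ = \sum_x \sum_y F (zf x y)); last first.
  by apply: eq_bigr => x _; apply: eq_bigr => y _; rewrite ent_mperm -[ent B _ _]entz_zf.
rewrite -(sum_lrz s F) /F.
apply: eq_bigr => x _; apply: eq_bigr => y _.
rewrite ent_mperm invgK -entz_zf; congr ((entz A _)^* * _).
by apply: funext => a /=; rewrite permKV.
Qed.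

Lemma sum_entries A : \sum_x \sum_y ent A x y = hs (@Jmx R _) A.
Proof.
rewrite hsE; apply: eq_bigr => x _; apply: eq_bigr => y _.
by rewrite ent_J conjC1 mul1r.
Qed.

Lemma tr_mulJ A : \tr (A *m @Jmx R _) = \sum_x \sum_y ent A x y.
Proof.
rewrite trE; apply: eq_bigr => x _; rewrite ent_mul.
by apply: eq_bigr => y _; rewrite ent_J mulr1.
Qed.

End OneType.
End Entries.

(** * The Hilbert-Schmidt inner product *)

Section HilbertSchmidt.
Variables (R : realType) (n : nat).
Local Notation C := R[i].
Implicit Types A B D : 'M[C]_n.

Lemma hs_sumE A B : hs A B = \sum_i \sum_j (A i j)^* * B i j.
Proof.
rewrite /hs /mxtrace exchange_big; apply: eq_bigr => j _.
by rewrite !mxE; apply: eq_bigr => i _; rewrite !mxE.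
Qed.

Lemma hs_conj A B : (hs A B)^* = hs B A.
Proof.
rewrite !hs_sumE rmorph_sum; apply: eq_bigr => i _.
rewrite rmorph_sum; apply: eq_bigr => j _.
by rewrite rmorphM /= conjCK mulrC.
Qed.

Lemma hsDr A B D : hs A (B + D) = hs A B + hs A D.
Proof. by rewrite /hs mulmxDr mxtraceD. Qed.

Lemma hsZr c A B : hs A (c *: B) = c * hs A B.
Proof. by rewrite /hs -scalemxAr mxtraceZ. Qed.

Lemma hsZl c A B : hs (c *: A) B = c^* * hs A B.
Proof. by rewrite -hs_conj hsZr rmorphM /= hs_conj. Qed.

Lemma hs0r A : hs A 0 = 0.
Proof. by rewrite /hs mulmx0 mxtrace0. Qed.

Lemma hs_sumr A I (r : seq I) (F : I -> 'M[C]_n) :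
  hs A (\sum_(i <- r) F i) = \sum_(i <- r) hs A (F i).
Proof. by elim/big_rec2: _ => [|i a b _ <-]; rewrite ?hs0r ?hsDr. Qed.

Lemma hs_ge0 A : 0 <= hs A A.
Proof.
rewrite hs_sumE; apply: sumr_ge0 => i _; apply: sumr_ge0 => j _.
by rewrite mulrC mul_conjC_ge0.
Qed.

Lemma hs_eq0 A : hs A A = 0 -> A = 0.
Proof.
move=> /eqP; rewrite hs_sumE psumr_eq0 => [/allP H|i _]; last first.
  by apply: sumr_ge0 => j _; rewrite mulrC mul_conjC_ge0.
apply/matrixP => i j; rewrite mxE.
have := H i (mem_index_enum i); rewrite /= psumr_eq0 => [/allP H'|j' _]; last first.
  by rewrite mulrC mul_conjC_ge0.
by have := H' j (mem_index_enum j); rewrite /= mulrC mul_conjC_eq0 => /eqP.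
Qed.

Lemma adjmxK A : adjmx (adjmx A) = A.
Proof. by apply/matrixP => i j; rewrite !mxE conjCK. Qed.

Lemma adjmxM A B : adjmx (A *m B) = adjmx B *m adjmx A.
Proof. by rewrite /adjmx map_mxM trmx_mul. Qed.

Lemma adjmxD A B : adjmx (A + B) = adjmx A + adjmx B.
Proof. by rewrite /adjmx map_mxD linearD. Qed.

Lemma adjmxZ c A : adjmx (c *: A) = c^* *: adjmx A.
Proof. by apply/matrixP => i j; rewrite !mxE rmorphM. Qed.

Lemma adjmx1 : adjmx (1%:M : 'M[C]_n) = 1%:M.
Proof. by apply/matrixP => i j; rewrite !mxE conjC_nat eq_sym. Qed.

Lemma hs_adj A B : hs (adjmx A) B = hs (adjmx B) A.
Proof. by rewrite /hs !adjmxK mxtrace_mulC. Qed.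

Lemma hs_mulr A B D : hs A (B *m D) = hs (A *m adjmx D) B.
Proof. by rewrite /hs adjmxM adjmxK mulmxA mxtrace_mulC mulmxA. Qed.

Lemma hs_mull A B D : hs A (B *m D) = hs (adjmx B *m A) D.
Proof. by rewrite /hs adjmxM adjmxK mulmxA. Qed.

Lemma hs_1l A : hs 1%:M A = \tr A.
Proof. by rewrite /hs adjmx1 mul1mx. Qed.

Lemma hs_hadam A B D : (forall i j, (A i j)^* = A i j) ->
  hs (hadam A B) D = hs B (hadam A D).
Proof.
move=> Ar; rewrite !hs_sumE; apply: eq_bigr => i _; apply: eq_bigr => j _.
by rewrite !mxE rmorphM /= Ar; ring.
Qed.

End HilbertSchmidt.

Section CyclicGroup.
Variable k : nat.

(** [in_Ck] only offers nonnegative powers of the generator; the inverse is one of them since [s]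
    has finite order. *)
Lemma in_Ck_inv (s : {perm 'I_(k + k)}) : in_Ck s -> in_Ck (s^-1)%g.
Proof.
case=> m sm; exists (m * #[s]%g.-1)%N => a.
have -> : (s^-1 = s ^+ #[s]%g.-1)%g.
  by apply: (mulgI s); rewrite -expgS mulgV prednK ?order_gt0 ?expg_order.
rewrite permX mulnC; elim: (#[s]%g.-1) => [|j IH] //=.
by rewrite mulSn iterD -IH sm.
Qed.

(** The generator in arithmetic form; it runs through [0, .., k-1, 2k-1, .., k] and back to [0]. *)
Definition cnext_val (a : nat) : nat :=
  if (a < k.-1)%N then a.+1 else if a == k.-1 then (k + k).-1
  else if a == k then 0%N else a.-1.

Lemma size_cseq : size (cseq k) = (k + k)%N.
Proof. by rewrite size_cat size_rev !size_iota. Qed.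

Lemma nth_cseq j : (j < k + k)%N ->
  nth 0%N (cseq k) j = if (j < k)%N then j else ((k + k).-1 - (j - k))%N.
Proof.
move=> jk; rewrite nth_cat size_iota; case: ifP => jk'; first by rewrite nth_iota.
by rewrite nth_rev size_iota ?nth_iota; lia.
Qed.

Lemma uniq_cseq : uniq (cseq k).
Proof.
rewrite cat_uniq rev_uniq !iota_uniq andbT /=; apply/hasPn => x.
by rewrite mem_rev !mem_iota; lia.
Qed.

Lemma index_cseq a : (a < k + k)%N ->
  index a (cseq k) = if (a < k)%N then a else (k + ((k + k).-1 - a))%N.
Proof.
move=> ak; set j := (if _ then _ else _).
have jk : (j < k + k)%N by rewrite /j; case: ifP; lia.
have {1}-> : a = nth 0%N (cseq k) j.
  rewrite nth_cseq // /j; case: (ltnP a k) => h; first by rewrite h.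
  by case: ifP; lia.
by rewrite index_uniq ?uniq_cseq ?size_cseq.
Qed.

Lemma cnextE (a : 'I_(k + k)) : cnext a = cnext_val a :> nat.
Proof.
have ak := ltn_ord a.
rewrite /cnext index_cseq //= val_insubd.
have E : nth 0%N (cseq k)
   ((if (a < k)%N then nat_of_ord a else (k + ((k + k).-1 - a))%N).+1 %% (k + k)) = cnext_val a.
  case: (ltnP a k) => h.
    rewrite modn_small; last by lia.
    rewrite nth_cseq; last by lia.
    by rewrite /cnext_val; do ?case: ifP => ?; lia.
  have [->|/eqP ak0] := eqVneq (nat_of_ord a) k.
    rewrite (_ : _.+1 = k + k)%N ?modnn; last by lia.
    rewrite nth_cseq; last by lia.
    rewrite /cnext_val; do ?case: ifP => ?; lia.
  rewrite modn_small; last by lia.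
  rewrite nth_cseq; last by lia.
  rewrite /cnext_val; do ?case: ifP => ?; lia.
by rewrite E ifT // /cnext_val; do ?case: ifP => ?; lia.
Qed.

Lemma cnext_inj : injective (@cnext k).
Proof.
move=> a b /(congr1 val) /=; rewrite !cnextE /cnext_val => E; apply: val_inj => /=.
have := ltn_ord a; have := ltn_ord b; move: E.
by do ?case: ifP => ?; lia.
Qed.

Definition crot : {perm 'I_(k + k)} := perm cnext_inj.

Lemma crot_Ck : in_Ck crot.
Proof. by exists 1%N => a; rewrite permE. Qed.

End CyclicGroup.

(** * Homomorphism tensors of glued graphs *)

Section QuotientMaps.
Variables (A : finType) (r : rel A).

Lemma qproj_surj (c : qtype r) : exists a, qproj r a == c.
Proof.
case: c => S hS; have /imsetP[a _ Sa] := hS.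
by exists a; apply/eqP; apply: val_inj => /=; rewrite Sa.
Qed.

Definition qrepr (c : qtype r) : A := xchoose (qproj_surj c).

Lemma qreprK : cancel qrepr (qproj r).
Proof. by move=> c; apply/eqP; exact: (xchooseP (qproj_surj c)). Qed.

Lemma qproj_rel a b : r a b -> qproj r a = qproj r b.
Proof.
move=> rab; apply: val_inj => /=; apply/setP => c; rewrite !inE.
have sym : connect_sym (symr r).
  by apply: sym_connect_sym => u v; rewrite /symr orbC.
have cab : connect (symr r) a b by apply: connect1; rewrite /symr rab.
exact: (same_connect sym cab).
Qed.

Lemma qproj_eq_map (T : Type) (f : A -> T) a b :
  (forall u v, r u v -> f u = f v) -> qproj r a = qproj r b -> f a = f b.
Proof.
move=> fr /(congr1 val) /= /setP /(_ b); rewrite !inE connect0.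
case/connectP => p; elim: p a => [|c p IH] a /=; first by move=> _ ->.
case/andP => ac pc lb; rewrite -(IH c pc lb).
by case/orP: ac => /fr.
Qed.

End QuotientMaps.

Definition csum (A B V : Type) (g1 : A -> V) (g2 : B -> V) (s : A + B) : V :=
  match s with inl a => g1 a | inr b => g2 b end.

(** Homomorphisms from a quotient of a disjoint union are the pairs of homomorphisms that agree
    along [r], by the universal property of the quotient. The predicate [L] stands for the label
    constraints, so that series and parallel composition are both instances. *)
Lemma card_glue_hom (A B V : finType) (r : rel (A + B)%type) (eA : rel A)
    (eB : rel B) (e : rel V) (L : (A -> V) -> (B -> V) -> bool) :
  #|[set h : {ffun qtype r -> V} | is_hom (qadj r (sum_adj eA eB)) e h &&
       L (fun a => h (qproj r (inl a))) (fun b => h (qproj r (inr b)))]| =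
  #|[set p : {ffun A -> V} * {ffun B -> V} |
      [&& is_hom eA e p.1, is_hom eB e p.2,
          [forall s, forall t, r s t ==> (csum p.1 p.2 s == csum p.1 p.2 t)] &
          L p.1 p.2]]|.
Proof.
pose f (h : {ffun qtype r -> V}) : {ffun A -> V} * {ffun B -> V} :=
  ([ffun a => h (qproj r (inl a))], [ffun b => h (qproj r (inr b))]).
have finj : injective f.
  move=> h1 h2 [/ffunP E1 /ffunP E2]; apply/ffunP => c; rewrite -(qreprK c).
  by case: (qrepr c) => a; [have := E1 a | have := E2 a]; rewrite !ffunE.
have fE1 h : (f h).1 = (fun a => h (qproj r (inl a))) :> (A -> V).
  by apply: funext => a; rewrite ffunE.
have fE2 h : (f h).2 = (fun b => h (qproj r (inr b))) :> (B -> V).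
  by apply: funext => b; rewrite ffunE.
rewrite -(card_imset _ finj); apply: eq_card => p; apply/imsetP/idP.
  case=> h; rewrite inE => /andP[/forallP hh hL] ->.
  have hom a b : sum_adj eA eB a b -> e (h (qproj r a)) (h (qproj r b)).
    move=> eab; have /forallP /(_ (qproj r b)) := hh (qproj r a).
    move=> /implyP; apply; apply/existsP; exists a; apply/existsP; exists b.
    by rewrite eab !eqxx.
  rewrite inE fE1 fE2 hL andbT; apply/and3P; split.
  - apply/forallP => a; apply/forallP => b; apply/implyP => ab.
    by apply: (hom (inl a) (inl b)).
  - apply/forallP => a; apply/forallP => b; apply/implyP => ab.
    by apply: (hom (inr a) (inr b)).
  - apply/forallP => s; apply/forallP => t; apply/implyP => rst.
    have E c : csum (fun a => h (qproj r (inl a))) (fun b => h (qproj r (inr b))) c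
       = h (qproj r c) by case: c.
    by rewrite !E (qproj_rel rst).
case: p => g1 g2; rewrite inE /= => /and4P[h1 h2 hr hL].
have cr s t : qproj r s = qproj r t -> csum g1 g2 s = csum g1 g2 t.
  apply: qproj_eq_map => u v ruv.
  by have /forallP /(_ u) /forallP /(_ v) /implyP /(_ ruv) /eqP := hr.
pose h : {ffun qtype r -> V} := [ffun c => csum g1 g2 (qrepr c)].
have hE s : h (qproj r s) = csum g1 g2 s.
  by rewrite ffunE; apply: cr; rewrite qreprK.
have Eh : (g1, g2) = f h.
  by congr pair; apply/ffunP => a; rewrite ffunE hE.
exists h => //; rewrite inE -fE1 -fE2 -Eh /= hL andbT.
apply/forallP => c; apply/forallP => d; apply/implyP => /existsP[a /existsP[b]].
case/and3P => eab /eqP <- /eqP <-; rewrite !hE.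
case: a b eab => [a|a] [b|b] //= eab.
  by have /forallP /(_ a) /forallP /(_ b) /implyP := h1; apply.
by have /forallP /(_ a) /forallP /(_ b) /implyP := h2; apply.
Qed.

Section Tensors.
Variables (k : nat) (V : finType) (e : rel V).
Implicit Types (F Q : bgraph k) (x y : k.-tuple V).

Definition homlab F (h : bV F -> V) x y : bool :=
  is_hom (bE F) e h &&
    [forall i, (h (tnth (bI F) i) == tnth x i) && (h (tnth (bO F) i) == tnth y i)].

Lemma hom_entryE F x y :
  hom_entry F e x y = #|[set h : {ffun bV F -> V} | homlab h x y]|.
Proof. by []. Qed.

Lemma hom_entry_series F Q x y :
  hom_entry (series F Q) e x y = (\sum_z hom_entry F e x z * hom_entry Q e z y)%N.
Proof.
pose L (g1 : bV F -> V) (g2 : bV Q -> V) :=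
  [forall i, (g1 (tnth (bI F) i) == tnth x i) && (g2 (tnth (bO Q) i) == tnth y i)].
set r := (fun a b : (bV F + bV Q)%type =>
  [exists i : 'I_k, (a == inl (tnth (bO F) i)) && (b == inr (tnth (bI Q) i))]).
rewrite /hom_entry.
have := @card_glue_hom _ _ V r (bE F) (bE Q) e L.
set X := #|_|; set Y := #|_| => XY.
transitivity Y.
  rewrite -XY; apply: eq_card => h; rewrite !inE /=; congr andb.
  by apply: eq_forallb => i; rewrite !tnth_map.
transitivity (\sum_z #|[set p : {ffun bV F -> V} * {ffun bV Q -> V} |
    homlab p.1 x z && homlab p.2 z y]|)%N; last first.
  apply: eq_bigr => z _; rewrite -cardsX; apply: eq_card => p.
  by rewrite !inE.
rewrite /Y -sum1_card.
(* The pairs are sorted by the common values [z] at the glued labels. *)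
rewrite (partition_big (fun p : {ffun bV F -> V} * {ffun bV Q -> V} =>
   [tuple p.1 (tnth (bO F) i) | i < k]) xpredT) //=.
apply: eq_bigr => z _; rewrite sum1dep_card; apply: eq_card => -[g1 g2].
rewrite !inE /= /homlab; apply/andP/andP.
  case=> /and4P[h1 h2 /forallP hr /forallP hL] /eqP <-; rewrite h1 h2 /=.
  split; apply/forallP => i; rewrite tnth_mktuple ?eqxx ?andbT.
    by case/andP: (hL i).
  case/andP: (hL i) => _ ->; rewrite andbT eq_sym.
  have /forallP /(_ (inr (tnth (bI Q) i))) /implyP := hr (inl (tnth (bO F) i)).
  by apply; apply/existsP; exists i; rewrite !eqxx.
case=> /andP[h1 /forallP l1] /andP[h2 /forallP l2].
rewrite h1 h2 /=; split; last first.
  apply/eqP; apply: eq_from_tnth => i; rewrite tnth_mktuple.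
  by case/andP: (l1 i) => _ /eqP.
apply/andP; split; last first.
  by apply/forallP => i; case/andP: (l1 i) => -> _; case/andP: (l2 i) => _ ->.
apply/forallP => s; apply/forallP => t; apply/implyP => /existsP[ i ].
case/andP => /eqP -> /eqP -> /=.
by case/andP: (l1 i) => _ /eqP ->; case/andP: (l2 i) => /eqP ->.
Qed.

Lemma hom_entry_parallel F Q x y :
  hom_entry (parallel F Q) e x y = (hom_entry F e x y * hom_entry Q e x y)%N.
Proof.
pose L (g1 : bV F -> V) (g2 : bV Q -> V) :=
  [forall i, (g1 (tnth (bI F) i) == tnth x i) && (g1 (tnth (bO F) i) == tnth y i)].
set r := (fun a b : (bV F + bV Q)%type => [exists i : 'I_k,
    ((a == inl (tnth (bI F) i)) && (b == inr (tnth (bI Q) i)))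
            || ((a == inl (tnth (bO F) i)) && (b == inr (tnth (bO Q) i)))]).
rewrite /hom_entry.
have := @card_glue_hom _ _ V r (bE F) (bE Q) e L.
set X := #|_|; set Y := #|_| => XY.
transitivity Y.
  rewrite -XY; apply: eq_card => h; rewrite !inE /=; congr andb.
  by apply: eq_forallb => i; rewrite !tnth_map.
rewrite -cardsX; apply: eq_card => -[g1 g2]; rewrite !inE /=.
apply/and4P/andP.
  case=> h1 h2 /forallP hr /forallP hL; rewrite h1 h2 /=.
  split; first exact/forallP.
  apply/forallP => i; case/andP: (hL i) => /eqP <- /eqP <-.
  rewrite ![g2 _ == _]eq_sym; apply/andP; split.
    have /forallP /(_ (inr (tnth (bI Q) i))) /implyP := hr (inl (tnth (bI F) i)).
    by apply; apply/existsP; exists i; rewrite !eqxx.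
  have /forallP /(_ (inr (tnth (bO Q) i))) /implyP := hr (inl (tnth (bO F) i)).
  by apply; apply/existsP; exists i; rewrite !eqxx orbT.
case=> /andP[h1 /forallP l1] /andP[h2 /forallP l2].
split=> //; last exact/forallP.
apply/forallP => s; apply/forallP => t; apply/implyP => /existsP[ i ].
case/orP => /andP[/eqP -> /eqP ->] /=.
  by case/andP: (l1 i) => /eqP -> _; case/andP: (l2 i) => /eqP ->.
by case/andP: (l1 i) => _ /eqP ->; case/andP: (l2 i) => _ /eqP ->.
Qed.

Definition lab F : 'I_(k + k) -> bV F := zf (bI F) (bO F).

Lemma homlabE F (h : bV F -> V) x y :
  homlab h x y = is_hom (bE F) e h && [forall a, h (lab F a) == zf x y a].
Proof.
rewrite /homlab; congr andb; apply/forallP/forallP => H.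
  move=> a; case: (split_ordP a) => i ->; rewrite /lab ?zf_l ?zf_r;
  by case/andP: (H i).
move=> i; have := H (lshift k i); have := H (rshift k i).
by rewrite /lab !zf_l !zf_r => -> ->.
Qed.

Lemma lab_bperm F s : lab (bperm F s) = lab F \o s.
Proof.
apply: funext => a; rewrite /lab /=; case: (split_ordP a) => i ->.
  by rewrite zf_l tnth_mktuple.
by rewrite zf_r tnth_mktuple.
Qed.

Lemma hom_entry_bperm F s x y :
  hom_entry (bperm F s) e x y =
  hom_entry F e (lz (zf x y \o (s^-1)%g)) (rz (zf x y \o (s^-1)%g)).
Proof.
rewrite !hom_entryE; apply: eq_card => h; rewrite !inE !homlabE zf_lrz.
congr andb; rewrite lab_bperm; apply/forallP/forallP => H a.
  by have := H ((s^-1)%g a); rewrite /= permKV.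
by have := H (s a); rewrite /= permK.
Qed.

Lemma hom_count_sum F :
  hom_count (bE F) e = (\sum_x \sum_y hom_entry F e x y)%N.
Proof.
rewrite pair_bigA /= /hom_count -sum1_card.
rewrite (partition_big (fun h : {ffun bV F -> V} =>
   (map_tuple h (bI F), map_tuple h (bO F))) xpredT) //=.
apply: eq_bigr => -[x y] _; rewrite sum1dep_card; apply: eq_card => h.
rewrite !inE; congr andb; apply/eqP/forallP.
  by case=> <- <- i; rewrite !tnth_map !eqxx.
move=> H; congr pair; apply: eq_from_tnth => i; rewrite tnth_map;
by case/andP: (H i) => /eqP ? /eqP ?.
Qed.

End Tensors.

Section HtensOps.
Variables (R : realType) (k : nat) (V : finType) (e : rel V).
Implicit Types (F Q : bgraph k).

Lemma htens_series F Q : htens R (series F Q) e = htens R F e *m htens R Q e.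
Proof.
apply: ent_inj => x y; rewrite ent_mul ent_htens hom_entry_series natr_sum.
by apply: eq_bigr => z _; rewrite natrM !ent_htens.
Qed.

Lemma htens_parallel F Q : htens R (parallel F Q) e = hadam (htens R F e) (htens R Q e).
Proof. by apply: ent_inj => x y; rewrite ent_hadam !ent_htens hom_entry_parallel natrM. Qed.

Lemma htens_bperm F s : htens R (bperm F s) e = mperm s (htens R F e).
Proof. by apply: ent_inj => x y; rewrite ent_mperm /entz !ent_htens hom_entry_bperm. Qed.

Lemma htens_sum F : \sum_x \sum_y ent (htens R F e) x y = (hom_count (bE F) e)%:R.
Proof.
rewrite hom_count_sum natr_sum; apply: eq_bigr => x _; rewrite natr_sum.
by apply: eq_bigr => y _; rewrite ent_htens.
Qed.

End HtensOps.

(** * Minors of fully labelled graphs *)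

Section Minors.
Variable k : nat.
Implicit Types (F : bgraph k).

(** [C_k] and [M_k] have no unlabelled vertex and no minor operation creates one. Hence vertex
    deletion never occurs, and a homomorphism is determined by its values at the labels. *)
Definition full F := forall v, exists a, lab F a == v.

Lemma full_section F : full F -> exists g : bV F -> 'I_(k + k), cancel g (lab F).
Proof.
by move=> fF; exists (fun v => xchoose (fF v)) => v; apply/eqP; exact: (xchooseP (fF v)).
Qed.

Lemma full_labelled F v : full F -> ~~ ((v \notin bI F) && (v \notin bO F)).
Proof.
move=> /(_ v)[a /eqP <-]; rewrite negb_and !negbK /lab.
case: (split_ordP a) => i ->; first by rewrite zf_l mem_tnth.
by rewrite zf_r mem_tnth orbT.
Qed.

Definition fits F (V : finType) (e : rel V) (z : 'I_(k + k) -> V) :=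
  [forall a, forall b, ((lab F a == lab F b) ==> (z a == z b)) &&
                       (bE F (lab F a) (lab F b) ==> e (z a) (z b))].

Lemma fitsP F (V : finType) (e : rel V) z :
  reflect (forall a b, (lab F a = lab F b -> z a = z b) /\
                       (bE F (lab F a) (lab F b) -> e (z a) (z b))) (fits F e z).
Proof.
apply: (iffP forallP) => H a.
  move=> b; have /forallP /(_ b) /andP[/implyP h1 /implyP h2] := H a.
  by split=> // /eqP /h1 /eqP.
apply/forallP => b; have [h1 h2] := H a b.
by apply/andP; split; apply/implyP => // /eqP /h1 /eqP.
Qed.

Lemma hom_entry_full F (V : finType) (e : rel V) x y :
  full F -> hom_entry F e x y = fits F e (zf x y).
Proof.
move=> /full_section[g gK]; rewrite hom_entryE.
case: fitsP => [H|nH].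
  have gE a : zf x y (g (lab F a)) = zf x y a by apply: (H _ _).1; rewrite gK.
  rewrite (_ : [set _ | _] = [set [ffun v => zf x y (g v)]]) ?cards1 //.
  apply/setP => h; rewrite !inE homlabE; apply/andP/eqP.
    case=> _ /forallP Hh; apply/ffunP => v; rewrite ffunE.
    by rewrite -[in LHS](gK v); apply/eqP.
  move=> ->; split; last by apply/forallP => a; rewrite ffunE gE.
  apply/forallP => u; apply/forallP => v; apply/implyP => uv.
  by rewrite !ffunE; apply: (H _ _).2; rewrite !gK.
apply/eqP; rewrite cards_eq0; apply/eqP/setP => h; rewrite !inE homlabE.
apply/negP => /andP[/forallP hh /forallP hl]; apply: nH => a b.
rewrite -!(eqP (hl _)); split; first by move=> ->.
by have /forallP /(_ (lab F b)) /implyP := hh (lab F a).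
Qed.

(** The common form to which [Ck_graph] and [Mk_graph] unfold, so that facts on minors are proved
    once for both. *)
Definition base (E0 : rel 'I_(k + k)) : bgraph k :=
  @BGraph k 'I_(k + k) E0 [tuple lshift k i | i < k] [tuple rshift k i | i < k].

Lemma lab_base E0 a : lab (base E0) a = a.
Proof.
by rewrite /lab; case: (split_ordP a) => i ->; rewrite ?zf_l ?zf_r tnth_mktuple.
Qed.

Lemma full_base E0 : full (base E0).
Proof. by move=> a; exists a; rewrite lab_base. Qed.

Lemma lab_contract F x y a : lab (contract F x y) a =
  qproj (fun u v => (u == x) && (v == y)) (lab F a).
Proof.
by rewrite /lab; case: (split_ordP a) => i ->; rewrite ?zf_l ?zf_r tnth_map.
Qed.

Lemma full_contract F x y : full F -> full (contract F x y).
Proof.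
move=> fF c; have [a /eqP Ea] := fF (qrepr c); exists a.
by rewrite lab_contract Ea qreprK.
Qed.

Definition pair_eq (T : eqType) (x y u v : T) :=
  ((u == x) && (v == y)) || ((u == y) && (v == x)).

Lemma pair_eqC (T : eqType) (x y u v : T) : pair_eq x y u v = pair_eq x y v u.
Proof. by rewrite /pair_eq orbC [X in X || _]andbC [X in _ || X]andbC. Qed.

Lemma qproj_contract F (x y u v : bV F) :
  let r : rel (bV F) := fun u v => (u == x) && (v == y) in
  (qproj r u == qproj r v) = (u == v) || pair_eq x y u v.
Proof.
move=> r; have rxy : qproj r x = qproj r y by apply: qproj_rel; rewrite /r !eqxx.
apply/eqP/orP => [E|[/eqP ->//|/orP[]/andP[/eqP-> /eqP->]//]].
pose f w := if w == y then x else w.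
have : f u = f v.
  apply: (qproj_eq_map _ E) => a b /andP[/eqP -> /eqP ->].
  by rewrite /f eqxx; case: eqP.
rewrite /f /pair_eq; case: eqP => [->|_]; case: eqP => [->|_] E'.
- by left.
- by right; rewrite -E' !eqxx orbT.
- by right; rewrite E' !eqxx.
- by left; rewrite E'.
Qed.

Lemma bE_contract F (x y : bV F) a b :
  bE (contract F x y) (lab _ a) (lab _ b) <->
  exists u v, [/\ bE F u v, ~~ pair_eq x y u v,
   (u == lab F a) || pair_eq x y u (lab F a) & (v == lab F b) || pair_eq x y v (lab F b)].
Proof.
rewrite !lab_contract; split.
  case/existsP=> u /existsP[v] /and3P[/andP[uv nxy]].
  by rewrite !qproj_contract => ? ?; exists u, v.
case=> u [v [uv nxy ua vb]]; apply/existsP; exists u; apply/existsP; exists v.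
by rewrite !qproj_contract ua vb /= uv; move: nxy; rewrite /pair_eq => ->.
Qed.

Section Invariant.
Variable E0 : rel 'I_(k + k).

(** [Eq] collects the base edges that were contracted or became parallel to a contracted edge, [Ad]
    those that represent the remaining adjacencies. [mi_eq] and [mi_eqz] say that labels are
    identified exactly by the equivalence that [Eq] generates, phrased as a universal property so
    that no closure has to be formed. *)
Record minor_inv F (Eq Ad : rel 'I_(k + k)) : Prop := MinorInv {
  mi_full : full F;
  mi_eq : forall a b, Eq a b -> lab F a = lab F b;
  mi_eqz : forall (T : Type) (z : 'I_(k + k) -> T), (forall a b, Eq a b -> z a = z b) ->
     forall a b, lab F a = lab F b -> z a = z b;
  mi_ad : forall a b, Ad a b -> bE F (lab F a) (lab F b);
  mi_adz : forall u v, bE F u v -> exists a b, [/\ Ad a b, lab F a = u & lab F b = v];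
  mi_subE : subrel Eq E0;
  mi_subA : subrel Ad E0
}.

Lemma minor_invP F : minor (base E0) F -> exists Eq Ad, minor_inv F Eq Ad.
Proof.
elim=> [|F' x y _ [Eq [Ad I]] Exy|F' v _ [Eq [Ad I]] vI vO|F' x y _ [Eq [Ad I]] nxy Exy].
- exists (fun _ _ => false), E0; split=> //.
  + exact: full_base.
  + by move=> T z _ a b; rewrite !lab_base => ->.
  + by move=> a b; rewrite !lab_base.
  + by move=> a b ab; exists a, b; rewrite !lab_base.
- exists Eq, (fun a b => Ad a b && ~~ pair_eq x y (lab F' a) (lab F' b)).
  case: I => fF h1 h2 h3 h4 h5 h6; split=> //.
  + by move=> a b /andP[ab n]; rewrite /= h3.
  + move=> u v /andP[/h4[a [b [ab <- <-]]] n]; exists a, b; split=> //.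
    exact/andP.
  + by move=> a b /andP[/h6].
- by have := full_labelled v (mi_full I); rewrite vI vO.
exists (fun a b => Eq a b || Ad a b && pair_eq x y (lab F' a) (lab F' b)).
exists (fun a b => Ad a b && ~~ pair_eq x y (lab F' a) (lab F' b)).
case: I => fF h1 h2 h3 h4 h5 h6; split.
- exact: full_contract.
- move=> a b; rewrite !lab_contract => /orP[/h1->//|/andP[_ p]].
  by apply/eqP; rewrite qproj_contract p orbT.
- move=> T z hz a b; rewrite !lab_contract => /eqP.
  have hz' a' b' : lab F' a' = lab F' b' -> z a' = z b'.
    by apply: h2 => c d cd; apply: hz; rewrite cd.
  rewrite qproj_contract => /orP[/eqP/hz'//|].
  have [a0 [b0 [ab Ea Eb]]] := h4 _ _ Exy.
  have zab : z a0 = z b0 by apply: hz; rewrite ab Ea Eb /pair_eq !eqxx orbT.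
  case/orP => /andP[/eqP e1 /eqP e2].
    by rewrite (hz' a a0) ?Ea // (hz' b b0) ?Eb.
  by rewrite (hz' a b0) ?Eb // (hz' b a0) ?Ea.
- move=> a b /andP[ab n]; apply/bE_contract.
  by exists (lab F' a), (lab F' b); rewrite !eqxx h3.
- move=> c d /existsP[u /existsP[v /and3P[/andP[uv n] /eqP <- /eqP <-]]].
  have [a [b [ab Ea Eb]]] := h4 _ _ uv; exists a, b.
  by rewrite !lab_contract Ea Eb; split=> //; rewrite ab.
- by move=> a b /orP[/h5//|/andP[/h6]].
- by move=> a b /andP[/h6].
Qed.

Lemma minor_full F : minor (base E0) F -> full F.
Proof. by move=> /minor_invP[Eq [Ad []]]. Qed.

(** The entry tests only equality or adjacency along edges of the base graph. For [C_k] these join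
    cyclically consecutive letters of a word, which is why condition (4) of a certificate yields the
    Schur condition of a quantum isomorphism map. *)
Lemma minor_hom_entry F : minor (base E0) F ->
  exists Eq Ad : rel 'I_(k + k), [/\ subrel Eq E0, subrel Ad E0 &
   forall (V : finType) (e : rel V) x y, let z := zf x y in
   hom_entry F e x y = [forall a, forall b, (Eq a b ==> (z a == z b)) &&
                                            (Ad a b ==> e (z a) (z b))]].
Proof.
move=> /minor_invP[Eq [Ad [fF h1 h2 h3 h4 h5 h6]]].
exists Eq, Ad; split=> // V e x y z; rewrite hom_entry_full //; congr nat_of_bool.
apply/fitsP/forallP => [H a|H a b].
  apply/forallP => b; have [H1 H2] := H a b.
  by apply/andP; split; apply/implyP; [move=> /h1/H1/eqP | move=> /h3/H2].
have hz a' b' : lab F a' = lab F b' -> z a' = z b'.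
  apply: h2 => c d cd; have /forallP /(_ d) := H c.
  by rewrite cd => /andP[/eqP].
split; first exact: hz.
move=> /h4[c [d [cd Ec Ed]]]; rewrite -!/(z _) -(hz _ _ Ec) -(hz _ _ Ed).
by have /forallP /(_ d) := H c; rewrite cd => /andP[_].
Qed.

Lemma minor_hom_entry01 F (V : finType) (e : rel V) x y :
  minor (base E0) F -> (hom_entry F e x y <= 1)%N.
Proof. by move=> /minor_full fF; rewrite hom_entry_full // leq_b1. Qed.

Section Automorphism.
Variable s : {perm 'I_(k + k)}.
Hypothesis sE0 : forall a b, E0 (s a) (s b) = E0 a b.

(** [F'] is [F] with its labels permuted by the automorphism [s]. The comparison goes through the
    labels because the two vertex types are built by different quotients. *)
Record sim F F' : Prop := Sim {
  sim_eq : forall a b, (lab F a == lab F b) = (lab F' (s a) == lab F' (s b));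
  sim_bE : forall a b, bE F (lab F a) (lab F b) = bE F' (lab F' (s a)) (lab F' (s b))
}.

Lemma minor_sim F : minor (base E0) F -> exists2 F', minor (base E0) F' & sim F F'.
Proof.
elim=> [|F' x y m [F1 m1 S] Exy|F' v m _ vI vO|F' x y m [F1 m1 S] nxy Exy].
- exists (base E0); first exact: minor_refl.
  by split=> a b; rewrite !lab_base ?sE0 ?(inj_eq perm_inj).
- have [a0 /eqP Ea] := minor_full m x; have [b0 /eqP Eb] := minor_full m y.
  exists (del_edge F1 (lab F1 (s a0)) (lab F1 (s b0))).
    by apply: minor_dele => //; rewrite -(sim_bE S) Ea Eb.
  split=> a b /=; first exact: (sim_eq S).
  by rewrite -Ea -Eb (sim_bE S) !(sim_eq S).
- by have := full_labelled v (minor_full m); rewrite vI vO.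
have [a0 /eqP Ea] := minor_full m x; have [b0 /eqP Eb] := minor_full m y.
have PE a b : pair_eq x y (lab F' a) (lab F' b) =
  pair_eq (lab F1 (s a0)) (lab F1 (s b0)) (lab F1 (s a)) (lab F1 (s b)).
  by rewrite /pair_eq -Ea -Eb !(sim_eq S).
exists (contract F1 (lab F1 (s a0)) (lab F1 (s b0))).
  apply: minor_contr => //; first by rewrite -(sim_eq S) Ea Eb.
  by rewrite -(sim_bE S) Ea Eb.
split=> a b; first by rewrite !lab_contract !qproj_contract (sim_eq S) PE.
apply/idP/idP => /bE_contract[u [v [uv n ua vb]]]; apply/bE_contract.
  have [c /eqP Ec] := minor_full m u; have [d /eqP Ed] := minor_full m v.
  exists (lab F1 (s c)), (lab F1 (s d)).
  by rewrite -(sim_bE S) -!(sim_eq S) -!PE Ec Ed.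
have [c' /eqP Ec] := minor_full m1 u; have [d' /eqP Ed] := minor_full m1 v.
pose c := (s^-1)%g c'; pose d := (s^-1)%g d'.
exists (lab F' c), (lab F' d).
by rewrite (sim_bE S) !(sim_eq S) !PE /c /d !permKV Ec Ed.
Qed.

Lemma sim_hom_entry F F' (V : finType) (e : rel V) x y : full F -> full F' ->
  sim F F' -> hom_entry F' e x y = hom_entry F e (lz (zf x y \o s)) (rz (zf x y \o s)).
Proof.
move=> fF fF' S; rewrite !hom_entry_full // zf_lrz; congr nat_of_bool.
apply/fitsP/fitsP => H a b /=.
  have [H1 H2] := H (s a) (s b); split; last by rewrite (sim_bE S).
  by move=> /eqP; rewrite (sim_eq S) => /eqP.
have [] := H ((s^-1)%g a) ((s^-1)%g b); rewrite /= !permKV => H1 H2; split.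
  by move=> E; apply: H1; apply/eqP; rewrite (sim_eq S) !permKV E.
by move=> E; apply: H2; rewrite (sim_bE S) !permKV.
Qed.

End Automorphism.

Lemma minor_del_edges F (l : seq (bV F * bV F)) : minor (base E0) F ->
  minor (base E0) (@BGraph k (bV F)
    (fun a b => [&& bE F a b, (a, b) \notin l & (b, a) \notin l]) (bI F) (bO F)).
Proof.
move=> mF; elim: l => [|[x y] l IH].
  rewrite (_ : @BGraph _ _ _ _ _ = F) //; case: F {mF} => V E I O /=.
  by congr BGraph; apply: funext => a; apply: funext => b; rewrite andbT.
set F1 := (@BGraph _ _ _ _ _) in IH; set F2 := @BGraph _ _ _ _ _.
have E2 : F2 = del_edge F1 x y.
  congr BGraph; apply: funext => a; apply: funext => b.
  rewrite !in_cons !xpair_eqE /=.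
  case: (bE F a b) => //=; case: (_ \in l); rewrite ?orbT //=.
  by case: (_ \in l); rewrite ?orbT ?andbF //= !orbF negb_or [(b == x) && _]andbC.
have [E1|n1] := boolP (bE F1 x y); first by rewrite E2; apply: minor_dele.
(* [minor_dele] asks for an edge from [x] to [y], but the adjacency need not be symmetric: the pair
   may be an edge in the other direction, or in neither, and then nothing is deleted. *)
have E2' : F2 = del_edge F1 y x.
  rewrite E2; congr BGraph; apply: funext => a; apply: funext => b.
  by congr (_ && ~~ _); rewrite orbC.
have [E1|n2] := boolP (bE F1 y x); first by rewrite E2'; apply: minor_dele.
rewrite E2 (_ : del_edge F1 x y = F1) //; congr BGraph.
apply: funext => a; apply: funext => b.
have [/orP[]/andP[/eqP -> /eqP ->]|_] := boolP (_ || _); last by rewrite andbT.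
  by rewrite andbF; apply/esym/negbTE.
by rewrite andbF; apply/esym/negbTE.
Qed.

Lemma minor_subgraph (E1 : rel 'I_(k + k)) : symmetric E1 -> subrel E1 E0 ->
  minor (base E0) (base E1).
Proof.
move=> sE1 sub.
pose l := [seq p <- enum {: 'I_(k + k) * 'I_(k + k)} | ~~ E1 p.1 p.2].
have := @minor_del_edges (base E0) l (minor_refl _).
rewrite (_ : @BGraph _ _ _ _ _ = base E1) //; congr BGraph.
apply: funext => a; apply: funext => b.
have lE p : (p \in l) = ~~ E1 p.1 p.2 by rewrite /l mem_filter mem_enum inE andbT.
rewrite !lE /= !negbK [E1 b a]sE1 andbb.
by apply/andP/idP => [[]//|E]; split=> //; apply: sub.
Qed.

Lemma card_contract F (x y : bV F) : x != y -> (#|bV (contract F x y)| < #|bV F|)%N.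
Proof.
move=> nxy; pose r : rel (bV F) := fun u v => (u == x) && (v == y).
have gK := @qreprK _ r; have ginj := can_inj gK.
rewrite ltnNge; apply/negP => le.
have [g' _ g'K] := inj_card_bij ginj le.
case/eqP: nxy; rewrite -(g'K x) -(g'K y); congr qrepr.
rewrite -(gK (g' x)) -(gK (g' y)) !g'K.
by apply: qproj_rel; rewrite /r !eqxx.
Qed.

(** Each contraction lowers the number of vertices. The resulting identification is described by the
    functions [z] that factor through it, which avoids naming connected components. Irreflexivity
    survives because [contract] deletes the edge before merging its ends. *)
Lemma minor_contract_all n F : (#|bV F| <= n)%N -> minor (base E0) F ->
  irreflexive (bE F) ->
  exists F1, [/\ minor (base E0) F1, (forall u v, bE F1 u v = false) &
    forall (T : Type) (z : 'I_(k + k) -> T),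
      (forall a b, lab F1 a = lab F1 b -> z a = z b) <->
      (forall a b, lab F a = lab F b \/ bE F (lab F a) (lab F b) -> z a = z b)].
Proof.
elim: n F => [|n IH] F leF mF iF.
  exists F; have nV (v : bV F) : False.
    by have := max_card (pred1 v); rewrite card1 leqNgt => /negP[]; rewrite ltnS.
  split=> // T z; split=> _ a; case: (nV (lab F a)).
have [/existsP[x /existsP[y xy]]|ne] := boolP [exists x, exists y, bE F x y]; last first.
  have {}ne u v : bE F u v = false.
    by apply: contraNF ne => uv; apply/existsP; exists u; apply/existsP; exists v.
  exists F; split=> // T z; split=> H a b; last by move=> ?; apply: H; left.
  by rewrite ne => -[/H|].
have nxy : x != y by apply: contraTneq xy => ->; rewrite iF.
have fF := minor_full mF.
have [] := IH (contract F x y).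
- by rewrite -ltnS (leq_trans (card_contract nxy)).
- exact: minor_contr.
- move=> c; apply/negbTE/negP => /existsP[u /existsP[v /and3P[/andP[uv n'] /eqP <-]]].
  rewrite qproj_contract => /orP[/eqP E|].
    by rewrite E iF in uv.
  by rewrite pair_eqC; apply/negP.
move=> F1 [m1 e1 H1]; exists F1; split=> // T z; rewrite H1; split=> H a b.
  case=> [E|E]; first by apply: H; left; rewrite !lab_contract E.
  apply: H; have [p|p] := boolP (pair_eq x y (lab F a) (lab F b)).
    by left; rewrite !lab_contract; apply/eqP; rewrite qproj_contract p orbT.
  by right; apply/bE_contract; exists (lab F a), (lab F b); rewrite !eqxx.
have Hp c d : (lab F c == lab F d) || pair_eq x y (lab F c) (lab F d) -> z c = z d.
  case/orP => [/eqP E|]; first by apply: H; left.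
  case/orP => /andP[/eqP E1 /eqP E2]; first by apply: H; right; rewrite E1 E2.
  by apply/esym/H; right; rewrite E1 E2.
case=> [/eqP|/bE_contract[u [v [uv n' ua vb]]]].
  by rewrite !lab_contract qproj_contract => /Hp.
have [c /eqP Ec] := fF u; have [d /eqP Ed] := fF v.
rewrite -(Hp c a) ?Ec // -(Hp d b) ?Ed //.
by apply: H; right; rewrite Ec Ed.
Qed.

(** Delete the edges outside [E1] and contract the others. *)
Lemma minor_eq (E1 : rel 'I_(k + k)) : irreflexive E0 -> symmetric E1 -> subrel E1 E0 ->
  exists2 F, minor (base E0) F & forall (V : finType) (e : rel V) x y,
    let z := zf x y in hom_entry F e x y = [forall a, forall b, E1 a b ==> (z a == z b)].
Proof.
move=> iE sE sub; have m1 := minor_subgraph sE sub.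
have i1 : irreflexive (bE (base E1)).
  by move=> a; apply/negbTE/negP => /sub; rewrite iE.
have [F [mF eF HF]] := minor_contract_all (leqnn _) m1 i1.
exists F => // V e x y z; rewrite hom_entry_full; last exact: minor_full mF.
congr nat_of_bool; have [H1 H2] := HF _ z.
apply/fitsP/forallP => [H a|H].
  apply/forallP => b; apply/implyP => ab; apply/eqP; apply: H1.
    by move=> c d; have [] := H c d.
  by right; rewrite !lab_base.
have hz : forall a b, lab F a = lab F b -> z a = z b.
  apply: H2 => a b; rewrite !lab_base => -[->//|ab].
  by have /forallP /(_ b) := H a; rewrite (ab : E1 a b) => /eqP.
by move=> a b; rewrite eF; split=> //; apply: hz.
Qed.

Lemma minor_adj (E1 : rel 'I_(k + k)) : symmetric E1 -> subrel E1 E0 ->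
  exists2 F, minor (base E0) F & forall (V : finType) (e : rel V) x y,
    let z := zf x y in hom_entry F e x y = [forall a, forall b, E1 a b ==> e (z a) (z b)].
Proof.
move=> sE sub; exists (base E1); first exact: minor_subgraph.
move=> V e x y z; rewrite hom_entry_full; last exact: full_base.
congr nat_of_bool.
apply/fitsP/forallP => [H a|H a b]; rewrite ?lab_base.
  by apply/forallP => b; apply/implyP; have [_] := H a b; rewrite !lab_base.
by split=> [->//|ab]; have /forallP /(_ b) /implyP := H a; apply.
Qed.

End Invariant.
End Minors.

(** * Quantum isomorphism maps and algebraic equivalence *)

Section Kraus.
Variables (R : realType).
Local Notation C := R[i].

Definition ctr n p (A : 'M[C]_(n, p)) : 'M[C]_(p, n) := (map_mx Num.conj A)^T.

Lemma ctrM n p q (A : 'M[C]_(n, p)) (B : 'M[C]_(p, q)) : ctr (A *m B) = ctr B *m ctr A.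
Proof. by rewrite /ctr map_mxM trmx_mul. Qed.

Lemma ctrK n p (A : 'M[C]_(n, p)) : ctr (ctr A) = A.
Proof. by apply/matrixP => i j; rewrite !mxE conjCK. Qed.

Lemma ctrB n p (A B : 'M[C]_(n, p)) : ctr (A - B) = ctr A - ctr B.
Proof. by apply/matrixP => i j; rewrite !mxE rmorphB. Qed.

Lemma tr_ctr_ge0 n p (A : 'M[C]_(n, p)) : 0 <= \tr (ctr A *m A).
Proof.
apply: sumr_ge0 => i _; rewrite mxE; apply: sumr_ge0 => j _.
by rewrite !mxE mulrC mul_conjC_ge0.
Qed.

Lemma tr_ctr_eq0 n p (A : 'M[C]_(n, p)) : \tr (ctr A *m A) = 0 -> A = 0.
Proof.
have ge0 (i : 'I_p) (j : 'I_n) : 0 <= ctr A i j * A j i.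
  by rewrite !mxE mulrC mul_conjC_ge0.
move=> /eqP; rewrite /mxtrace psumr_eq0 => [/allP H|i _]; last first.
  by rewrite mxE; apply: sumr_ge0.
apply/matrixP => i j; rewrite mxE.
have := H j (mem_index_enum j); rewrite /= mxE psumr_eq0 // => /allP H'.
by have := H' i (mem_index_enum i); rewrite /= !mxE mulrC mul_conjC_eq0 => /eqP.
Qed.

Lemma blockpsd_psdk m n (X : 'I_m -> 'I_m -> 'M[C]_n) :
  blockpsd X <-> psdk (fun p q : 'I_m * 'I_n => X p.1 q.1 p.2 q.2).
Proof.
have E (v : 'I_m -> 'I_n -> C) : \sum_a \sum_b \sum_i \sum_j ((v a i)^* * X a b i j * v b j)
  = qform (fun p q : 'I_m * 'I_n => X p.1 q.1 p.2 q.2) (fun p => v p.1 p.2).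
  rewrite /qform -(pair_bigA _ (fun a i => \sum_q (v a i)^* * X a q.1 i q.2 * v q.1 q.2)) /=.
  apply: eq_bigr => a _; rewrite exchange_big /=; apply: eq_bigr => i _.
  by rewrite pair_bigA.
split=> -[h p]; split.
- by move=> [a i] [b j] /=.
- by move=> v; have := p (fun a i => v (a, i)); rewrite E; congr (_ <= _);
     apply: eq_bigr => -[a i] _; apply: eq_bigr => -[b j] _.
- by move=> a b i j; apply: (h (a, i) (b, j)).
- by move=> v; rewrite E.
Qed.

Lemma exchange_sum4 (I J S Q : finType) (F : I -> J -> S -> Q -> C) :
  \sum_i \sum_j \sum_s \sum_q F i j s q = \sum_q \sum_s \sum_i \sum_j F i j s q.
Proof.
rewrite pair_bigA [RHS]exchange_big [RHS]pair_bigA /=.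
under eq_bigr do rewrite pair_bigA.
under [RHS]eq_bigr do rewrite pair_bigA.
exact: exchange_big.
Qed.

Variables (n p : nat).

(** Choi's argument: the block matrix of the matrix units is positive semidefinite, its form being a
    single square, and a Gram decomposition of its image lists the Kraus operators. *)
Lemma cp_kraus (Phi : {linear 'M[C]_n -> 'M[C]_p}) : completely_positive Phi ->
  exists m (K : 'I_m -> 'M[C]_(n, p)), forall X, Phi X = \sum_l ctr (K l) *m X *m K l.
Proof.
move=> cp; have : blockpsd (fun a b : 'I_n => delta_mx a b : 'M[C]_n).
  split=> [a b i j|v]; first by rewrite !mxE conjC_nat andbC.
  suff -> : \sum_a \sum_b \sum_i \sum_j (v a i)^* * (delta_mx a b : 'M[C]_n) i j * v b j
      = (\sum_a v a a)^* * \sum_a v a a by rewrite mulrC mul_conjC_ge0.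
  rewrite rmorph_sum mulr_suml; apply: eq_bigr => a _.
  rewrite mulr_sumr; apply: eq_bigr => b _.
  rewrite (bigD1 a) //= [X in _ + X]big1 ?addr0; last first.
    move=> i /negbTE ni; rewrite big1 // => j _.
    by rewrite mxE ni mulr0 mul0r.
  rewrite (bigD1 b) //= [X in _ + X]big1 ?addr0; last first.
    by move=> j /negbTE nj; rewrite mxE nj andbF mulr0 mul0r.
  by rewrite mxE !eqxx mulr1.
move=> /cp /blockpsd_psdk /psdk_gram[c hc].
exists _, (fun l => \matrix_(a, i) c l (a, i)) => X.
rewrite {1}[X]matrix_sum_delta linear_sum /=; apply/matrixP => i j.
rewrite !summxE; under eq_bigr do rewrite linear_sum /= summxE.
under [RHS]eq_bigr do rewrite mxE.
rewrite [RHS]exchange_big /= exchange_big /=; apply: eq_bigr => b _.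
under [RHS]eq_bigr do rewrite [X in X * _]mxE mulr_suml.
rewrite [RHS]exchange_big; apply: eq_bigr => a _.
rewrite linearZ /= mxE (hc (a, i) (b, j)) mulr_sumr; apply: eq_bigr => l _.
by rewrite !mxE; ring.
Qed.

Lemma kraus_cp (Phi : 'M[C]_n -> 'M[C]_p) m (K : 'I_m -> 'M[C]_(n, p)) :
  (forall X, Phi X = \sum_l ctr (K l) *m X *m K l) -> completely_positive Phi.
Proof.
move=> hK r X [hX pX]; split=> [a b i j|v].
  rewrite !hK !summxE rmorph_sum; apply: eq_bigr => l _.
  rewrite !mxE rmorph_sum.
  under eq_bigr do rewrite mxE mulr_suml.
  under [RHS]eq_bigr do rewrite rmorphM mxE rmorph_sum mulr_suml.
  rewrite exchange_big; apply: eq_bigr => c _; apply: eq_bigr => d _.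
  by rewrite !mxE (hX a b) !rmorphM /= conjCK; ring.
pose w l a q := \sum_i K l q i * v a i.
suff -> : \sum_a \sum_b \sum_i \sum_j (v a i)^* * Phi (X a b) i j * v b j =
   \sum_l \sum_a \sum_b \sum_q \sum_s (w l a q)^* * X a b q s * w l b s.
  by apply: sumr_ge0 => l _; apply: pX.
rewrite [RHS]exchange_big; apply: eq_bigr => a _ /=.
rewrite [RHS]exchange_big; apply: eq_bigr => b _ /=.
under eq_bigr do under eq_bigr do rewrite hK summxE mulr_sumr mulr_suml.
under eq_bigr do rewrite exchange_big /=.
rewrite exchange_big; apply: eq_bigr => l _ /=.
transitivity (\sum_i \sum_j \sum_s \sum_q (v a i)^* * (K l q i)^* * X a b q s * (K l s j * v b j)).
  apply: eq_bigr => i _; apply: eq_bigr => j _.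
  rewrite mxE mulr_sumr mulr_suml; apply: eq_bigr => s _.
  rewrite mxE !mulr_suml mulr_sumr mulr_suml; apply: eq_bigr => q _.
  by rewrite !mxE; ring.
rewrite exchange_sum4; apply: eq_bigr => q _; apply: eq_bigr => s _.
rewrite /w rmorph_sum !mulr_suml; apply: eq_bigr => i _.
rewrite mulr_sumr; apply: eq_bigr => j _.
by rewrite rmorphM /=; ring.
Qed.

Section KrausMap.
Variables (Phi : {linear 'M[C]_n -> 'M[C]_p}).
Hypothesis cp : completely_positive Phi.

Lemma cp_adj X : Phi (adjmx X) = adjmx (Phi X).
Proof.
have [m [K hK]] := cp_kraus cp; rewrite !hK.
have -> : adjmx (\sum_l ctr (K l) *m X *m K l) = \sum_l adjmx (ctr (K l) *m X *m K l).
  by elim/big_rec2: _ => [|i a b _ <-]; apply/matrixP => x y; rewrite !mxE ?conjC0 ?rmorphD.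
by apply: eq_bigr => l _; rewrite -![adjmx _]/(ctr _) !ctrM ctrK mulmxA.
Qed.

Hypothesis Phi1 : Phi 1%:M = 1%:M.
Hypothesis Phi_tr : forall X, \tr (Phi X) = \tr X.

(* The Kraus operators of [Phi] intertwine [Z] and [Phi Z], because the sum of
   the squared norms of [Z K_l - K_l (Phi Z)] is [hs Z Z - hs (Phi Z) (Phi Z)]. *)
Lemma cp_mult Z : hs (Phi Z) (Phi Z) = hs Z Z -> forall X, Phi (X *m Z) = Phi X *m Phi Z.
Proof.
move=> iso; have [m [K hK]] := cp_kraus cp.
pose D l := Z *m K l - K l *m Phi Z.
have sumD : \sum_l \tr (ctr (D l) *m D l) = 0.
  have -> : \sum_l \tr (ctr (D l) *m D l) =
      \tr (\sum_l (ctr (K l) *m (ctr Z *m Z) *m K l)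
        - (\sum_l ctr (K l) *m ctr Z *m K l) *m Phi Z
        - ctr (Phi Z) *m (\sum_l ctr (K l) *m Z *m K l)
        + ctr (Phi Z) *m (\sum_l ctr (K l) *m 1%:M *m K l) *m Phi Z).
    rewrite !mulmx_suml !mulmx_sumr !mulmx_suml -!sumrB -big_split -raddf_sum /=.
    congr (\tr _); apply: eq_bigr => l _.
    rewrite /D ctrB !ctrM mulmxBl !mulmxBr mulmx1 !mulmxA opprB.
    by rewrite addrA addrAC -!addrA; congr (_ + _); rewrite addrCA addrC addrA.
  rewrite -!hK Phi1 mulmx1 -[ctr (Phi Z)]/(adjmx _) -cp_adj addrNK.
  rewrite linearB /= Phi_tr -[ctr Z]/(adjmx Z) -[\tr (adjmx Z *m Z)]/(hs Z Z) -iso.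
  by rewrite /hs -cp_adj subrr.
have D0 l : Z *m K l = K l *m Phi Z.
  apply/eqP; rewrite -subr_eq0; apply/eqP; apply: tr_ctr_eq0.
  move/eqP: sumD; rewrite psumr_eq0 => [/allP|i _]; last exact: tr_ctr_ge0.
  by move=> /(_ l (mem_index_enum l)) /eqP.
move=> X; rewrite [LHS]hK (hK X) mulmx_suml; apply: eq_bigr => l _.
by rewrite !mulmxA -mulmxA D0 !mulmxA.
Qed.

End KrausMap.
End Kraus.

Section QiToAlg.
Variables (R : realType) (k : nat) (VG VH : finType) (eG : rel VG) (eH : rel VH).
Local Notation C := R[i].

Lemma inQ_hom_entry01 (V : finType) (e : rel V) (F : bgraph k) x y :
  inQ F -> (hom_entry F e x y <= 1)%N.
Proof. by case; apply: minor_hom_entry01. Qed.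

(** The entries are [0] or [1], hence equal to their squares. Since a quantum isomorphism map
    preserves sums of entries, it preserves the norm of these generators. *)
Lemma hs_htens_J (V : finType) (e : rel V) (F : bgraph k) : inQ F ->
  hs (htens R F e) (htens R F e) = hs (@Jmx R _) (htens R F e).
Proof.
move=> QF; rewrite !hsE; apply: eq_bigr => x _; apply: eq_bigr => y _.
rewrite ent_J ent_htens conjC1 mul1r conjC_nat.
by have := inQ_hom_entry01 e x y QF; case: hom_entry => [|[|]] //; rewrite ?mul0r ?mulr1.
Qed.

Lemma htens_real (V : finType) (e : rel V) (F : bgraph k) i j :
  (htens R F e i j)^* = htens R F e i j.
Proof. by rewrite !mxE conjC_nat. Qed.

Lemma qi_map_alg_iso (Phi : {linear 'M[C]_(dimk k VG) -> 'M[C]_(dimk k VH)}) :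
  qi_map eG eH Phi -> alg_iso eG eH Phi.
Proof.
case=> cp had PI PJ [Psi [adj [Psi1 PsiJ]]] hom prm.
have PTr X : \tr (Phi X) = \tr X.
  have := adj X 1%:M; rewrite Psi1 => /(congr1 Num.conj).
  by rewrite !hs_conj !hs_1l.
have PhiJ X : hs (Phi X) (@Jmx R _) = hs X (@Jmx R _) by rewrite adj PsiJ.
have mult Z : hs (Phi Z) (Phi Z) = hs Z Z ->
    forall X, hs (Phi X) (Phi Z) = hs X Z.
  move=> iso X; rewrite /hs -cp_adj // -(cp_mult cp PI PTr iso).
  by rewrite PTr.
(* The isometry is proved against every [X], not only [X = Z]: Schur products and rotations are then
   moved to the other argument, where they act on an arbitrary matrix. *)
have isoP Z : inQhat eG Z -> forall X, hs (Phi X) (Phi Z) = hs X Z.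
  elim=> {Z} [||A B _ hA _ hB|c A _ hA|A B _ hA _ hB|A _ hA|F A FQ _ hA|s A sC _ hA|F FQ] X.
  - by rewrite PI -[LHS]hs_conj -[RHS]hs_conj !hs_1l PTr.
  - by rewrite PJ PhiJ.
  - by rewrite linearD !hsDr hA hB.
  - by rewrite linearZ !hsZr hA.
  - rewrite (cp_mult cp PI PTr (hB _)) hs_mull.
    (* Multiplicativity with [A] on the left follows by taking adjoints. *)
    have -> : adjmx (Phi A) *m Phi X = Phi (adjmx A *m X).
      have := congr1 (@adjmx _ _) (cp_mult cp PI PTr (hA _) (adjmx X)).
      by rewrite -(cp_adj cp (adjmx X *m A)) !adjmxM adjmxK (cp_adj cp X) adjmxK.
    by rewrite hB hs_mull.
  - by rewrite cp_adj // -hs_conj hs_adj -cp_adj // hA hs_adj hs_conj.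
  - rewrite had // -hs_hadam; last exact: htens_real.
    by rewrite -had // hA hs_hadam //; apply: htens_real.
  - rewrite prm // -{1}[s]invgK -hs_mperm -prm; last exact: in_Ck_inv.
    by rewrite hA hs_mperm invgK.
  - apply: mult; rewrite hom // !hs_htens_J // -hom // -hs_conj PhiJ.
    by rewrite hs_conj.
have Pmul M N : inQhat eG N -> Phi (M *m N) = Phi M *m Phi N.
  by move=> hN; apply: (cp_mult cp PI PTr (isoP _ hN _)).
split=> //.
- move=> M; elim=> {M} [||A B _ hA _ hB|c A _ hA|A B _ hA qB hB|A _ hA
    |F A FQ _ hA|s A sC _ hA|F FQ].
  + by rewrite PI; apply: qh_I.
  + by rewrite PJ; apply: qh_J.
  + by rewrite linearD; apply: qh_add.
  + by rewrite linearZ; apply: qh_scale.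
  + by rewrite Pmul //; apply: qh_mul.
  + by rewrite cp_adj //; apply: qh_adj.
  + by rewrite had //; apply: qh_had.
  + by rewrite prm //; apply: qh_perm.
  + by rewrite hom //; apply: qh_hom.
- by move=> a M N _ _; rewrite linearP.
- move=> M N hM hN E; apply/eqP; rewrite -subr_eq0; apply/eqP/hs_eq0.
  have hMN : inQhat eG (M - N).
    by rewrite -scaleN1r; apply: qh_add => //; apply: qh_scale.
  by rewrite -(isoP _ hMN) linearB /= E subrr hs0r.
- move=> M'; elim=> {M'} [||A B _ [A' qA <-] _ [B' qB <-]|c A _ [A' qA <-]
    |A B _ [A' qA <-] _ [B' qB <-]|A _ [A' qA <-]|F A FQ _ [A' qA <-]
    |s A sC _ [A' qA <-]|F FQ].
  + by exists 1%:M; [apply: qh_I|].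
  + by exists (@Jmx R _); [apply: qh_J|].
  + by exists (A' + B'); [apply: qh_add|rewrite linearD].
  + by exists (c *: A'); [apply: qh_scale|rewrite linearZ].
  + by exists (A' *m B'); [apply: qh_mul|rewrite Pmul].
  + by exists (adjmx A'); [apply: qh_adj|rewrite cp_adj].
  + by exists (hadam (htens R F eG) A'); [apply: qh_had|rewrite had].
  + by exists (mperm s A'); [apply: qh_perm|rewrite prm].
  + by exists (htens R F eG); [apply: qh_hom|rewrite hom].
- by move=> M _; rewrite cp_adj.
- by move=> M N _ hN; apply: Pmul.
- by move=> F M FQ _; apply: had.
- by move=> s M sC _; apply: prm.
Qed.

Lemma hadamC n (A B : 'M[C]_n) : hadam A B = hadam B A.
Proof. by apply/matrixP => i j; rewrite !mxE mulrC. Qed.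

Lemma alg_equiv_hom_indist : @alg_equiv R k VG VH eG eH -> hom_indist_P k eG eH.
Proof.
case=> phi [into lin _ _ _ mul had _ phiJ hom prm ptr].
have tens F : inP F -> inQhat eG (htens R F eG) /\ phi (htens R F eG) = htens R F eH.
  elim=> {F} [F FQ|F F' _ [q1 e1] _ [q2 e2]|F Q _ [q1 e1] QQ|F s _ [q1 e1] sC].
  - by split; [apply: qh_hom|apply: hom].
  - by rewrite !htens_series mul // e1 e2; split=> //; apply: qh_mul.
  - rewrite !htens_parallel ![hadam _ (htens R Q _)]hadamC had // e1.
    by split=> //; apply: qh_had.
  - by rewrite !htens_bperm prm // e1; split=> //; apply: qh_perm.
(* [hom F] is the sum of the entries of the tensor, that is, its trace after multiplication by [J];
   [phi] preserves this trace. *)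
move=> F /tens[q1 e1]; apply/eqP; rewrite -(eqr_nat C) -!htens_sum -!tr_mulJ.
have qJ := @qh_J R k VG eG.
by rewrite -e1 -phiJ -mul // ptr //; apply: qh_mul.
Qed.

End QiToAlg.

(** * Cyclic words *)

Ltac case_ifs := repeat match goal with
  |- context [if ?b then _ else _] =>
    lazymatch b with
    | context [if _ then _ else _] => fail
    | _ => case: (boolP b) => ?
    end
  end.

Section CyclicWords.
Variables (k : nat) (S : Type).
Implicit Types z : 'I_(k + k) -> S.

(** This is [s^R t] for the two halves [s], [t] of [z]. It lists the label positions as
    [k-1, .., 0, k, .., 2k-1], which is the cycle of [cnext] read backwards, so rotating the labels
    rotates the word. *)
Definition cword z : seq S := rev (lz z) ++ rz z.

Lemma size_cword z : size (cword z) = (k + k)%N.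
Proof. by rewrite size_cat size_rev !size_tuple. Qed.

Lemma cidx_subproof (a : 'I_(k + k)) : ((if (a < k)%N then k.-1 - a else a) < k + k)%N.
Proof. by have := ltn_ord a; case: ifP; lia. Qed.

Definition cidx (a : 'I_(k + k)) : 'I_(k + k) := Ordinal (cidx_subproof a).

Lemma cidxK : involutive cidx.
Proof. move=> a; apply: val_inj => /=; have := ltn_ord a.
by case: (ltnP a k) => h; case: ifP => ?; lia. Qed.

Lemma nth_lz d z (a : 'I_(k + k)) : (a < k)%N -> nth d (lz z) a = z a.
Proof.
move=> ak; rewrite -[nat_of_ord a]/(val (Ordinal ak)) -tnth_nth tnth_mktuple.
by congr z; apply: val_inj.
Qed.

Lemma nth_rz d z (a : 'I_(k + k)) : (k <= a)%N -> nth d (rz z) (a - k) = z a.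
Proof.
move=> ka; have ak : (a - k < k)%N by have := ltn_ord a; lia.
rewrite -[(a - k)%N]/(val (Ordinal ak)) -tnth_nth tnth_mktuple.
by congr z; apply: val_inj => /=; lia.
Qed.

Lemma nth_cword d z a : nth d (cword z) (cidx a) = z a.
Proof.
have ak := ltn_ord a.
have -> : cidx a = (if (a < k)%N then k.-1 - a else a)%N :> nat by [].
rewrite /cword nth_cat size_rev size_tuple; case: (ltnP a k) => h; last first.
  by rewrite ltnNge h nth_rz.
rewrite ifT; last by lia.
rewrite nth_rev ?size_tuple; last by lia.
by rewrite (_ : k - (k.-1 - a).+1 = a)%N ?nth_lz //; lia.
Qed.

Lemma cword_cnext z : cword (z \o @cnext k) = rotr 1 (cword z).
Proof.
have [k0|k0] := posnP k.
  have : size (cword (z \o @cnext k)) = 0%N by rewrite size_cword k0.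
  have : size (cword z) = 0%N by rewrite size_cword k0.
  by move=> /size0nil -> /size0nil ->.
have k2 : ((k + k).-1 < k + k)%N by lia.
pose d := z (Ordinal k2).
apply: (@eq_from_nth _ d) => [|j]; rewrite ?size_rotr !size_cword // => jk.
pose a := cidx (Ordinal jk).
have -> : nth d (cword (z \o @cnext k)) j = z (cnext a).
  have := @nth_cword d (z \o @cnext k) a; rewrite cidxK /= => -> //.
rewrite /rotr size_cword /rot nth_cat size_drop size_cword.
have e := @nth_cword d z (cnext a).
have Ej : nat_of_ord (cidx (cnext a)) = if j == 0%N then (k + k).-1 else j.-1.
  by rewrite /= cnextE /cnext_val /=; case_ifs; lia.
rewrite -e Ej; case: ifP => h; first rewrite ifT; last rewrite ifF; try lia.
  by rewrite nth_drop; congr nth; lia.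
by rewrite nth_take; [congr nth|]; lia.
Qed.

Lemma cnext_k (k0 : (0 < k)%N) (a : 'I_(k + k)) : nat_of_ord a = k ->
  nat_of_ord (cnext a) = 0%N.
Proof. by move=> ak; rewrite cnextE /cnext_val ak; case_ifs; lia. Qed.

(* [cnext] is a single cycle: it visits [0, .., k-1], then [2k-1, .., k]. *)
Lemma cnext_orbit (k0 : (0 < k)%N) (b : 'I_(k + k)) : nat_of_ord b = k ->
  forall a, exists m, a = iter m (@cnext k) b.
Proof.
move=> bk.
have H m : (m < k + k)%N -> nat_of_ord (iter m.+1 (@cnext k) b) =
   if (m < k)%N then m else (k + k + k - m.+1)%N.
  elim: m => [|m IH] mk; first by rewrite /= cnext_k // k0.
  rewrite iterS cnextE IH; last by lia.
  by rewrite /cnext_val; case_ifs; lia.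
move=> a; have ak := ltn_ord a.
case: (ltnP a k) => h.
  by exists a.+1; apply: val_inj; rewrite /= -iterS H ?h.
exists (k + k + k - a.+1).+1; apply: val_inj; rewrite /= -iterS H; last by lia.
by case: ifP; lia.
Qed.

Lemma Ck_e_cnext (a b : 'I_(k + k)) : Ck_e k a b -> b = cnext a \/ a = cnext b.
Proof.
have := ltn_ord a; have := ltn_ord b => ? ?.
rewrite /Ck_e => /or3P[/and3P[/eqP h1 h2 h3]|/andP[/eqP h1 /eqP h2]|/andP[/eqP h1 /eqP h2]].
- case: (ltnP a k) => h; [left|right]; apply: val_inj;
  by rewrite /= cnextE /cnext_val; case_ifs; lia.
- right; apply: val_inj; rewrite /= cnextE /cnext_val; case_ifs; lia.
- left; apply: val_inj; rewrite /= cnextE /cnext_val; case_ifs; lia.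
Qed.

End CyclicWords.

(** * Sums over words of a fixed length *)

Section WordSums.
Variables (C : numClosedFieldType) (S : finType).
Implicit Types F G : seq S -> C.

(** Recursive rather than a sum over tuples, so that letters can be split off and concatenations
    regrouped without casts between tuple types. *)
Fixpoint wS n F : C :=
  if n is n'.+1 then \sum_a wS n' (fun u => F (a :: u)) else F [::].

Lemma eq_wS n F G : (forall u, size u = n -> F u = G u) -> wS n F = wS n G.
Proof.
elim: n F G => [|n IH] F G E; first exact: E.
by apply: eq_bigr => a _; apply: IH => u su; apply: E; rewrite /= su.
Qed.

Lemma wS_mull n c F : wS n (fun u => c * F u) = c * wS n F.
Proof.
elim: n F => //= n IH F; rewrite mulr_sumr; apply: eq_bigr => a _; exact: IH.
Qed.

Lemma wS_sum n (I : finType) (F : I -> seq S -> C) :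
  wS n (fun u => \sum_i F i u) = \sum_i wS n (F i).
Proof.
elim: n F => //= n IH F; rewrite exchange_big; apply: eq_bigr => a _; exact: IH.
Qed.

Lemma wS_cat n m F : wS (n + m) F = wS n (fun s => wS m (fun t => F (s ++ t))).
Proof. by elim: n F => //= n IH F; apply: eq_bigr => a _; apply: IH. Qed.

Lemma wS_tuple n F : wS n F = \sum_(t : n.-tuple S) F t.
Proof.
elim: n F => [|n IH] F /=.
  rewrite (bigD1 [tuple]) //= big1 ?addr0 // => t; rewrite (tuple0 t).
  by case/eqP.
under eq_bigr do rewrite IH.
rewrite pair_bigA /=.
rewrite [RHS](reindex (fun p : S * n.-tuple S => [tuple of p.1 :: p.2])) /=.
  by [].
exists (fun t => (thead t, [tuple of behead t])) => [[a t] _|t _] /=.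
  by rewrite theadE; congr pair; apply: val_inj.
by rewrite -tuple_eta.
Qed.

End WordSums.

Lemma wS_exchange (C : numClosedFieldType) (S T : finType) n m (F : seq S -> seq T -> C) :
  wS n (fun s => wS m (fun t => F s t)) = wS m (fun t => wS n (fun s => F s t)).
Proof.
elim: n F => //= n IH F; rewrite wS_sum; apply: eq_bigr => a _; exact: IH.
Qed.

(** * From NPA certificates to quantum isomorphism maps *)

Section Rel3.
Variables (V : finType) (eV : rel V).
Hypothesis iV : irreflexive eV.

Lemma rel3_0 x y : (rel3 eV x y == 0%N) = (x == y).
Proof. by rewrite /rel3; case: (eqVneq x y) => // _; case: ifP. Qed.

Lemma rel3_1 x y : (rel3 eV x y == 1%N) = eV x y.
Proof. by rewrite /rel3; case: (eqVneq x y) => [->|_]; [rewrite iV | case: ifP]. Qed.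

Lemma rel3_sym x y : symmetric eV -> rel3 eV x y = rel3 eV y x.
Proof. by move=> sV; rewrite /rel3 eq_sym sV. Qed.

End Rel3.

(** [c i r] tells whether relation [r] is allowed at position [i]. Minors of [M_k], the identity and
    [J] all have tensors of this kind, so one marginal computation serves for all of them. *)
Fixpoint cok (V : finType) (e : rel V) (c : nat -> nat -> bool) (x y : seq V) : bool :=
  match x, y with
  | a :: x', b :: y' => c 0%N (rel3 e a b) && cok e (fun i => c i.+1) x' y'
  | _, _ => true
  end.

Lemma cok_tuple (V : finType) (e : rel V) c n (x y : n.-tuple V) :
  cok e c x y = [forall i : 'I_n, c i (rel3 e (tnth x i) (tnth y i))].
Proof.
elim: n c x y => [|n IH] c x y.
  by rewrite (tuple0 x) (tuple0 y) /=; apply/esym/forallP => -[].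
case/tupleP: x => a x; case/tupleP: y => b y /=.
rewrite (IH (fun i => c i.+1)); apply/andP/forallP => [[h1 /forallP h2] i|h].
  case: (unliftP ord0 i) => [j|] ->; last by rewrite !tnth0.
  by rewrite !tnthS; apply: h2.
split; first by have := h ord0; rewrite !tnth0.
by apply/forallP => j; have := h (lift ord0 j); rewrite !tnthS.
Qed.

(* Summing out the letters one pair at a time: the vanishing condition forces
   the relation of the first letters to agree on both sides. *)
Section Marginal.
Variables (C : numClosedFieldType) (A B : finType) (eA : rel A) (eB : rel B) (k : nat).
Variable N : seq (A * B) -> seq (A * B) -> C.
Hypothesis N1 : N [::] [::] = 1.
Hypothesis Nl : forall b s t, (size s < k)%N -> (size t <= k)%N ->
  \sum_a N ((a, b) :: s) t = N s t.
Hypothesis Nr : forall b s t, (size s <= k)%N -> (size t < k)%N ->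
  \sum_a N s ((a, b) :: t) = N s t.
Hypothesis N0 : forall a b a' b' s t, (size s < k)%N -> (size t < k)%N ->
  rel3 eA a a' <> rel3 eB b b' -> N ((a, b) :: s) ((a', b') :: t) = 0.

Lemma marginal n c u v : (n <= k)%N -> size u = n -> size v = n ->
  wS n (fun x => wS n (fun y => N (zip x u) (zip y v) * (cok eA c x y)%:R)) =
  (cok eB c u v)%:R.
Proof.
elim: n c u v => [|n IH] c [|b u] [|b' v] //= nk; first by rewrite N1 mulr1.
move=> [su] [sv].
transitivity (\sum_a \sum_a' wS n (fun x => wS n (fun y =>
   (c 0%N (rel3 eB b b'))%:R * ((cok eA (fun i => c i.+1) x y)%:R *
     N ((a, b) :: zip x u) ((a', b') :: zip y v))))).
  apply: eq_bigr => a _; rewrite -wS_sum; apply: eq_wS => x sx.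
  apply: eq_bigr => a' _; apply: eq_wS => y sy.
  have [E|/eqP/N0 ->] := eqVneq (rel3 eA a a') (rel3 eB b b').
  - by rewrite E -mulnb natrM; ring.
  - by rewrite !(mul0r, mulr0).
  - by rewrite size_zip sx su minnn.
  - by rewrite size_zip sy sv minnn.
rewrite exchange_big /=.
under eq_bigr do rewrite -wS_sum.
rewrite -wS_sum -mulnb natrM.
rewrite -(IH (fun i => c i.+1) u v (ltnW nk) su sv).
rewrite -wS_mull.
apply: eq_wS => x sx; rewrite -wS_mull.
under eq_bigr do rewrite -wS_sum.
rewrite -wS_sum; apply: eq_wS => y sy.
have szx : (size (zip x u) < k)%N by rewrite size_zip sx su minnn.
have szy : (size (zip y v) < k)%N by rewrite size_zip sy sv minnn.
rewrite -(Nr b' (ltnW szx) szy) !mulr_suml mulr_sumr; apply: eq_bigr => a' _.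
rewrite -(Nl b szx) // !mulr_suml mulr_sumr; apply: eq_bigr => a _.
by ring.
Qed.

End Marginal.

Section NpaMap.
Variables (R : realType) (k : nat) (VG VH : finType).
Local Notation C := R[i].
Variable M : seq (VG * VH) -> seq (VG * VH) -> C.

(** The map whose Choi matrix is [M] on words of length exactly [k], a word being read as a pair of
    tuples. *)
Definition npa_map (X : 'M[C]_(dimk k VG)) : 'M[C]_(dimk k VH) :=
  mkmx (fun u v => \sum_(x : k.-tuple VG) \sum_(y : k.-tuple VG) M (zip x u) (zip y v) * ent X x y).

Lemma npa_map_is_linear : linear npa_map.
Proof.
move=> c X Y; apply: ent_inj => u v; rewrite ent_add ent_scale !ent_mkmx.
rewrite mulr_sumr -big_split; apply: eq_bigr => x _ /=.
rewrite mulr_sumr -big_split; apply: eq_bigr => y _ /=.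
by rewrite ent_add ent_scale; ring.
Qed.

HB.instance Definition _ := GRing.isLinear.Build _ _ _ _ npa_map npa_map_is_linear.

Definition npa_comap (Y : 'M[C]_(dimk k VH)) : 'M[C]_(dimk k VG) :=
  mkmx (fun x y => \sum_(u : k.-tuple VH) \sum_(v : k.-tuple VH)
    (M (zip x u) (zip y v))^* * ent Y u v).

Lemma npa_adjoint : is_adjoint npa_map npa_comap.
Proof.
move=> X Y; rewrite !hsE.
transitivity (\sum_(u : k.-tuple VH) \sum_(v : k.-tuple VH)
   \sum_(x : k.-tuple VG) \sum_(y : k.-tuple VG)
     ((M (zip x u) (zip y v))^* * (ent X x y)^* * ent Y u v)).
  apply: eq_bigr => u _; apply: eq_bigr => v _.
  rewrite ent_mkmx rmorph_sum mulr_suml; apply: eq_bigr => x _.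
  rewrite rmorph_sum mulr_suml; apply: eq_bigr => y _.
  by rewrite rmorphM.
rewrite exchange_sum4 exchange_big; apply: eq_bigr => x _; apply: eq_bigr => y _.
rewrite ent_mkmx mulr_sumr; apply: eq_bigr => u _.
rewrite mulr_sumr; apply: eq_bigr => v _; ring.
Qed.

Lemma npa_map_cp :
  psdk (fun p q : k.-tuple VG * k.-tuple VH => M (zip p.1 p.2) (zip q.1 q.2)) ->
  completely_positive npa_map.
Proof.
move=> /psdk_gram[c hc].
apply: (@kraus_cp _ _ _ _ _ (fun l => \matrix_(i, j) c l (enum_val i, enum_val j))) => X.
apply: ent_inj => u v; rewrite ent_mkmx ent_sum.
transitivity (\sum_x \sum_y \sum_l (c l (x, u))^* * c l (y, v) * ent X x y).
  apply: eq_bigr => x _; apply: eq_bigr => y _.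
  by rewrite (hc (x, u) (y, v)) mulr_suml.
under eq_bigr do rewrite exchange_big /=.
rewrite exchange_big; apply: eq_bigr => l _ /=.
rewrite exchange_big /= /ent mxE sum_dimk; apply: eq_bigr => y _.
rewrite !mxE sum_dimk mulr_suml; apply: eq_bigr => x _.
by rewrite !mxE !enum_rankK; ring.
Qed.

End NpaMap.

Section NpaToQi.
Variables (R : realType) (k : nat) (VG VH : finType) (eG : rel VG) (eH : rel VH).
Local Notation C := R[i].
Hypotheses (sG : symmetric eG) (iG : irreflexive eG) (sH : symmetric eH) (iH : irreflexive eH).
Hypotheses (cGH : #|VG| = #|VH|) (k0 : (0 < k)%N).
Variable M : seq (VG * VH) -> seq (VG * VH) -> C.
Hypothesis cert : npa_cert k eG eH M.

Definition pz (zg : 'I_(k + k) -> VG) (zh : 'I_(k + k) -> VH) a := (zg a, zh a).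
Definition Mz (z : 'I_(k + k) -> VG * VH) := M (lz z) (rz z).

Lemma zip_lz zg zh : zip (lz zg) (lz zh) = lz (pz zg zh).
Proof.
apply: (@eq_from_nth _ (zg (lshift k (Ordinal k0)), zh (lshift k (Ordinal k0)))).
  by rewrite size_zip !size_tuple minnn.
move=> i; rewrite size_zip !size_tuple minnn => ik.
rewrite nth_zip ?size_tuple //; have -> : i = Ordinal ik by [].
by rewrite -!tnth_nth !tnth_mktuple.
Qed.

Lemma zip_rz zg zh : zip (rz zg) (rz zh) = rz (pz zg zh).
Proof.
apply: (@eq_from_nth _ (zg (lshift k (Ordinal k0)), zh (lshift k (Ordinal k0)))).
  by rewrite size_zip !size_tuple minnn.
move=> i; rewrite size_zip !size_tuple minnn => ik.
rewrite nth_zip ?size_tuple //; have -> : i = Ordinal ik by [].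
by rewrite -!tnth_nth !tnth_mktuple.
Qed.

Lemma M_zip (x : k.-tuple VG) (u : k.-tuple VH) (y : k.-tuple VG) (v : k.-tuple VH) :
  M (zip x u) (zip y v) = Mz (pz (zf x y) (zf u v)).
Proof. by rewrite /Mz -zip_lz -zip_rz !lz_zf !rz_zf. Qed.

Lemma Mz_cnext z : Mz (z \o @cnext k) = Mz z.
Proof.
apply: (npa_equiv cert); rewrite ?size_tuple //.
rewrite -[rev _ ++ _]/(cword _) cword_cnext -[rev _ ++ _]/(cword z) /rotr.
by rewrite -{3}(cat_take_drop (size (cword z) - 1) (cword z));
  apply: Relation_Operators.rst_step; apply: ws_rot.
Qed.

Lemma Mz_iter m z : Mz (z \o iter m (@cnext k)) = Mz z.
Proof.
elim: m z => [|m IH] z; first by congr Mz; apply: funext.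
rewrite -[RHS](Mz_cnext) -[RHS]IH; congr Mz; exact: funext.
Qed.

Lemma Mz_perm s z : in_Ck s -> Mz (z \o s) = Mz z.
Proof.
case=> m hm; rewrite -[RHS](Mz_iter m); congr Mz.
by apply: funext => a /=; rewrite hm.
Qed.

Lemma M_first a b a' b' s t : (size s < k)%N -> (size t < k)%N ->
  rel3 eG a a' <> rel3 eH b b' -> M ((a, b) :: s) ((a', b') :: t) = 0.
Proof.
move=> hs ht hr; apply: (@npa_zero _ _ _ _ _ _ _ cert _ _ (rev s) t a b a' b') => //.
by rewrite rev_cons cat_rcons.
Qed.

(** Covers also the pair formed by the last and the first letter: a rotation brings any cyclically
    consecutive pair to the junction of [s^R] and [t], where condition (4) applies. *)
Lemma Mz_zero z a : rel3 eG (z (cnext a)).1 (z a).1 <> rel3 eH (z (cnext a)).2 (z a).2 ->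
  Mz z = 0.
Proof.
have kk : (k < k + k)%N by lia.
have [m ->] := cnext_orbit k0 (b := Ordinal kk) erefl a.
rewrite -iterS iterSr -(Mz_iter m); set z' := z \o _.
have -> : cnext (Ordinal kk) = lshift k (Ordinal k0).
  by apply: val_inj; rewrite /= cnext_k.
move=> H; rewrite /Mz.
case El : (tval (lz z')) => [|c s]; first by have := size_tuple (lz z'); rewrite El /=; lia.
case Er : (tval (rz z')) => [|d t]; first by have := size_tuple (rz z'); rewrite Er /=; lia.
have ss : (size s < k)%N by have := size_tuple (lz z'); rewrite El /= => <-.
have st : (size t < k)%N by have := size_tuple (rz z'); rewrite Er /= => <-.
have Ec : c = z' (lshift k (Ordinal k0)).
  by have := nth_lz c z' (a := lshift k (Ordinal k0)) k0; rewrite El /= => ->.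
have Ed : d = z' (Ordinal kk).
  by have := nth_rz d z' (a := Ordinal kk) (leqnn k); rewrite Er subnn /= => ->.
move: c d Ec Ed {El Er} => [a1 b1] [a2 b2] Ec Ed.
apply: M_first => //; move: H; rewrite -[z _]/(z' (lshift k (Ordinal k0))) -Ec.
by rewrite -[z _]/(z' (Ordinal kk)) -Ed.
Qed.

Lemma Mz_edge zg zh a b : Mz (pz zg zh) <> 0 -> bE (Ck_graph k) a b ->
  rel3 eG (zg a) (zg b) = rel3 eH (zh a) (zh b).
Proof.
move=> nz E; apply/eqP; apply/negPn/negP => /eqP H; apply: nz.
have : b = cnext a \/ a = cnext b.
  by case/orP: E => /Ck_e_cnext[]; auto.
case=> E'; last by apply: (@Mz_zero _ b); rewrite -E'.
by apply: (@Mz_zero _ a); rewrite -E' /= rel3_sym // [in RHS]rel3_sym.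
Qed.

Lemma Mz_had zg zh (F : bgraph k) : inQP F ->
  Mz (pz zg zh) * (hom_entry F eG (lz zg) (rz zg))%:R =
  Mz (pz zg zh) * (hom_entry F eH (lz zh) (rz zh))%:R.
Proof.
move=> /minor_hom_entry[Eq [Ad [sEq sAd H]]].
have [->|/eqP nz] := eqVneq (Mz (pz zg zh)) 0; first by rewrite !mul0r.
congr (_ * _%:R); rewrite !H !zf_lrz; congr nat_of_bool.
apply: eq_forallb => a; apply: eq_forallb => b.
congr andb.
  case Eab : (Eq a b) => //=; have := Mz_edge nz (sEq _ _ Eab) => E.
  by rewrite -(rel3_0 eG) -(rel3_0 eH) E.
case Aab : (Ad a b) => //=; have := Mz_edge nz (sAd _ _ Aab) => E.
by rewrite -(rel3_1 iG) -(rel3_1 iH) E.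
Qed.

Lemma QS_cok (F : bgraph k) : inQS F -> exists c, forall (V : finType) (e : rel V),
  symmetric e -> irreflexive e -> forall x y, hom_entry F e x y = cok e c x y.
Proof.
move=> /minor_hom_entry[Eq [Ad [sEq sAd H]]].
(* The quantifier over [j] turns the natural number [i] into a position; both orientations are
   tested because [Eq] and [Ad] need not be symmetric. *)
pose c (i r : nat) := [forall j : 'I_k, (nat_of_ord j == i) ==>
  [&& (Eq (lshift k j) (rshift k j) || Eq (rshift k j) (lshift k j)) ==> (r == 0%N) &
      (Ad (lshift k j) (rshift k j) || Ad (rshift k j) (lshift k j)) ==> (r == 1%N)]].
exists c => V e se ie x y; rewrite H cok_tuple; congr nat_of_bool.
have edge a b : bE (Mk_graph k) a b -> exists j : 'I_k,
    (a = lshift k j /\ b = rshift k j) \/ (a = rshift k j /\ b = lshift k j).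
  have := ltn_ord a; have := ltn_ord b => ? ? /orP[]/eqP E.
    have ak : (a < k)%N by lia.
    by exists (Ordinal ak); left; split; apply: val_inj => /=; lia.
  have bk : (b < k)%N by lia.
  by exists (Ordinal bk); right; split; apply: val_inj => /=; lia.
apply/forallP/forallP => [h i|h a].
  apply/forallP => j; apply/implyP => /eqP /ord_inj ->.
  rewrite rel3_0 // rel3_1 //.
  have := forallP (h (lshift k i)) (rshift k i); rewrite zf_l zf_r => /andP[/implyP h1 /implyP h2].
  have := forallP (h (rshift k i)) (lshift k i); rewrite zf_l zf_r => /andP[/implyP h3 /implyP h4].
  apply/andP; split; apply/implyP => /orP[].
  + exact: h1.
  + by move=> /h3; rewrite eq_sym.
  + exact: h2.
  + by move=> /h4; rewrite se.
apply/forallP => b.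
have hc i : (Eq (lshift k i) (rshift k i) || Eq (rshift k i) (lshift k i) -> tnth x i = tnth y i) /\
   (Ad (lshift k i) (rshift k i) || Ad (rshift k i) (lshift k i) -> e (tnth x i) (tnth y i)).
  have := forallP (h i) i; rewrite eqxx /= rel3_0 // rel3_1 // => /andP[/implyP h1 /implyP h2].
  by split=> // /h1 /eqP.
apply/andP; split; apply/implyP => E.
  have [j [] [Ea Eb]] := edge _ _ (sEq _ _ E); rewrite Ea Eb zf_l zf_r.
    by apply/eqP; apply: (hc j).1; rewrite -Ea -Eb E.
  by apply/eqP/esym; apply: (hc j).1; rewrite -Ea -Eb E orbT.
have [j [] [Ea Eb]] := edge _ _ (sAd _ _ E); rewrite Ea Eb zf_l zf_r.
  by apply: (hc j).2; rewrite -Ea -Eb E.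
by rewrite se; apply: (hc j).2; rewrite -Ea -Eb E orbT.
Qed.

Lemma cok_eq (V : finType) (e : rel V) (x y : k.-tuple V) :
  cok e (fun _ r => r == 0%N) x y = (x == y).
Proof.
rewrite cok_tuple; apply/forallP/eqP => [h|-> i]; last by rewrite rel3_0.
by apply: eq_from_tnth => i; apply/eqP; rewrite -(rel3_0 e).
Qed.

Lemma cok_true (V : finType) (e : rel V) (x y : k.-tuple V) :
  cok e (fun _ _ => true) x y.
Proof. by rewrite cok_tuple; apply/forallP. Qed.

(** A sum condition of a certificate names a full letter [(g, h)]; this supplies the component over
    which the sum runs. *)
Lemma card_inhabited (A B : finType) (b : B) : #|A| = #|B| -> exists a : A, true.
Proof.
move=> cAB; have : (0 < #|A|)%N by rewrite cAB; apply/card_gt0P; exists b.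
by case/card_gt0P => a _; exists a.
Qed.

Lemma npa_map_cok c (u v : k.-tuple VH) :
  \sum_(x : k.-tuple VG) \sum_(y : k.-tuple VG)
    M (zip x u) (zip y v) * (cok eG c x y)%:R = (cok eH c u v)%:R.
Proof.
rewrite -(@marginal _ _ _ eG eH k M _ _ _ _ k c u v) ?size_tuple //; first last.
- exact: M_first.
- move=> b s t hs ht; have [g _] := card_inhabited b cGH.
  by have := @npa_sumG_r _ _ _ _ _ _ _ cert [::] t g b s ht hs.
- move=> b s t hs ht; have [g _] := card_inhabited b cGH.
  by have := @npa_sumG_l _ _ _ _ _ _ _ cert [::] s g b t hs ht.
- exact: npa_one cert.
rewrite wS_tuple; apply: eq_bigr => x _.
by rewrite wS_tuple.
Qed.

Lemma npa_comap_cok c (x y : k.-tuple VG) :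
  \sum_(u : k.-tuple VH) \sum_(v : k.-tuple VH)
    M (zip x u) (zip y v) * (cok eH c u v)%:R = (cok eG c x y)%:R.
Proof.
(* Exchanging the two components of every letter lets [marginal] sum over the vertices of [H]. *)
pose sw (p : VH * VG) := (p.2, p.1).
pose N s t := M (map sw s) (map sw t).
have swz n (a : seq VH) (b : seq VG) : size a = n -> size b = n -> map sw (zip a b) = zip b a.
  by elim: n a b => [|n IH] [|a0 a] [|b0 b] //= [sa] [sb]; rewrite IH.
rewrite -(@marginal _ _ _ eH eG k N _ _ _ _ k c x y) ?size_tuple //; first last.
- by move=> a b a' b' s t hs ht H; apply: M_first; rewrite ?size_map //; apply: nesym.
- move=> b s t hs ht; have [g _] := card_inhabited b (esym cGH).
  have := @npa_sumH_r _ _ _ _ _ _ _ cert [::] (map sw t) b g (map sw s).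
  by rewrite /= !size_map; apply.
- move=> b s t hs ht; have [g _] := card_inhabited b (esym cGH).
  have := @npa_sumH_l _ _ _ _ _ _ _ cert [::] (map sw s) b g (map sw t).
  by rewrite /= !size_map; apply.
- exact: npa_one cert.
rewrite wS_tuple; apply: eq_bigr => u _.
rewrite wS_tuple; apply: eq_bigr => v _.
by rewrite /N !(swz k) ?size_tuple.
Qed.

Lemma npa_psdk :
  psdk (fun p q : k.-tuple VG * k.-tuple VH => M (zip p.1 p.2) (zip q.1 q.2)).
Proof.
split=> [[x u] [y v]|w] /=.
  by apply: (npa_herm cert); rewrite size_zip !size_tuple minnn.
(* [w] lives on words of length [k] and is extended by zero to all words. *)
pose w' (s : seq (VG * VH)) :=
  if insub (unzip1 s) is Some x then
    if insub (unzip2 s) is Some u then w (x, u) else 0 else 0.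
have w'E (x : k.-tuple VG) (u : k.-tuple VH) : w' (zip x u) = w (x, u).
  by rewrite /w' unzip1_zip ?unzip2_zip ?size_tuple // !valK.
have w'0 s : size s <> k -> w' s = 0.
  by move=> hs; rewrite /w' insubF // size_map; apply/eqP.
have wsumE (F : seq (VG * VH) -> C) : (forall s, size s <> k -> F s = 0) ->
    wsum k F = \sum_(p : k.-tuple VG * k.-tuple VH) F (zip p.1 p.2).
  move=> F0; rewrite /wsum big_ord_recr /= big1 ?add0r; last first.
    move=> i _; rewrite big1 // => t _; apply: F0; rewrite size_tuple.
    by have := ltn_ord i; lia.
  rewrite (reindex (fun p : k.-tuple VG * k.-tuple VH => [tuple of zip p.1 p.2])) //=.
  exists (fun t : k.-tuple (VG * VH) => ([tuple of unzip1 t], [tuple of unzip2 t])).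
    by move=> [x u] _; congr pair; apply: val_inj;
      rewrite /= ?unzip1_zip ?unzip2_zip ?size_tuple.
  by move=> t _; apply: val_inj; rewrite /= zip_unzip.
have := npa_psd cert w'; rewrite wsumE => [|s hs]; last first.
  rewrite /wsum big1 // => i _; rewrite big1 // => t _.
  by rewrite w'0 // conjC0 !mul0r.
congr (_ <= _); apply: eq_bigr => -[x u] _; rewrite wsumE => [|s hs]; last first.
  by rewrite (w'0 s hs) mulr0.
by apply: eq_bigr => -[y v] _ /=; rewrite !w'E.
Qed.

Lemma npa_qi_map : @qi_map R k VG VH eG eH (npa_map M).
Proof.
have had (F : bgraph k) X : inQP F ->
    npa_map M (hadam (htens R F eG) X) = hadam (htens R F eH) (npa_map M X).
  move=> FQ; apply: ent_inj => u v; rewrite ent_hadam !ent_mkmx mulr_sumr.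
  apply: eq_bigr => x _; rewrite mulr_sumr; apply: eq_bigr => y _.
  rewrite ent_hadam ent_htens M_zip mulrA.
  have := Mz_had (zf x y) (zf u v) FQ; rewrite !lz_zf !rz_zf => ->.
  by ring.
have mapJ : npa_map M (@Jmx R (dimk k VG)) = @Jmx R _.
  apply: ent_inj => u v; rewrite ent_mkmx ent_J.
  have E := npa_map_cok (fun _ _ => true) u v; rewrite cok_true in E.
  rewrite -[RHS]/(true%:R) -E.
  apply: eq_bigr => x _; apply: eq_bigr => y _.
  by rewrite ent_J cok_true.
split=> //.
- exact: npa_map_cp npa_psdk.
- apply: ent_inj => u v; rewrite ent_mkmx ent_1 -(cok_eq eH) -npa_map_cok.
  by apply: eq_bigr => x _; apply: eq_bigr => y _; rewrite ent_1 cok_eq.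
- exists (@npa_comap R k VG VH M); split; first exact: npa_adjoint.
  split; apply: ent_inj => x y; rewrite ent_mkmx ?ent_1 ?ent_J.
    rewrite -(cok_eq eG) -[RHS]conjC_nat -npa_comap_cok rmorph_sum.
    apply: eq_bigr => u _; rewrite rmorph_sum; apply: eq_bigr => v _.
    by rewrite rmorphM /= conjC_nat ent_1 cok_eq.
  have E := npa_comap_cok (fun _ _ => true) x y; rewrite cok_true in E.
  rewrite -[RHS]conjC1 -[X in X^*]/(true%:R) -E rmorph_sum.
  apply: eq_bigr => u _; rewrite rmorph_sum; apply: eq_bigr => v _.
  by rewrite rmorphM /= conjC_nat ent_J cok_true.
- move=> F [FP|/QS_cok[c hc]].
    (* For minors of [C_k] the claim is the Schur condition applied to [J]; minors of [M_k] are then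
       computed directly through [cok]. *)
    have JE (V : finType) (e : rel V) : htens R F e = hadam (htens R F e) (@Jmx R _).
      by apply: ent_inj => x y; rewrite ent_hadam ent_J mulr1.
    by rewrite [RHS]JE -mapJ -(had F _ FP) -JE.
  apply: ent_inj => u v; rewrite ent_mkmx ent_htens hc // -npa_map_cok.
  by apply: eq_bigr => x _; apply: eq_bigr => y _; rewrite ent_htens hc.
- move=> s X sC; apply: ent_inj => u v; rewrite ent_mperm ent_mkmx /entz ent_mkmx.
  pose F z := Mz (pz z (zf u v \o (s^-1)%g)) * entz X z.
  transitivity (\sum_x \sum_y F (zf x y)); last first.
    apply: eq_bigr => x _; apply: eq_bigr => y _.
    by rewrite M_zip zf_lrz /F entz_zf.
  rewrite -(sum_lrz (s^-1)%g F); apply: eq_bigr => x _; apply: eq_bigr => y _.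
  rewrite M_zip ent_mperm /F; congr (_ * _).
  by rewrite -(Mz_perm _ (in_Ck_inv sC)).
Qed.

End NpaToQi.

(** * Isometric pairs and their kernel *)

Lemma sum_pair (V : zmodType) (I J : finType) (F : I * J -> V) :
  \sum_q F q = \sum_i \sum_j F (i, j).
Proof. by rewrite pair_bigA; apply: eq_bigr => -[]. Qed.

Section IsometricPairs.
Variables (R : realType) (n p : nat).
Local Notation C := R[i].

(** Caps the size of orthonormal families, so that a maximal one exists in [onb_exists]. *)
Lemma orthonormal_bound m (A : 'I_m -> 'M[C]_n) :
  (forall i j, hs (A i) (A j) = (i == j)%:R) -> (m <= n * n)%N.
Proof.
move=> oA; pose U : 'M[C]_(m, n * n) := \matrix_i mxvec (A i).
have : U *m ctr U = 1%:M.
  apply/matrixP => i j; rewrite !mxE eq_sym -oA hs_sumE.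
  rewrite (reindex _ (curry_mxvec_bij n n)) /= pair_bigA /=.
  by apply: eq_bigr => -[a b] _; rewrite !mxE /= !mxvecE mulrC.
exact: mulmx1_min.
Qed.

Variable W : 'M[C]_n -> 'M[C]_p -> Prop.
Hypothesis W0 : W 0 0.
Hypothesis Wlin : forall c X Y X' Y', W X Y -> W X' Y' -> W (c *: X + X') (c *: Y + Y').
Hypothesis Wiso : forall X Y X' Y', W X Y -> W X' Y' -> hs X X' = hs Y Y'.

Definition onfam m (A : 'I_m -> 'M[C]_n) (B : 'I_m -> 'M[C]_p) :=
  (forall i, W (A i) (B i)) /\ forall i j, hs (A i) (A j) = (i == j)%:R.

(** Take a maximal orthonormal family: if subtracting the projection left a nonzero first component,
    the remaining pair could be normalised and added. The isometry then kills the second component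
    too, which makes [W] the graph of a function. *)
Lemma onb_exists : exists m (A : 'I_m -> 'M[C]_n) (B : 'I_m -> 'M[C]_p), onfam A B /\
  forall X Y, W X Y -> X = \sum_i hs (A i) X *: A i /\ Y = \sum_i hs (A i) X *: B i.
Proof.
pose P m := `[< exists (A : 'I_m -> 'M[C]_n) (B : 'I_m -> 'M[C]_p), onfam A B >].
have P0 : exists m, P m.
  exists 0%N; apply/asboolP; exists (fun=> 0), (fun=> 0).
  by split=> -[].
have Pb m : P m -> (m <= n * n)%N.
  by move=> /asboolP[A [B [_ oA]]]; apply: orthonormal_bound oA.
case: (ex_maxnP P0 Pb) => m /asboolP[A [B [WA oA]]] max.
exists m, A, B; split=> // X Y WXY.
pose X' := X - \sum_i hs (A i) X *: A i; pose Y' := Y - \sum_i hs (A i) X *: B i.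
have WS (r : seq 'I_m) : W (\sum_(i <- r) hs (A i) X *: A i) (\sum_(i <- r) hs (A i) X *: B i).
  by elim: r => [|i r IH]; rewrite ?big_nil ?big_cons //; apply: Wlin.
have WX' : W X' Y'.
  by have := Wlin (-1) (WS (index_enum _)) WXY; rewrite !scaleN1r ![- _ + _]addrC.
have oX' j : hs (A j) X' = 0.
  rewrite /X' -scaleN1r hsDr hsZr hs_sumr (bigD1 j) //= hsZr oA eqxx mulr1.
  rewrite big1 ?addr0 ?mulN1r ?subrr // => i /negbTE ni.
  by rewrite hsZr oA eq_sym ni mulr0.
have nX' : hs X' X' = 0.
  apply/eqP/negPn/negP => nz.
  pose c := (sqrtC (hs X' X'))^-1.
  have cc : c^* * (c * hs X' X') = 1.
    have cr : c^* = c.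
      by apply: conj_Creal; rewrite realV ger0_real ?sqrtC_ge0 ?hs_ge0.
    rewrite cr mulrA -expr2 exprVn sqrtCK mulVf //.
  have := max m.+1; rewrite ltnn => /(_ _)/negP; apply; last by [].
  apply/asboolP.
  exists (fun i => if unlift ord0 i is Some j then A j else c *: X').
  exists (fun i => if unlift ord0 i is Some j then B j else c *: Y').
  have oX'' j : hs X' (A j) = 0 by rewrite -hs_conj oX' conjC0.
  split=> [i|i j].
    case: (unliftP ord0 i) => [j|] _ //.
    by rewrite -[c *: X']addr0 -[c *: Y']addr0; apply: Wlin.
  case: (unliftP ord0 i) => [i'|] ->; case: (unliftP ord0 j) => [j'|] ->.
  - by rewrite oA (inj_eq lift_inj).
  - by rewrite hsZr oX' mulr0.
  - by rewrite hsZl oX'' mulr0.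
  - by rewrite hsZl hsZr eqxx.
have nY' : hs Y' Y' = 0 by rewrite -(Wiso WX' WX').
by split; apply/eqP; rewrite -subr_eq0; apply/eqP/hs_eq0.
Qed.

Section Kernel.
Variables (m : nat) (A : 'I_m -> 'M[C]_n) (B : 'I_m -> 'M[C]_p).
Hypothesis WAB : forall i, W (A i) (B i).
Hypothesis expand : forall X Y, W X Y ->
  X = \sum_i hs (A i) X *: A i /\ Y = \sum_i hs (A i) X *: B i.

Definition pker (s t : 'I_n * 'I_p) : C := \sum_l (A l s.1 t.1)^* * B l s.2 t.2.

(** [W] is a graph, so [LH (B l)] has the same coefficients in the family [B] as [LG (A l)] has in
    [A]. As [LG'] is adjoint to [LG], the two coefficient matrices are adjoint, and the conjugation
    on the first factor turns one into the other. The rotation, vanishing and sum conditions are all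
    instances. *)
Lemma pker_transfer (LG LG' : 'M[C]_n -> 'M[C]_n) (LH LH' : 'M[C]_p -> 'M[C]_p) :
  (forall X Y, W X Y -> W (LG X) (LH Y)) ->
  (forall X Y, W X Y -> W (LG' X) (LH' Y)) ->
  (forall X X', hs (LG' X) X' = hs X (LG X')) ->
  forall i j a b, \sum_l (A l i j)^* * LH (B l) a b = \sum_l (LG' (A l) i j)^* * B l a b.
Proof.
move=> WL WL' adj i j a b.
transitivity (\sum_l \sum_l' (A l i j)^* * (hs (A l') (LG (A l)) * B l' a b)).
  apply: eq_bigr => l _; have [_ {1}->] := expand (WL _ _ (WAB l)).
  rewrite summxE mulr_sumr; apply: eq_bigr => l' _; by rewrite mxE.
rewrite exchange_big; apply: eq_bigr => l' _ /=.
have [{2}-> _] := expand (WL' _ _ (WAB l')).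
rewrite summxE rmorph_sum mulr_suml; apply: eq_bigr => l _.
by rewrite mxE rmorphM /= hs_conj adj; ring.
Qed.

Hypothesis Wmul : forall X Y X' Y', W X Y -> W X' Y' -> W (X *m X') (Y *m Y').
Hypothesis Wadj : forall X Y, W X Y -> W (adjmx X) (adjmx Y).

(** Taking adjoints is antilinear, so [pker_transfer] does not cover it. Instead the adjoints are
    expanded on both factors, the coefficients [hs (A l') (adjmx (A l))] being symmetric in [l] and
    [l']. *)
Lemma pker_herm : hermk pker.
Proof.
move=> [i a] [j b]; rewrite /pker /= rmorph_sum.
transitivity (\sum_l \sum_l' (adjmx (A l) j i)^* *
    (hs (A l') (adjmx (A l)) * B l' b a)); last first.
  apply: eq_bigr => l _; rewrite -mulr_sumr rmorphM /=.
  have [_ E] := expand (Wadj (WAB l)).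
  have /matrixP/(_ b a) := E; rewrite summxE [LHS]mxE [LHS]mxE => ->.
  rewrite mxE mxE; congr (_ * _); apply: eq_bigr => l' _.
  by rewrite mxE.
rewrite exchange_big; apply: eq_bigr => l _ /=.
have [E _] := expand (Wadj (WAB l)).
have /matrixP/(_ i j) := E; rewrite summxE [LHS]mxE [LHS]mxE => ->.
rewrite mulr_suml; apply: eq_bigr => l' _.
have -> : hs (A l) (adjmx (A l')) = hs (A l') (adjmx (A l)).
  by rewrite -hs_conj hs_adj hs_conj.
by rewrite !mxE conjCK; ring.
Qed.

Lemma pker_psd : psdk pker.
Proof.
pose Bt := \sum_l adjmx (B l) *m B l.
pose Bk (s t : 'I_n * 'I_p) := (s.1 == t.1)%:R * Bt s.2 t.2.
apply: (@psdk_of_sqr _ _ _ Bk); first exact: pker_herm.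
  move=> [i a] [r d].
  transitivity (\sum_l' \sum_l (A l i r)^* * (B l *m (adjmx (B l') *m B l')) a d).
    transitivity (\sum_l' \sum_l (((A l *m A l') i r)^* * (B l *m B l') a d)).
      rewrite exchange_big /= /pker /=.
      under eq_bigr do rewrite mulr_suml.
      rewrite exchange_big /=; apply: eq_bigr => l _.
      under eq_bigr do rewrite mulr_sumr.
      rewrite exchange_big /=; apply: eq_bigr => l' _.
      rewrite sum_pair.
      rewrite !mxE rmorph_sum mulr_suml; apply: eq_bigr => j _.
      rewrite mulr_sumr; apply: eq_bigr => b _.
      by rewrite rmorphM /=; ring.
    apply: eq_bigr => l' _.
    (* The right factor [A l'] crosses to the second tensor factor as [adjmx (B l')], which leaves
       [B l *m adjmx (B l') *m B l']. *)
    have T b := @pker_transfer (fun X => X *m adjmx (A l')) (fun X => X *m A l')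
      (fun X => X *m adjmx (B l')) (fun X => X *m B l') _ _ _ i r a b.
    transitivity (\sum_b (\sum_l ((A l *m A l') i r)^* * B l a b) * B l' b d).
      under [RHS]eq_bigr do rewrite mulr_suml.
      rewrite exchange_big; apply: eq_bigr => l _ /=.
      by rewrite [(B l *m _) _ _]mxE mulr_sumr; apply: eq_bigr => b _; rewrite mulrA.
    under eq_bigr => b _.
      rewrite -T; [over|..].
      - by move=> X Y XY; apply: Wmul => //; apply: Wadj.
      - by move=> X Y XY; apply: Wmul.
      - by move=> X X'; rewrite hs_mulr adjmxK.
    under eq_bigr do rewrite mulr_suml.
    rewrite exchange_big; apply: eq_bigr => l _ /=.
    rewrite mulmxA [(_ *m B l') _ _]mxE mulr_sumr; apply: eq_bigr => b _.
    by rewrite mulrA.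
  rewrite sum_pair.
  rewrite (bigD1 r) //= [X in _ + X]big1 ?addr0; last first.
    move=> j /negbTE nj; rewrite big1 // => b _.
    by rewrite /Bk /= nj mul0r mulr0.
  rewrite exchange_big /=.
  under [RHS]eq_bigr do rewrite /pker /Bk /= eqxx mul1r mulr_suml.
  rewrite [RHS]exchange_big; apply: eq_bigr => l _ /=.
  rewrite -mulr_sumr; under [RHS]eq_bigr do rewrite -mulrA.
  rewrite -mulr_sumr; congr (_ * _).
  transitivity ((B l *m Bt) a d); last by rewrite mxE.
  by rewrite /Bt mulmx_sumr summxE.
move=> v.
have -> : qform Bk v = \sum_j \sum_l \sum_q
    (\sum_b B l q b * v (j, b))^* * (\sum_b B l q b * v (j, b)).
  rewrite /qform sum_pair.
  apply: eq_bigr => j _.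
  transitivity (\sum_b \sum_d (v (j, b))^* * Bt b d * v (j, d)).
    apply: eq_bigr => b _.
    rewrite sum_pair.
    rewrite (bigD1 j) //= [X in _ + X]big1 ?addr0; last first.
      move=> i /negbTE ni; rewrite big1 // => d _.
      by rewrite /Bk /= eq_sym ni mul0r mulr0 mul0r.
    by apply: eq_bigr => d _; rewrite /Bk /= eqxx mul1r.
  transitivity (\sum_b \sum_d \sum_l \sum_q (v (j, b))^* * (B l q b)^* * (B l q d * v (j, d))).
    apply: eq_bigr => b _; apply: eq_bigr => d _.
    rewrite /Bt summxE mulr_sumr mulr_suml; apply: eq_bigr => l _.
    rewrite mxE mulr_sumr mulr_suml; apply: eq_bigr => q _.
    by rewrite !mxE; ring.
  rewrite exchange_sum4 exchange_big; apply: eq_bigr => l _; apply: eq_bigr => q _ /=.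
  rewrite rmorph_sum mulr_suml; apply: eq_bigr => b _.
  rewrite mulr_sumr; apply: eq_bigr => d _.
  by rewrite rmorphM /=; ring.
apply: sumr_ge0 => j _; apply: sumr_ge0 => l _; apply: sumr_ge0 => q _.
by rewrite mulrC mul_conjC_ge0.
Qed.

End Kernel.
End IsometricPairs.

(** * The span of the tensor pairs *)

Section Transpose.
Variable k : nat.

(** Transposition reverses the cyclic sequence, hence is in general not a rotation, and [P_k] is not
    closed under it by definition. It is however an automorphism of [C_k] and of [M_k], and
    conjugates each rotation to its inverse. *)
Definition swap_lr (a : 'I_(k + k)) : 'I_(k + k) :=
  match split a with inl i => rshift k i | inr i => lshift k i end.

Lemma swap_lrE (a : 'I_(k + k)) : swap_lr a = (if a < k then a + k else a - k)%N :> nat.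
Proof.
rewrite /swap_lr; case: (split_ordP a) => i ->.
  by rewrite /= addnC.
by rewrite /= addKn.
Qed.

Lemma swap_lrK : involutive swap_lr.
Proof.
move=> a; apply: val_inj; rewrite /= !swap_lrE; have := ltn_ord a.
by case_ifs; lia.
Qed.

Definition sw : {perm 'I_(k + k)} := perm (inv_inj swap_lrK).

Lemma zf_sw (V : Type) (x y : k.-tuple V) : zf x y \o sw = zf y x.
Proof.
apply: funext => a; rewrite /= permE /swap_lr; case: (split_ordP a) => i ->.
  by rewrite zf_r zf_l.
by rewrite zf_r zf_l.
Qed.

Lemma cnext_sw a : cnext (sw (cnext a)) = sw a.
Proof.
apply: val_inj; rewrite /= !cnextE !permE /cnext_val !swap_lrE cnextE /cnext_val.
by have := ltn_ord a; case_ifs; lia.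
Qed.

Lemma CkE (a b : 'I_(k + k)) : bE (Ck_graph k) a b = (b == cnext a) || (a == cnext b).
Proof.
have H (c : 'I_(k + k)) : Ck_e k c (cnext c) || Ck_e k (cnext c) c.
  rewrite cnextE /cnext_val; have ck := ltn_ord c.
  case: ltnP => c1.
    by apply/orP; left; rewrite /Ck_e; apply/or3P/Or31/and3P; split; apply/eqP; lia.
  case: eqP => c2; first by
    apply/orP; left; rewrite /Ck_e; apply/or3P/Or33/andP; split; apply/eqP; lia.
  case: eqP => c3; first by
    apply/orP; right; rewrite /Ck_e; apply/or3P/Or32/andP; split; apply/eqP; lia.
  by apply/orP; right; rewrite /Ck_e; apply/or3P/Or31/and3P; split; apply/eqP; lia.
apply/orP/orP => [|[]/eqP ->].
- by case=> /Ck_e_cnext[] ->; rewrite eqxx; auto.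
- by apply/orP; apply: H.
- by apply/orP; rewrite orbC; apply: H.
Qed.

Lemma sw_Ck a b : bE (Ck_graph k) (sw a) (sw b) = bE (Ck_graph k) a b.
Proof.
have H c d : (sw d == cnext (sw c)) = (c == cnext d).
  apply/eqP/eqP => [E|->]; last by rewrite cnext_sw.
  by apply: (@perm_inj _ sw); apply: (@cnext_inj k); rewrite cnext_sw.
by rewrite !CkE !H orbC.
Qed.

Lemma MkE (a b : 'I_(k + k)) : bE (Mk_graph k) a b = (b == sw a).
Proof.
have := ltn_ord a; have := ltn_ord b => bk ak.
apply/orP/eqP => [[]/eqP E|->]; first by
  apply: val_inj; rewrite /= permE swap_lrE; case: ltnP; lia.
  by apply: val_inj; rewrite /= permE swap_lrE; case: ltnP; lia.
rewrite permE /= swap_lrE; case: ltnP => h; first by left.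
by right; rewrite subnK.
Qed.

Lemma sw_Mk a b : bE (Mk_graph k) (sw a) (sw b) = bE (Mk_graph k) a b.
Proof. by rewrite !MkE (inj_eq perm_inj). Qed.

Lemma in_Ck_sw s a : in_Ck s -> s (sw a) = sw ((s^-1)%g a).
Proof.
case=> m hm; suff H b : s (sw (s b)) = sw b by rewrite -{1}[a](permKV s) H.
rewrite !hm; elim: m b {hm s} => //= m IH b.
by rewrite -iterS iterSr cnext_sw IH.
Qed.

Definition transposed (F F' : bgraph k) :=
  forall (V : finType) (e : rel V) x y, hom_entry F' e x y = hom_entry F e y x.

Lemma minor_transposed E0 F : (forall a b, E0 (sw a) (sw b) = E0 a b) ->
  minor (base E0) F -> exists2 F', minor (base E0) F' & transposed F F'.
Proof.
move=> sE mF; have [F' mF' S] := minor_sim sE mF; exists F' => // V e x y.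
rewrite (sim_hom_entry _ _ _ _ _ S); [|exact: minor_full mF|exact: minor_full mF'].
by rewrite zf_sw lz_zf rz_zf.
Qed.

Lemma inQP_transposed F : inQP F -> exists2 F', inQP F' & transposed F F'.
Proof. by apply: minor_transposed; apply: sw_Ck. Qed.

Lemma inQ_transposed F : inQ F -> exists2 F', inQ F' & transposed F F'.
Proof.
case=> [/inQP_transposed[F' h1 h2]|]; first by exists F' => //; left.
by case/(minor_transposed sw_Mk) => F' h1 h2; exists F' => //; right.
Qed.

Lemma inP_transposed F : inP F -> exists2 F', inP F' & transposed F F'.
Proof.
elim=> {F} [F /inQ_transposed[F' h1 h2]|F1 F2 _ [F1' h1 t1] _ [F2' h2 t2]
   |F Q _ [F' h1 t1] /inQP_transposed[Q' h2 t2]|F s _ [F' h1 t1] sC].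
- by exists F' => //; apply: inP_Q.
- exists (series F2' F1'); first exact: inP_series.
  move=> V e x y; rewrite !hom_entry_series; apply: eq_bigr => z _.
  by rewrite t1 t2 mulnC.
- exists (parallel F' Q'); first exact: inP_parallel.
  by move=> V e x y; rewrite !hom_entry_parallel t1 t2.
(* Transposing after the rotation [s] is rotating the transpose by [s^-1]. *)
exists (bperm F' (s^-1)%g); first by apply: inP_perm => //; apply: in_Ck_inv.
move=> V e x y; rewrite !hom_entry_bperm t1 invgK -(zf_sw x y).
have -> : (zf x y \o sw) \o (s^-1)%g = zf x y \o s \o sw.
  by apply: funext => a /=; rewrite in_Ck_sw.
rewrite -[zf x y \o s](zf_lrz) zf_sw.
by rewrite !(lz_zf, rz_zf).
Qed.

End Transpose.

(** * Tensors that free, identify or test labels *)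

Section AtomicTensors.
Variable k : nat.
Hypothesis k0 : (0 < k)%N.
Let o : 'I_k := Ordinal k0.

Lemma Ck_irr : irreflexive (bE (Ck_graph k)).
Proof. by move=> a; rewrite /= /Ck_e; have := ltn_ord a; lia. Qed.

Lemma Ck_sym : symmetric (bE (Ck_graph k)).
Proof. by move=> a b; rewrite /= orbC. Qed.

Lemma Mk_irr : irreflexive (bE (Mk_graph k)).
Proof. by move=> a /=; have := ltn_ord a; lia. Qed.

Lemma Mk_sym : symmetric (bE (Mk_graph k)).
Proof. by move=> a b; rewrite /= orbC. Qed.

Definition free_upto (V : finType) j (x y : k.-tuple V) :=
  [forall i : 'I_k, (j <= i)%N ==> (tnth x i == tnth y i)].

Lemma free_uptoP (V : finType) j (x y : k.-tuple V) :
  reflect (forall i : 'I_k, (j <= i)%N -> tnth x i = tnth y i) (free_upto j x y).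
Proof.
apply: (iffP forallP) => H i; first by move=> ji; apply/eqP; apply: implyP (H i) ji.
by apply/implyP => ji; apply/eqP; apply: H.
Qed.

Definition const_upto (V : finType) j (x y : k.-tuple V) :=
  [forall i : 'I_k, (i <= j)%N ==> (tnth x i == tnth x o) && (tnth y i == tnth x o)].

Lemma const_uptoP (V : finType) j (x y : k.-tuple V) :
  reflect (forall i : 'I_k, (i <= j)%N -> tnth x i = tnth x o /\ tnth y i = tnth x o)
    (const_upto j x y).
Proof.
apply: (iffP forallP) => H i.
  by move=> ji; have /implyP /(_ ji) /andP[/eqP ? /eqP ?] := H i.
by apply/implyP => /(H i)[-> ->]; rewrite eqxx.
Qed.

(** From [M_k]: delete the edges at positions below [j] and contract the others. The tensor
    interpolates between [I] at [j = 0] and [J] at [j = k]. *)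
Lemma free_tensor j : exists2 F, @inQS k F & forall (V : finType) (e : rel V) x y,
  hom_entry F e x y = free_upto j x y.
Proof.
have [||F mF HF] := @minor_eq k _ (fun a b => bE (Mk_graph k) a b && (j <= minn a b)%N) Mk_irr.
- by move=> a b; rewrite Mk_sym minnC.
- by move=> a b /andP[].
exists F => // V e x y; rewrite HF; congr nat_of_bool.
apply/forallP/free_uptoP => [H i ji|H a].
  have := forallP (H (lshift k i)) (rshift k i); rewrite zf_l zf_r => /implyP h.
  by apply/eqP; apply: h; rewrite /= addnC eqxx /=; lia.
apply/forallP => b; apply/implyP => /andP[/= E jm]; apply/eqP.
have := ltn_ord a; have := ltn_ord b => ? ?.
case/orP: E => /eqP E.
  have ak : (a < k)%N by lia.
  have -> : a = lshift k (Ordinal ak) by apply: val_inj.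
  have -> : b = rshift k (Ordinal ak) by apply: val_inj => /=; lia.
  by rewrite zf_l zf_r; apply: H => /=; lia.
have bk : (b < k)%N by lia.
have -> : b = lshift k (Ordinal bk) by apply: val_inj.
have -> : a = rshift k (Ordinal bk) by apply: val_inj => /=; lia.
by rewrite zf_l zf_r; apply/esym/H => /=; lia.
Qed.

Lemma Ck_edge0 : bE (Ck_graph k) (lshift k o) (rshift k o).
Proof. by rewrite /= /Ck_e /= addn0 eqxx orbT. Qed.

(** From [C_k]: keep the edges among the positions up to [j] on both sides and contract them. The
    edge joining the two first labels makes this part connected, so all these labels become one
    vertex. *)
Lemma const_tensor j : exists2 F, @inQP k F & forall (V : finType) (e : rel V) x y,
  hom_entry F e x y = const_upto j x y.
Proof.
pose lev (a : 'I_(k + k)) := (if (a < k)%N then a : nat else a - k)%N.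
have [||F mF HF] := @minor_eq k _
    (fun a b => bE (Ck_graph k) a b && (lev a <= j)%N && (lev b <= j)%N) Ck_irr.
- by move=> a b; rewrite Ck_sym andbAC.
- by move=> a b /andP[/andP[]].
exists F => // V e x y; rewrite HF; congr nat_of_bool.
have levl (i : 'I_k) : lev (lshift k i) = i by rewrite /lev /= ltn_ord.
have levr (i : 'I_k) : lev (rshift k i) = i.
  by rewrite /lev /= ltnNge leq_addr /= addKn.
apply/forallP/const_uptoP => [H|H a].
  have edge a b : bE (Ck_graph k) a b -> (lev a <= j)%N -> (lev b <= j)%N ->
      zf x y a = zf x y b.
    move=> E la lb; have /forallP /(_ b) /implyP := H a.
    by rewrite E la lb => /(_ isT) /eqP.
  have xy0 : tnth y o = tnth x o.
    rewrite -(zf_l x y) -(zf_r x y); apply/esym/edge; first exact: Ck_edge0.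
      by rewrite levl.
    by rewrite levr.
  move=> [i ik] /=; elim: i ik => [|i IH] ik ij.
    by rewrite (_ : Ordinal ik = o) //; apply: val_inj.
  have ik' : (i < k)%N by lia.
  have [] := IH ik' (ltnW ij); rewrite -(zf_l x y) -(zf_r x y) => h1 h2.
  split; [rewrite -(zf_l x y) -h1|rewrite -(zf_r x y) -h2]; apply/esym/edge;
    rewrite ?levl ?levr //=; try lia.
    by rewrite /Ck_e /=; lia.
  by rewrite /Ck_e /=; lia.
apply/forallP => b; apply/implyP => /andP[/andP[_ la] lb].
have all c : (lev c <= j)%N -> zf x y c = tnth x o.
  case: (split_ordP c) => i ->; rewrite ?levl ?levr ?zf_l ?zf_r => /H[] //.
by rewrite !all.
Qed.

Lemma adj_tensor : exists2 F, @inQP k F & forall (V : finType) (e : rel V) x y,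
  symmetric e -> hom_entry F e x y = e (tnth x o) (tnth y o).
Proof.
have [||F mF HF] := @minor_adj k (bE (Ck_graph k)) (pair_eq (lshift k o) (rshift k o)).
- by move=> a b; rewrite pair_eqC.
- move=> a b /orP[]/andP[/eqP -> /eqP ->]; first exact: Ck_edge0.
  by rewrite Ck_sym Ck_edge0.
exists F => // V e x y se; rewrite HF; congr nat_of_bool.
apply/forallP/idP => [H|H a].
  have := forallP (H (lshift k o)) (rshift k o); rewrite zf_l zf_r => /implyP; apply.
  by rewrite /pair_eq !eqxx.
apply/forallP => b; apply/implyP => /orP[]/andP[/eqP -> /eqP ->]; rewrite zf_l zf_r //.
by rewrite se.
Qed.

(* With [S_j] the tensor freeing the coordinates below [j] and [D_j] the one
   identifying all labels up to [j], this says [S_j = S_j (D_j (.) S_(j+1)) S_j].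
   Since [S_k = J] and [S_0 = I], it turns traces into sums of entries. *)
Lemma free_upto_step (V : finType) (j : 'I_k) (x y x' y' : k.-tuple V) :
  let hat (t : k.-tuple V) := [tuple if (i < j)%N then tnth t j else tnth t i | i < k] in
  [&& free_upto j x x', const_upto j x' y', free_upto j.+1 x' y' & free_upto j y' y] =
  [&& x' == hat x, y' == hat y & free_upto j x y].
Proof.
move=> hat; apply/and4P/and3P => [[/free_uptoP h1 /const_uptoP h2 /free_uptoP h3 /free_uptoP h4]|].
  have xj (i : 'I_k) : (i <= j)%N -> tnth x' i = tnth x j.
    by move=> ij; rewrite h1 // (h2 i ij).1 (h2 j _).1.
  have yj (i : 'I_k) : (i <= j)%N -> tnth y' i = tnth y j.
    by move=> ij; rewrite -h4 // (h2 i ij).2 (h2 j _).2.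
  split.
  - apply/eqP; apply: eq_from_tnth => i; rewrite tnth_mktuple; case: ltnP => ij.
      by apply: xj; apply: ltnW.
    by rewrite h1.
  - apply/eqP; apply: eq_from_tnth => i; rewrite tnth_mktuple; case: ltnP => ij.
      by apply: yj; apply: ltnW.
    by rewrite h4.
  apply/free_uptoP => i ji; rewrite h1 // -h4 //.
  move: ji; rewrite leq_eqVlt => /orP[/eqP /val_inj <-|/h3//].
  by rewrite (h2 j _).1 // (h2 j _).2.
case=> /eqP -> /eqP -> /free_uptoP h; split.
- by apply/free_uptoP => i ji; rewrite tnth_mktuple ltnNge ji.
- have hx (t : k.-tuple V) (i : 'I_k) : (i <= j)%N -> tnth (hat t) i = tnth t j.
    move=> ij; rewrite tnth_mktuple; case: ltnP => // ji; congr tnth.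
    by apply: val_inj; apply/eqP; rewrite eqn_leq ij ji.
  by apply/const_uptoP => i ij; rewrite !hx // h.
- by apply/free_uptoP => i ji; rewrite !tnth_mktuple ltnNge (ltnW ji) /= h // ltnW.
- by apply/free_uptoP => i ji; rewrite tnth_mktuple ltnNge ji.
Qed.

End AtomicTensors.

Section Span.
Variables (R : realType) (k : nat) (VG VH : finType) (eG : rel VG) (eH : rel VH).
Local Notation C := R[i].
Hypothesis k0 : (0 < k)%N.
Hypothesis indist : hom_indist_P k eG eH.

(** Both sides carry the same coefficients; that this relation is the graph of a function is a
    consequence of [inW_hs]. *)
Inductive inW : 'M[C]_(dimk k VG) -> 'M[C]_(dimk k VH) -> Prop :=
| inW_0 : inW 0 0
| inW_cons c F X Y : inP F -> inW X Y ->
    inW (c *: htens R F eG + X) (c *: htens R F eH + Y).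

Lemma inW_lin c X Y X' Y' : inW X Y -> inW X' Y' -> inW (c *: X + X') (c *: Y + Y').
Proof.
move=> WXY WXY'; elim: WXY => [|d F X1 Y1 PF _ IH]; first by rewrite !scaler0 !add0r.
by rewrite !scalerDr !scalerA -!addrA; apply: inW_cons.
Qed.

Lemma inW_tens F : inP F -> inW (htens R F eG) (htens R F eH).
Proof.
move=> PF; have := inW_cons 1 PF inW_0.
by rewrite !scale1r !addr0.
Qed.

(** [f] is the action on scalars: the identity, or conjugation for adjoints. *)
Lemma inW_map (f : C -> C) LG LH :
  LG 0 = 0 -> LH 0 = 0 ->
  (forall c X X', LG (c *: X + X') = f c *: LG X + LG X') ->
  (forall c Y Y', LH (c *: Y + Y') = f c *: LH Y + LH Y') ->
  (forall F, inP F -> inW (LG (htens R F eG)) (LH (htens R F eH))) ->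
  forall X Y, inW X Y -> inW (LG X) (LH Y).
Proof.
move=> G0 H0 GL HL HF X Y; elim=> [|c F X1 Y1 PF _ IH]; first by rewrite G0 H0; apply: inW_0.
by rewrite GL HL; apply: inW_lin => //; apply: HF.
Qed.

Lemma inW_mul X Y X' Y' : inW X Y -> inW X' Y' -> inW (X *m X') (Y *m Y').
Proof.
move=> WX WX'; move: WX.
apply: (inW_map (f := id) (LG := fun X => X *m X') (LH := fun Y => Y *m Y')).
- by rewrite mul0mx.
- by rewrite mul0mx.
- by move=> c A B; rewrite mulmxDl scalemxAl.
- by move=> c A B; rewrite mulmxDl scalemxAl.
move=> F PF; move: WX'.
apply: (inW_map (f := id) (LG := fun X => _ *m X) (LH := fun Y => _ *m Y)).
- by rewrite mulmx0.
- by rewrite mulmx0.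
- by move=> c A B; rewrite mulmxDr scalemxAr.
- by move=> c A B; rewrite mulmxDr scalemxAr.
by move=> F' PF'; rewrite -!htens_series; apply: inW_tens; apply: inP_series.
Qed.

Lemma inW_had Q X Y : inQP Q -> inW X Y ->
  inW (hadam (htens R Q eG) X) (hadam (htens R Q eH) Y).
Proof.
move=> QQ; apply: (inW_map (f := id)).
- by apply/matrixP => i j; rewrite !mxE mulr0.
- by apply/matrixP => i j; rewrite !mxE mulr0.
- by move=> c A B; apply/matrixP => i j; rewrite !mxE; ring.
- by move=> c A B; apply/matrixP => i j; rewrite !mxE; ring.
move=> F PF; rewrite ![hadam (htens R Q _) _]hadamC -!htens_parallel.
by apply: inW_tens; apply: inP_parallel.
Qed.

Lemma inW_perm s X Y : in_Ck s -> inW X Y -> inW (mperm s X) (mperm s Y).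
Proof.
move=> sC; apply: (inW_map (f := id)).
- by apply: entz_inj => z; rewrite entz_mperm /entz !ent0.
- by apply: entz_inj => z; rewrite entz_mperm /entz !ent0.
- move=> c A B; apply: entz_inj => z; rewrite entz_mperm /entz !(ent_add, ent_scale).
  by rewrite -![ent (mperm _ _) _ _]/(entz _ z) !entz_mperm.
- move=> c A B; apply: entz_inj => z; rewrite entz_mperm /entz !(ent_add, ent_scale).
  by rewrite -![ent (mperm _ _) _ _]/(entz _ z) !entz_mperm.
by move=> F PF; rewrite -!htens_bperm; apply: inW_tens; apply: inP_perm.
Qed.

Lemma inW_adj X Y : inW X Y -> inW (adjmx X) (adjmx Y).
Proof.
apply: (inW_map (f := Num.conj)).
- by apply/matrixP => i j; rewrite !mxE conjC0.
- by apply/matrixP => i j; rewrite !mxE conjC0.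
- by move=> c A B; rewrite adjmxD adjmxZ.
- by move=> c A B; rewrite adjmxD adjmxZ.
move=> F /inP_transposed[F' PF' t].
have E (V : finType) (e : rel V) : adjmx (htens R F e) = htens R F' e.
  by apply: ent_inj => x y; rewrite ent_adj !ent_htens t conjC_nat.
by rewrite !E; apply: inW_tens.
Qed.

Lemma inW_sum X Y : inW X Y -> \sum_x \sum_y ent X x y = \sum_x \sum_y ent Y x y.
Proof.
rewrite !sum_entries; elim=> [|c F X1 Y1 PF _ IH]; first by rewrite !hs0r.
by rewrite !hsDr !hsZr IH -!sum_entries !htens_sum indist.
Qed.

Definition fmx j (V : finType) : 'M[C]_(dimk k V) := mkmx (fun x y => (free_upto j x y)%:R).
Definition cmx j (V : finType) : 'M[C]_(dimk k V) := mkmx (fun x y => (const_upto k0 j x y)%:R).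

Lemma inW_fmx j : inW (fmx j VG) (fmx j VH).
Proof.
have [F QF HF] := free_tensor k0 j.
have E (V : finType) (e : rel V) : fmx j V = htens R F e.
  by apply: ent_inj => x y; rewrite ent_mkmx ent_htens HF.
by rewrite (E _ eG) (E _ eH); apply: inW_tens; apply: inP_Q; right.
Qed.

Lemma inW_cmx j X Y : inW X Y -> inW (hadam (cmx j VG) X) (hadam (cmx j VH) Y).
Proof.
have [F QF HF] := const_tensor k0 j.
have E (V : finType) (e : rel V) : cmx j V = htens R F e.
  by apply: ent_inj => x y; rewrite ent_mkmx ent_htens HF.
by rewrite (E _ eG) (E _ eH); apply: inW_had.
Qed.

Lemma fmx0 V : fmx 0 V = 1%:M.
Proof.
apply: ent_inj => x y; rewrite ent_mkmx ent_1; congr _%:R; congr nat_of_bool.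
apply/free_uptoP/eqP => [H|->//]; apply: eq_from_tnth => i; exact: H.
Qed.

Lemma fmxk V : fmx k V = @Jmx R _.
Proof.
apply: ent_inj => x y; rewrite ent_mkmx ent_J.
by case: free_uptoP => // -[] i; rewrite leqNgt ltn_ord.
Qed.

Lemma inW_J : inW (@Jmx R _) (@Jmx R _).
Proof. by rewrite -!fmxk; apply: inW_fmx. Qed.

Lemma fmx_adj j V : adjmx (fmx j V) = fmx j V.
Proof.
apply: ent_inj => x y; rewrite ent_adj !ent_mkmx conjC_nat; congr (_%:R).
by congr nat_of_bool; apply: eq_forallb => i; rewrite eq_sym.
Qed.

Lemma fmx_step (j : 'I_k) V :
  fmx j V = fmx j V *m hadam (cmx j V) (fmx j.+1 V) *m fmx j V.
Proof.
apply: ent_inj => x y; rewrite ent_mkmx ent_mul.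
(* Only one pair of intermediate tuples contributes: coordinates below [j] must take the value of
   coordinate [j]. *)
pose hat (t : k.-tuple V) := [tuple if (i < j)%N then tnth t j else tnth t i | i < k].
transitivity (\sum_y' \sum_x' ((y' == hat y)%:R * ((x' == hat x)%:R * (free_upto j x y)%:R)) : C).
  under eq_bigr do rewrite -mulr_sumr (sum_delta (hat x) (fun=> _)).
  by rewrite (sum_delta (hat y) (fun=> _)).
apply: eq_bigr => y' _; rewrite ent_mul mulr_suml; apply: eq_bigr => x' _.
rewrite ent_hadam !ent_mkmx -!natrM !mulnb; congr (_%:R); congr nat_of_bool.
have := free_upto_step k0 j x y x' y'; rewrite /= -/(hat x) -/(hat y).
by rewrite !andbA => ->; rewrite [(x' == _) && _]andbC.
Qed.

Lemma inW_hs_fmx j X Y : (j <= k)%N -> inW X Y -> hs (fmx j VG) X = hs (fmx j VH) Y.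
Proof.
move=> jk; rewrite -(subKn jk); move: (k - j)%N (leq_subr j k) => i ik.
elim: i ik X Y => [|i IH] ik X Y WXY.
  by rewrite subn0 !fmxk -!sum_entries; apply: inW_sum.
have jk' : (k - i.+1 < k)%N by lia.
pose jj := Ordinal jk'.
(* The outer factors of [fmx_step] move to [Z] by self-adjointness, and so does the Schur factor;
   the index thereby rises from [jj] to [jj.+1], towards [J]. *)
have E V (Z : 'M[C]_(dimk k V)) : hs (fmx jj V) Z =
    hs (fmx jj.+1 V) (hadam (cmx jj V) (fmx jj V *m Z *m fmx jj V)).
  rewrite [in LHS]fmx_step -[LHS]hs_conj hs_mulr hs_conj fmx_adj.
  rewrite -[LHS]hs_conj hs_mull hs_conj fmx_adj hs_hadam ?mulmxA // => a b.
  by rewrite mxE conjC_nat.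
rewrite -[(k - i.+1)%N]/(nat_of_ord jj) !E.
have -> : jj.+1 = (k - i)%N by rewrite /=; lia.
apply: IH; first by lia.
by apply: inW_cmx; do 2?apply: inW_mul => //; apply: inW_fmx.
Qed.

Lemma inW_tr X Y : inW X Y -> \tr X = \tr Y.
Proof. by move=> WXY; have := inW_hs_fmx (leq0n k) WXY; rewrite !fmx0 !hs_1l. Qed.

Lemma inW_hs X Y X' Y' : inW X Y -> inW X' Y' -> hs X X' = hs Y Y'.
Proof. by move=> WX WX'; apply: inW_tr; apply: inW_mul => //; apply: inW_adj. Qed.

End Span.

(** * Certificates from functionals on cyclic words *)

Section CyclicReduction.
Variable S : eqType.

Definition cpairs (w : seq S) := zip w (rot 1 w).
Definition cfilt (w : seq S) := [seq q.1 | q <- cpairs w & q.1 != q.2].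

(* The case distinction keeps one letter of a constant word, so that [cred] is
   invariant under [wstep] up to rotation. *)
Definition cred (w : seq S) := if cfilt w is [::] then take 1 w else cfilt w.

Definition rot_inv (T : Type) (F : seq S -> T) := forall s t, F (s ++ t) = F (t ++ s).

Lemma cpairs_rot a b t : exists Z, cpairs (a :: b :: t) = (a, b) :: Z /\
  cpairs (rcons (b :: t) a) = rcons Z (a, b).
Proof.
exists (zip (b :: t) (rcons t a)); rewrite /cpairs !rot1_cons; split=> //.
by rewrite -zip_rcons ?size_rcons.
Qed.

Lemma cred_rot1 (T : Type) (F : seq S -> T) a t : rot_inv F ->
  F (cred (rcons t a)) = F (cred (a :: t)).
Proof.
move=> Finv; case: t => [|b t] //.
have [Z [E1 E2]] := cpairs_rot a b t.
rewrite /cred /cfilt E1 E2 filter_rcons /=.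
have [->|nab] := eqVneq a b; first by case: (map _ _) => //=; rewrite !take0.
rewrite map_rcons /=; case: (map _ _) => [|c Z'] //=.
by rewrite -rcons_cons -cats1 Finv.
Qed.

Lemma cred_rot (T : Type) (F : seq S -> T) : rot_inv F -> rot_inv (F \o cred).
Proof.
move=> Finv s t; elim: s t => [|a s IH] t; first by rewrite cats0.
rewrite /= -cred_rot1 // -cats1 -catA -[LHS]/((F \o cred) (s ++ (t ++ [:: a]))) IH.
by rewrite -catA.
Qed.

Lemma cred_dup a t : cred (a :: a :: t) = cred (a :: t).
Proof.
by rewrite /cred /cfilt /cpairs !rot1_cons /= eqxx /= !take0.
Qed.

(** A chain of elementary steps may pass through arbitrarily long words, where a functional on short
    words says nothing. Comparing normal forms skips the chain. *)
Lemma wequiv_cred (T : Type) (F : seq S -> T) w w' : rot_inv F ->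
  wequiv w w' -> F (cred w) = F (cred w').
Proof.
move=> Finv; elim=> {w w'} [w w' [s a t|s t]|//|w w' _ ->//|w w' w'' _ -> _ ->//].
  have E c : F (cred (s ++ c)) = F (cred (c ++ s)) by apply: (cred_rot Finv).
  by rewrite !E /= cred_dup.
exact: (cred_rot Finv).
Qed.

Lemma cred_cases w : cred w = w \/ exists s t a,
  w = s ++ t /\ exists r, t ++ s = a :: a :: r.
Proof.
have [Hall|] := boolP (all (fun q : S * S => q.1 != q.2) (cpairs w)).
  left; rewrite /cred /cfilt.
  have /all_filterP -> := Hall; rewrite -/(unzip1 _) unzip1_zip ?size_rot //.
  by case: (w).
case/allPn => -[a a'] qin; rewrite /= negbK => /eqP Ea; rewrite -{}Ea {a'} in qin.
(* In a one-letter word the letter is its own cyclic successor; [cred] keeps it. *)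
case: w qin => [|b [|c w]] //; first by left; rewrite /cred /cfilt /cpairs /= eqxx.
set w0 := b :: c :: w => qin; right.
have [i iw Ei] := nthP (a, a) qin.
have sz : size w0 = size (rot 1 w0) by rewrite size_rot.
rewrite size_zip -sz minnn in iw; rewrite nth_zip // in Ei.
case: Ei => E1 E2.
exists (take i w0), (drop i w0), a; rewrite cat_take_drop; split=> //.
have r0 (u : seq S) : (i < size u)%N -> nth a (rot i u) 0 = nth a u i.
  by move=> iu; rewrite /rot nth_cat size_drop subn_gt0 iu nth_drop addn0.
rewrite -/(rot i w0).
have h0 : nth a (rot i w0) 0 = a by rewrite r0.
have h1 : nth a (rot 1 (rot i w0)) 0 = a by rewrite rot_rot r0 ?size_rot.
have : size (rot i w0) = (size w).+2 by rewrite size_rot.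
case: (rot i w0) h0 h1 => [|x [|y r]] // /= -> -> _.
by exists r.
Qed.

End CyclicReduction.

(** * Averaging a functional on cyclic words *)

Section WordFunctional.
Variables (C : numClosedFieldType) (VG VH : finType) (eG : rel VG) (eH : rel VH).
Variables (g0 : VG) (N : nat).
Local Notation S := (VG * VH)%type.
Implicit Types (w s t u v : seq S) (a b : S).
Variable p : seq S -> C.
Hypothesis p_rot : forall s t, size (s ++ t) = N -> p (s ++ t) = p (t ++ s).
Hypothesis p_zero : forall g h g' h' t, (size t).+2 = N ->
  rel3 eG g g' <> rel3 eH h h' -> p ((g, h) :: (g', h') :: t) = 0.
Hypothesis p_sum : forall g h w, (size w).+1 = N ->
  \sum_h' p ((g, h') :: w) = \sum_g' p ((g', h) :: w).

Let n : C := #|VG|%:R.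

Lemma n_neq0 : n != 0.
Proof. by rewrite pnatr_eq0 -lt0n; apply/card_gt0P; exists g0. Qed.

(** In [p_sum] the left side does not involve [h] and the right side does not involve [g], so both
    are constant. Summing a letter over all pairs therefore yields a factor [#|VG|], the origin of
    the powers of [n] below. *)
Lemma p_sum_const g h w : (size w).+1 = N ->
  \sum_a p (a :: w) = n * \sum_h' p ((g, h') :: w) /\
  \sum_a p (a :: w) = n * \sum_g' p ((g', h) :: w).
Proof.
move=> sw; rewrite -(p_sum g h sw) sum_pair.
suff -> : \sum_i \sum_j p ((i, j) :: w) = n * \sum_h' p ((g, h') :: w) by [].
under eq_bigr do rewrite (p_sum _ h sw) -(p_sum g h sw).
by rewrite sumr_const -mulr_natl.
Qed.

Lemma p_cycl w1 a w2 : size (w1 ++ a :: w2) = N -> p (w1 ++ a :: w2) = p (a :: w2 ++ w1).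
Proof. by move=> sz; rewrite p_rot. Qed.

Lemma rel3_eqb g h g' h' : rel3 eG g g' = rel3 eH h h' -> (g == g') = (h == h').
Proof. by rewrite -(rel3_0 eG) -(rel3_0 eH) => ->. Qed.

(** Once the first component of the summed letter is fixed to [g], the vanishing condition leaves
    only [h' = h]. *)
Lemma p_dupl b w : (size w).+2 = N -> \sum_a p (a :: b :: w) = n * p (b :: b :: w).
Proof.
case: b => g h sw; have [-> _] := p_sum_const g h (sw : (size ((g, h) :: w)).+1 = N).
congr (_ * _); rewrite (bigD1 h) //= big1 ?addr0 // => h' nh.
apply: p_zero => // /rel3_eqb; rewrite eqxx => /esym/eqP E.
by rewrite E eqxx in nh.
Qed.

Lemma p_dupr b w : (size w).+2 = N -> \sum_a p (b :: a :: w) = n * p (b :: b :: w).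
Proof.
case: b => g h sw; have sw' : (size (w ++ [:: (g, h)])).+1 = N by rewrite size_cat addn1.
have E a : p ((g, h) :: a :: w) = p (a :: w ++ [:: (g, h)]).
  by rewrite -cat1s p_rot //= sw.
under eq_bigr do rewrite E.
have [-> _] := p_sum_const g h sw'; congr (_ * _).
under eq_bigr do rewrite -E.
rewrite (bigD1 h) //= big1 ?addr0 // => h' nh.
apply: p_zero => // /rel3_eqb; rewrite eqxx => /esym/eqP E'.
by rewrite E' eqxx in nh.
Qed.

Lemma p_dup w1 b w2 : (size (w1 ++ w2)).+2 = N ->
  \sum_a p (w1 ++ a :: b :: w2) = n * p (w1 ++ b :: b :: w2).
Proof.
move=> sz; have sz' : (size (w2 ++ w1)).+2 = N by rewrite size_cat addnC -size_cat.
rewrite p_cycl; last by rewrite -sz !size_cat /= !addnS.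
rewrite -p_dupl //; apply: eq_bigr => a _.
by rewrite p_cycl // -sz !size_cat /= !addnS.
Qed.

(** Both sides equal [n] times the value with [b] doubled. A letter that is summed out may thus
    change places with its neighbour, so missing letters can be inserted anywhere. *)
Lemma p_move1 w1 b w2 : (size (w1 ++ w2)).+2 = N ->
  \sum_a p (w1 ++ a :: b :: w2) = \sum_a p (w1 ++ b :: a :: w2).
Proof.
move=> sz; have sz' : (size (w2 ++ w1)).+2 = N by rewrite size_cat addnC -size_cat.
rewrite p_dup // p_cycl; last by rewrite -sz !size_cat /= !addnS.
rewrite -p_dupr //; apply: eq_bigr => a _.
by rewrite p_cycl // -sz !size_cat /= !addnS.
Qed.

Lemma p_move m w1 b w2 : (size (w1 ++ w2) + m).+1 = N ->
  wS m (fun u => p (w1 ++ u ++ b :: w2)) = wS m (fun u => p (w1 ++ b :: u ++ w2)).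
Proof.
elim: m w1 => // m IH w1 sz /=.
transitivity (\sum_a wS m (fun u => p (w1 ++ a :: b :: u ++ w2))).
  apply: eq_bigr => a _.
  transitivity (wS m (fun u => p ((w1 ++ [:: a]) ++ u ++ b :: w2))).
    by apply: eq_wS => u _; rewrite -catA.
  rewrite IH; last by rewrite -sz !size_cat /=; lia.
  by apply: eq_wS => u _; rewrite -catA.
rewrite -!wS_sum; apply: eq_wS => u su; rewrite p_move1 //.
by rewrite -sz !size_cat su; lia.
Qed.

Lemma p_moves m w1 w w2 : (size (w1 ++ w ++ w2) + m)%N = N ->
  wS m (fun u => p (w1 ++ u ++ w ++ w2)) = wS m (fun u => p (w1 ++ w ++ u ++ w2)).
Proof.
elim: w w1 => // b w IH w1 sz /=.
rewrite p_move; last by rewrite -sz !size_cat /=; lia.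
transitivity (wS m (fun u => p ((w1 ++ [:: b]) ++ u ++ w ++ w2))).
  by apply: eq_wS => u _; rewrite -catA.
rewrite IH; first by apply: eq_wS => u _; rewrite -catA.
by rewrite -sz !size_cat /=; lia.
Qed.

Definition pmarg w : C := n ^- (N - size w) * wS (N - size w) (fun u => p (w ++ u)).

Lemma pmarg_rot s t : (size (s ++ t) <= N)%N -> pmarg (s ++ t) = pmarg (t ++ s).
Proof.
move=> sz; rewrite /pmarg.
have -> : size (t ++ s) = size (s ++ t) by rewrite !size_cat addnC.
congr (_ * _).
transitivity (wS (N - size (s ++ t)) (fun u => p (t ++ u ++ s ++ [::]))).
  apply: eq_wS => u su; rewrite -catA p_rot ?cats0 ?catA //.
  by rewrite !size_cat su; move: sz; rewrite !size_cat; lia.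
rewrite p_moves; last by move: sz; rewrite !size_cat /=; lia.
by apply: eq_wS => u _; rewrite cats0 catA.
Qed.

Lemma pmarg_insert w1 w2 : (size (w1 ++ w2) < N)%N -> let m := (N - (size (w1 ++ w2)).+1)%N in
  pmarg (w1 ++ w2) = n ^- m.+1 * \sum_a wS m (fun u => p (w1 ++ a :: w2 ++ u)).
Proof.
move=> sz m; rewrite /pmarg.
have -> : (N - size (w1 ++ w2) = m.+1)%N by rewrite /m; lia.
congr (_ * _) => /=; rewrite -!wS_sum; apply: eq_wS => u su.
have := @p_moves 1 w1 w2 u; rewrite /= => -> //; last first.
  by rewrite !size_cat su /m; move: sz; rewrite !size_cat; lia.
by apply: eq_bigr => a _; rewrite -catA.
Qed.

Lemma pmarg_sum g h w1 w2 : (size (w1 ++ w2) < N)%N ->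
  \sum_h' pmarg (w1 ++ (g, h') :: w2) = pmarg (w1 ++ w2) /\
  \sum_g' pmarg (w1 ++ (g', h) :: w2) = pmarg (w1 ++ w2).
Proof.
move=> sz; rewrite pmarg_insert //; set m := (N - _)%N.
have sE a : size (w1 ++ a :: w2) = (size (w1 ++ w2)).+1 by rewrite !size_cat addnS.
rewrite /pmarg; under eq_bigr do rewrite sE -/m.
under [X in _ /\ X = _]eq_bigr do rewrite sE -/m.
rewrite -!mulr_sumr -!wS_sum exprS invfM [n^-1 * _]mulrC -!mulrA -[n^-1 * wS _ _]wS_mull.
have E u : size u = m -> 
   \sum_h' p ((w1 ++ (g, h') :: w2) ++ u) = n^-1 * \sum_a p (w1 ++ a :: w2 ++ u) /\
   \sum_g' p ((w1 ++ (g', h) :: w2) ++ u) = n^-1 * \sum_a p (w1 ++ a :: w2 ++ u).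
  move=> su; pose w := (w2 ++ u) ++ w1.
  have sw : (size w).+1 = N by rewrite !size_cat su /m; move: sz; rewrite !size_cat; lia.
  have cyc a : p (w1 ++ a :: w2 ++ u) = p (a :: w).
    by rewrite p_cycl // -sw !size_cat /= !size_cat; lia.
  under eq_bigr do rewrite -catA /= cyc.
  under [X in _ /\ X = _]eq_bigr do rewrite -catA /= cyc.
  under [X in _ = _ * X /\ _]eq_bigr do rewrite cyc.
  under [X in _ /\ _ = _ * X]eq_bigr do rewrite cyc.
  have [E1 E2] := p_sum_const g h sw.
  by rewrite {1}E1 E2 !mulKf ?n_neq0.
split; congr (_ * _).
  by apply: eq_wS => u /E[].
by apply: eq_wS => u /E[].
Qed.

Lemma pmarg_dup s a t : (size (s ++ a :: a :: t) <= N)%N ->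
  pmarg (s ++ a :: a :: t) = pmarg (s ++ a :: t).
Proof.
move=> sz; have sE : size (s ++ a :: a :: t) = (size (s ++ a :: t)).+1.
  by rewrite !size_cat /= !addnS.
rewrite [RHS]pmarg_insert -?sE // /pmarg sE; set m := (N - _)%N.
rewrite exprS invfM [n^-1 * _]mulrC -mulrA; congr (_ * _).
rewrite -wS_sum -wS_mull; apply: eq_wS => u su.
rewrite -catA /= p_dup ?mulKf ?n_neq0 //.
by move: sz; rewrite !size_cat su /m !size_cat /=; lia.
Qed.

Lemma pmarg_zero w1 g h g' h' w2 : (size (w1 ++ (g, h) :: (g', h') :: w2) <= N)%N ->
  rel3 eG g g' <> rel3 eH h h' -> pmarg (w1 ++ (g, h) :: (g', h') :: w2) = 0.
Proof.
move=> sz H; rewrite /pmarg (_ : wS _ _ = 0) ?mulr0 //.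
rewrite (eq_wS (G := fun=> 0 * 0)); first by rewrite wS_mull mul0r.
move=> u su; rewrite mul0r -catA /= p_cycl /=; last first.
  by move: sz; rewrite !size_cat /= !size_cat su !size_cat /=; lia.
apply: p_zero => //.
by move: sz; rewrite !size_cat su !size_cat /=; lia.
Qed.

(** [rot_inv] speaks of all words, while [pmarg] is rotation invariant up to length [N]; longer
    words get the value [0]. *)
Definition pall w : C := if (size w <= N)%N then pmarg w else 0.

Lemma pall_rot : rot_inv pall.
Proof.
move=> s t; rewrite /pall [size (t ++ s)]size_cat addnC -size_cat.
by case: ifP => // sz; rewrite pmarg_rot.
Qed.

Lemma pmarg_cred w : (size w <= N)%N -> pmarg w = pall (cred w).
Proof.
move: {2}(size w) (leqnn (size w)) => m; elim: m w => [|m IH] w wm wN.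
  by case: w wm wN => // _ _; rewrite /cred /= /pall.
have [->|[s [t [a [E [r Er]]]]]] := cred_cases w; first by rewrite /pall wN.
have szE : size w = size (a :: a :: r) by rewrite -Er E !size_cat addnC.
have -> : pmarg w = pmarg (a :: r).
  rewrite E pmarg_rot -?E // Er.
  by apply: (@pmarg_dup [::]); rewrite /= -/(size (a :: a :: r)) -szE.
rewrite IH; [|by move: wm; rewrite szE|by rewrite szE in wN; apply: ltnW].
have -> : pall (cred w) = pall (cred (a :: a :: r)).
  by rewrite E -Er; apply: (cred_rot pall_rot).
by rewrite cred_dup.
Qed.

Lemma pmarg_wequiv w w' : (size w <= N)%N -> (size w' <= N)%N -> wequiv w w' ->
  pmarg w = pmarg w'.
Proof.
move=> h1 h2 ww'; rewrite !pmarg_cred //.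
exact: wequiv_cred pall_rot ww'.
Qed.

End WordFunctional.

Section Certificate.
Variables (R : realType) (VG VH : finType) (eG : rel VG) (eH : rel VH).
Local Notation C := R[i].
Variables (g0 : VG) (k : nat).
Local Notation S := (VG * VH)%type.
Variable p : seq S -> C.
Hypothesis p_rot : forall s t, size (s ++ t) = (k + k)%N -> p (s ++ t) = p (t ++ s).
Hypothesis p_zero : forall g h g' h' t, (size t).+2 = (k + k)%N ->
  rel3 eG g g' <> rel3 eH h h' -> p ((g, h) :: (g', h') :: t) = 0.
Hypothesis p_sum : forall g h w, (size w).+1 = (k + k)%N ->
  \sum_h' p ((g, h') :: w) = \sum_g' p ((g', h) :: w).
Hypothesis p_one : wS (k + k) p = #|VG|%:R ^+ (k + k).
Hypothesis p_herm : forall s t, size s = k -> size t = k ->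
  p (rev t ++ s) = (p (rev s ++ t))^*.
Hypothesis p_psd : forall x : seq S -> C,
  0 <= wS k (fun s => wS k (fun t => (x s)^* * p (rev s ++ t) * x t)).

Let n : C := #|VG|%:R.
Let M (s t : seq S) := pmarg (k + k) p (rev s ++ t).

Lemma wS_rev (T : finType) m (F : seq T -> C) : wS m (fun u => F (rev u)) = wS m F.
Proof.
elim: m F => // m IH F.
transitivity (wS (m + 1) F); last by rewrite addn1.
rewrite wS_cat /= -(IH (fun u => \sum_a F (u ++ [:: a]))) wS_sum.
by apply: eq_bigr => a _; apply: eq_wS => u _; rewrite rev_cons -cats1.
Qed.

Lemma wS_conj (T : finType) m (F : seq T -> C) : (wS m F)^* = wS m (fun u => (F u)^*).
Proof.
elim: m F => // m IH F /=; rewrite rmorph_sum; apply: eq_bigr => a _.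
exact: IH.
Qed.

(* Up to a rotation, the summed-out letters can be split between the two words:
   [M] is the compression of the kernel [p (rev s ++ t)] to padded words. *)
Lemma M_padded s t : (size s <= k)%N -> (size t <= k)%N ->
  M s t = n ^- (k - size s) * n ^- (k - size t) *
   wS (k - size s) (fun u => wS (k - size t) (fun v => p (rev (s ++ u) ++ (t ++ v)))).
Proof.
move=> hs ht; rewrite /M /pmarg.
have -> : (k + k - size (rev s ++ t) = (k - size t) + (k - size s))%N.
  by rewrite size_cat size_rev; lia.
rewrite exprD invfM [n ^- _ * n ^- _]mulrC; congr (_ * _).
rewrite wS_cat [RHS]wS_exchange; apply: eq_wS => v sv.
rewrite -wS_rev; apply: eq_wS => u su.
rewrite rev_cat -!catA [RHS]p_rot -?catA // !size_cat !size_rev su sv; lia.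
Qed.

Lemma wsum_wS (F : seq S -> C) : wsum k F = \sum_(m < k.+1) wS m F.
Proof. by apply: eq_bigr => m _; rewrite wS_tuple. Qed.

Lemma wS_take (F : seq S -> seq S -> C) m : (m <= k)%N ->
  wS m (fun s => wS (k - m) (fun u => F s (s ++ u))) = wS k (fun s => F (take m s) s).
Proof.
move=> mk; rewrite -{2}(subnKC mk) wS_cat; apply: eq_wS => s ss.
by apply: eq_wS => u _; rewrite -ss take_size_cat.
Qed.

Lemma pmarg_npa_cert : npa_cert k eG eH M.
Proof.
have szM s t : (size s <= k)%N -> (size t <= k)%N -> (size (rev s ++ t) <= k + k)%N.
  by move=> h1 h2; rewrite size_cat size_rev leq_add.
split.
- move=> s t hs ht; rewrite !M_padded // rmorphM /= wS_conj.
  have nr m : (n ^- m)^* = n ^- m by rewrite fmorphV rmorphXn /= conjC_nat.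
  rewrite rmorphM /= !nr [n ^- (k - size t) * _]mulrC; congr (_ * _).
  rewrite wS_exchange; apply: eq_wS => u su; rewrite wS_conj; apply: eq_wS => v sv.
  by apply: p_herm; rewrite size_cat ?su ?sv subnKC.
- move=> x.
  (* [x] is pulled back to words of length [k]: each prefix contributes with the weight of its
     missing letters. *)
  pose X (s : seq S) := \sum_(m < k.+1) n ^- (k - m) * x (take m s).
  suff -> : wsum k (fun s => wsum k (fun t => (x s)^* * M s t * x t)) =
     wS k (fun s => wS k (fun t => (X s)^* * p (rev s ++ t) * X t)) by exact: p_psd.
  have nr m : (n ^- m)^* = n ^- m by rewrite fmorphV rmorphXn /= conjC_nat.
  transitivity (\sum_(m < k.+1) \sum_(m' < k.+1) wS k (fun s => wS k (fun t =>
     (n ^- (k - m) * x (take m s))^* * p (rev s ++ t) * (n ^- (k - m') * x (take m' t))))).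
    rewrite wsum_wS; apply: eq_bigr => m _.
    have mk : (m <= k)%N by rewrite -ltnS.
    transitivity (wS m (fun s => \sum_(m' < k.+1) wS m' (fun t => (x s)^* * M s t * x t))).
      by apply: eq_wS => s _; rewrite wsum_wS.
    rewrite wS_sum; apply: eq_bigr => m' _.
    have mk' : (m' <= k)%N by rewrite -ltnS.
    rewrite -(wS_take (fun s' s => wS k (fun t => (n ^- (k - m) * x s')^* *
       p (rev s ++ t) * (n ^- (k - m') * x (take m' t))))) //.
    apply: eq_wS => s ss.
    transitivity (wS m' (fun t => wS (k - m) (fun u => wS (k - m') (fun v =>
      (n ^- (k - m) * x s)^* * p (rev (s ++ u) ++ t ++ v) * (n ^- (k - m') * x t))))).
      apply: eq_wS => t st; rewrite M_padded ?ss ?st //.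
      transitivity (((n ^- (k - m) * x s)^* * (n ^- (k - m') * x t)) *
        wS (k - m) (fun u => wS (k - m') (fun v => p (rev (s ++ u) ++ t ++ v)))).
        rewrite rmorphM /= nr; move: (wS _ _) (n ^- _) (n ^- _) => y1 y2 y3.
        by ring.
      rewrite -wS_mull; apply: eq_wS => u _.
      by rewrite -wS_mull; apply: eq_wS => v _; ring.
    rewrite wS_exchange; apply: eq_wS => u _.
    by rewrite -(wS_take (fun t' t => (n ^- (k - m) * x s)^* *
      p (rev (s ++ u) ++ t) * (n ^- (k - m') * x t'))).
  under eq_bigr do rewrite -wS_sum.
  rewrite -wS_sum; apply: eq_wS => s _.
  under eq_bigr do rewrite -wS_sum.
  rewrite -wS_sum; apply: eq_wS => t _.
  rewrite /X rmorph_sum !mulr_suml; apply: eq_bigr => m _.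
  by rewrite mulr_sumr.
- rewrite /M /pmarg /= subn0 p_one mulVf //.
  by rewrite expf_neq0 // n_neq0.
- move=> s t s' t' hs ht hs' ht'.
  by apply: (pmarg_wequiv (eG := eG) (eH := eH)) => //; apply: szM.
- move=> s s' g h t; rewrite size_cat /= addnS => hs ht; rewrite /M.
  have [|E _] := pmarg_sum g0 p_rot p_zero p_sum g h (w1 := rev s') (w2 := rev s ++ t).
    by rewrite !size_cat !size_rev; lia.
  rewrite rev_cat -catA -E; apply: eq_bigr => h' _.
  by rewrite rev_cat rev_cons cat_rcons -!catA.
- move=> s s' g h t; rewrite size_cat /= addnS => hs ht; rewrite /M.
  have [|_ E] := pmarg_sum g0 p_rot p_zero p_sum g h (w1 := rev s') (w2 := rev s ++ t).
    by rewrite !size_cat !size_rev; lia.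
  rewrite rev_cat -catA -E; apply: eq_bigr => h' _.
  by rewrite rev_cat rev_cons cat_rcons -!catA.
- move=> s s' g h t; rewrite size_cat /= addnS => hs ht; rewrite /M.
  have [|E _] := pmarg_sum g0 p_rot p_zero p_sum g h (w1 := rev t ++ s) (w2 := s').
    by rewrite !size_cat !size_rev; lia.
  by rewrite catA -E; apply: eq_bigr => h' _; rewrite catA.
- move=> s s' g h t; rewrite size_cat /= addnS => hs ht; rewrite /M.
  have [|_ E] := pmarg_sum g0 p_rot p_zero p_sum g h (w1 := rev t ++ s) (w2 := s').
    by rewrite !size_cat !size_rev; lia.
  by rewrite catA -E; apply: eq_bigr => h' _; rewrite catA.
- move=> s t q r g h g' h' hs ht E H; rewrite /M E.
  apply: (pmarg_zero (eG := eG) (eH := eH)) => //.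
  by rewrite -E szM.
Qed.

End Certificate.

(** * From homomorphism indistinguishability to NPA certificates *)

Section IndistToNpa.
Variables (R : realType) (k : nat) (VG VH : finType) (eG : rel VG) (eH : rel VH).
Local Notation C := R[i].
Hypotheses (sG : symmetric eG) (sH : symmetric eH).
Hypotheses (k0 : (0 < k)%N) (g0 : VG) (h0 : VH).
Hypothesis indist : hom_indist_P k eG eH.
Local Notation S := (VG * VH)%type.
Let o : 'I_k := Ordinal k0.
Let d : S := (g0, h0).
Notation W := (@inW R k VG VH eG eH).

Variables (m : nat) (A : 'I_m -> 'M[C]_(dimk k VG)) (B : 'I_m -> 'M[C]_(dimk k VH)).
Hypothesis WAB : forall i, W (A i) (B i).
Hypothesis expand : forall X Y, W X Y ->
  X = \sum_i hs (A i) X *: A i /\ Y = \sum_i hs (A i) X *: B i.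

Definition kxy (x y : k.-tuple VG) (u v : k.-tuple VH) : C :=
  \sum_l (ent (A l) x y)^* * ent (B l) u v.

Lemma kxy_transfer LG LG' LH LH' :
  (forall X Y, W X Y -> W (LG X) (LH Y)) ->
  (forall X Y, W X Y -> W (LG' X) (LH' Y)) ->
  (forall X X', hs (LG' X) X' = hs X (LG X')) ->
  forall x y u v, \sum_l (ent (A l) x y)^* * ent (LH (B l)) u v =
                  \sum_l (ent (LG' (A l)) x y)^* * ent (B l) u v.
Proof.
by move=> h1 h2 h3 x y u v; apply: (pker_transfer WAB expand h1 h2 h3).
Qed.

Definition kz (z : 'I_(k + k) -> S) : C :=
  kxy (lz (fst \o z)) (rz (fst \o z)) (lz (snd \o z)) (rz (snd \o z)).

Lemma kz_perm s z : in_Ck s -> kz (z \o s) = kz z.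
Proof.
move=> sC.
have := @kxy_transfer (mperm s) (mperm (s^-1)%g) (mperm s) (mperm (s^-1)%g) _ _ _
  (lz (fst \o z)) (rz (fst \o z)) (lz (snd \o z \o s)) (rz (snd \o z \o s)).
move=> T; rewrite /kz /kxy.
transitivity (\sum_l (ent (mperm (s^-1)%g (A l)) (lz (fst \o z)) (rz (fst \o z)))^* *
   ent (B l) (lz (snd \o z \o s)) (rz (snd \o z \o s))).
  apply: eq_bigr => l _; rewrite ent_mperm invgK zf_lrz /entz.
  by [].
rewrite -T.
- apply: eq_bigr => l _; rewrite ent_mperm zf_lrz /entz; congr (_ * ent _ _ _).
  + by congr lz; apply: funext => a /=; rewrite permKV.
  + by congr rz; apply: funext => a /=; rewrite permKV.
- by move=> X Y; apply: inW_perm.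
- by move=> X Y; apply: inW_perm; apply: in_Ck_inv.
- by move=> X X'; rewrite hs_mperm invgK.
Qed.

Lemma kxy_had (F : bgraph k) x y u v : inQP F ->
  kxy x y u v * (hom_entry F eH u v)%:R = kxy x y u v * (hom_entry F eG x y)%:R.
Proof.
move=> QF; have T := @kxy_transfer (hadam (htens R F eG)) (hadam (htens R F eG))
   (hadam (htens R F eH)) (hadam (htens R F eH)) _ _ _ x y u v.
transitivity (\sum_l (ent (A l) x y)^* * ent (hadam (htens R F eH) (B l)) u v).
  rewrite mulr_suml; apply: eq_bigr => l _; rewrite ent_hadam ent_htens; ring.
rewrite T.
- rewrite mulr_suml; apply: eq_bigr => l _.
  by rewrite ent_hadam ent_htens rmorphM /= conjC_nat; ring.
- by move=> X Y; apply: inW_had.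
- by move=> X Y; apply: inW_had.
- by move=> X X'; apply: hs_hadam; apply: htens_real.
Qed.

(** The minors of [C_k] that contract, respectively keep, only the edge joining the first labels
    test their equality and adjacency. By [kxy_had] a nonzero entry forces both tests, hence [rel3],
    to agree on the two sides. *)
Lemma kxy_zero x y u v :
  rel3 eG (tnth x o) (tnth y o) <> rel3 eH (tnth u o) (tnth v o) -> kxy x y u v = 0.
Proof.
move=> H; apply/eqP/negPn/negP => nz.
have [F1 Q1 H1] := const_tensor k0 0; have [F2 Q2 H2] := adj_tensor k0.
have := kxy_had x y u v Q1; have := kxy_had x y u v Q2.
rewrite !H1 !H2 // => /(mulfI nz)/eqP; rewrite eqr_nat => E2.
move=> /(mulfI nz)/eqP; rewrite eqr_nat => E1.
have cE (V : finType) (a b : k.-tuple V) : const_upto k0 0 a b = (tnth a o == tnth b o).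
  apply/const_uptoP/eqP => [/(_ o (leqnn 0))[] //|E i].
  rewrite leqn0 => /eqP i0; have -> : i = o by apply: val_inj.
  by rewrite E.
move: E1; rewrite !cE => E1; apply: H; rewrite /rel3.
move: E1 E2; rewrite -/o.
by case: (tnth x o == _); case: (tnth u o == _); case: (eG _ _); case: (eH _ _).
Qed.

Definition upd (V : finType) (y : k.-tuple V) (g : V) : k.-tuple V :=
  [tuple if i == o then g else tnth y i | i < k].

Lemma sum_upd (V : finType) (X : 'M[C]_(dimk k V)) x y :
  ent (X *m fmx R k 1 V) x y = \sum_g ent X x (upd y g).
Proof.
rewrite ent_mul.
transitivity (\sum_(t | free_upto 1 t y) ent X x t).
  rewrite [RHS]big_mkcond; apply: eq_bigr => t _; rewrite ent_mkmx.
  by case: ifP; rewrite ?mulr1 ?mulr0.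
rewrite (reindex_onto (upd y) (fun t => tnth t o)) /=; last first.
  move=> t /free_uptoP H; apply: eq_from_tnth => i; rewrite tnth_mktuple.
  case: eqP => [->//|ni]; rewrite H // lt0n; apply/eqP => i0; apply: ni.
  exact: val_inj.
apply: eq_bigl => g; rewrite tnth_mktuple eqxx eqxx andbT.
apply/free_uptoP => i i1; rewrite tnth_mktuple ifN //.
by apply: contraTneq i1 => ->.
Qed.

(** Right multiplication by the tensor that frees coordinate [0] sums this coordinate out. The
    tensor is self-adjoint and its pair lies in [W], so the sum crosses from one tensor factor to
    the other. *)
Lemma kxy_sum x y u v :
  \sum_h kxy x y u (upd v h) = \sum_g kxy x (upd y g) u v.
Proof.
have T := @kxy_transfer (fun X => X *m fmx R k 1 VG) (fun X => X *m fmx R k 1 VG)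
   (fun X => X *m fmx R k 1 VH) (fun X => X *m fmx R k 1 VH) _ _ _ x y u v.
rewrite /kxy exchange_big [RHS]exchange_big /=.
transitivity (\sum_l (ent (A l) x y)^* * ent (B l *m fmx R k 1 VH) u v).
  by apply: eq_bigr => l _; rewrite sum_upd mulr_sumr.
rewrite T.
- by apply: eq_bigr => l _; rewrite sum_upd rmorph_sum mulr_suml.
- by move=> X Y WXY; apply: inW_mul => //; apply: inW_fmx.
- by move=> X Y WXY; apply: inW_mul => //; apply: inW_fmx.
- by move=> X X'; rewrite hs_mulr fmx_adj.
Qed.

(** Defined on all sequences, with the default letter [d], so that [kword] needs no length proof. *)
Definition tg1 (s : seq S) : k.-tuple VG := [tuple (nth d s i).1 | i < k].
Definition tg2 (s : seq S) : k.-tuple VH := [tuple (nth d s i).2 | i < k].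

Definition kword (w : seq S) : C :=
  kxy (tg1 (rev (take k w))) (tg1 (drop k w)) (tg2 (rev (take k w))) (tg2 (drop k w)).

Lemma kword_cat s t : size s = k ->
  kword (rev s ++ t) = kxy (tg1 s) (tg1 t) (tg2 s) (tg2 t).
Proof.
move=> ss; rewrite /kword take_size_cat ?size_rev // drop_size_cat ?size_rev //.
by rewrite revK.
Qed.

Lemma kword_cword z : kword (cword z) = kz z.
Proof.
rewrite kword_cat ?size_tuple //.
by congr kxy; apply: eq_from_tnth => i; rewrite !tnth_mktuple -tnth_nth tnth_mktuple.
Qed.

Lemma cword_surj w : size w = (k + k)%N -> exists z, w = @cword k S z.
Proof.
move=> sw.
have s1 : size (rev (take k w)) == k.
  by rewrite size_rev size_take sw; case: ltnP => //; lia.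
have s2 : size (drop k w) == k by rewrite size_drop sw addKn.
exists (zf (Tuple s1) (Tuple s2)); rewrite /cword lz_zf rz_zf /= revK.
by rewrite cat_take_drop.
Qed.

Lemma kword_rot s t : size (s ++ t) = (k + k)%N -> kword (s ++ t) = kword (t ++ s).
Proof.
have r1 a w : size (a :: w) = (k + k)%N -> kword (a :: w) = kword (rcons w a).
  move=> sw; have sw' : size (rcons w a) = (k + k)%N by rewrite size_rcons.
  have [z Ez] := cword_surj sw'.
  have <- : cword (z \o @cnext k) = a :: w.
    by rewrite cword_cnext -Ez rotr1_rcons.
  rewrite Ez !kword_cword -[RHS](kz_perm _ (crot_Ck k)); congr kz.
  by apply: funext => b /=; rewrite permE.
elim: s t => [|a s IH] t sz; first by rewrite cats0.
rewrite cat_cons r1 // -cats1 -catA IH ?cats1; last first.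
  by rewrite -sz !size_cat ?size_rcons /=; lia.
by rewrite cat_rcons.
Qed.

Lemma kword_zero g h g' h' t : (size t).+2 = (k + k)%N ->
  rel3 eG g g' <> rel3 eH h h' -> kword ((g, h) :: (g', h') :: t) = 0.
Proof.
move=> st H; rewrite -(cat_take_drop k.-1 t).
(* Rotate so that [(g, h)] ends the first half and [(g', h')] starts the second; both then sit at
   first labels. *)
rewrite -[_ :: _ :: _]/(((g, h) :: (g', h') :: take k.-1 t) ++ drop k.-1 t) kword_rot; last first.
  by rewrite cat_cons cat_cons cat_take_drop.
have sd : size (drop k.-1 t) = k.-1 by rewrite size_drop; lia.
rewrite -cat_rcons -[rcons _ _]revK kword_cat; last by rewrite size_rev size_rcons sd prednK.
by apply: kxy_zero; rewrite rev_rcons !tnth_mktuple.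
Qed.

Lemma kword_sum g h w : (size w).+1 = (k + k)%N ->
  \sum_h' kword ((g, h') :: w) = \sum_g' kword ((g', h) :: w).
Proof.
move=> sw; rewrite -(cat_take_drop k.-1 w).
have sd : size (drop k.-1 w) = k by rewrite size_drop; lia.
(* Rotated to the start of the second half, [a] occupies the first coordinate, where it overwrites
   the placeholder [d]. *)
have E a : kword (a :: (take k.-1 w ++ drop k.-1 w)) =
   kxy (tg1 (rev (drop k.-1 w))) (upd (tg1 (d :: take k.-1 w)) a.1)
       (tg2 (rev (drop k.-1 w))) (upd (tg2 (d :: take k.-1 w)) a.2).
  rewrite -cat_cons kword_rot; last by rewrite cat_cons /= cat_take_drop.
  rewrite -{1}[drop _ _]revK kword_cat; last by rewrite size_rev.
  congr kxy; apply: eq_from_tnth => i; rewrite !tnth_mktuple -val_eqE /=;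
  by case: (nat_of_ord i).
under eq_bigr do rewrite E.
under [RHS]eq_bigr do rewrite E.
have updE (V : finType) (y : k.-tuple V) a b : upd (upd y a) b = upd y b.
  by apply: eq_from_tnth => i; rewrite !tnth_mktuple; case: eqP.
have K := kxy_sum (tg1 (rev (drop k.-1 w))) (upd (tg1 (d :: take k.-1 w)) g)
  (tg2 (rev (drop k.-1 w))) (upd (tg2 (d :: take k.-1 w)) h).
apply: etrans (etrans _ K) _; apply: eq_bigr => c _; by rewrite updE.
Qed.

Lemma kxy_pker x y u v : kxy x y u v =
  pker A B (enum_rank x, enum_rank u) (enum_rank y, enum_rank v).
Proof. by []. Qed.

Lemma pker_psdk : psdk (pker A B).
Proof.
apply: (pker_psd WAB expand).
- by move=> X Y X' Y'; apply: inW_mul.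
- by move=> X Y; apply: inW_adj.
Qed.

Lemma kword_herm s t : size s = k -> size t = k ->
  kword (rev t ++ s) = (kword (rev s ++ t))^*.
Proof. by move=> ss st; rewrite !kword_cat // !kxy_pker; apply: pker_psdk.1. Qed.

Lemma kword_psd (x : seq S -> C) :
  0 <= wS k (fun s => wS k (fun t => (x s)^* * kword (rev s ++ t) * x t)).
Proof.
have [c hc] := psdk_gram pker_psdk.
pose rk s := (enum_rank (tg1 s), enum_rank (tg2 s)).
pose y i := wS k (fun s => c i (rk s) * x s).
suff -> : wS k (fun s => wS k (fun t => (x s)^* * kword (rev s ++ t) * x t)) =
    \sum_i (y i)^* * y i.
  by apply: sumr_ge0 => i _; rewrite mulrC mul_conjC_ge0.
transitivity (wS k (fun s => \sum_i (c i (rk s) * x s)^* * y i)).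
  apply: eq_wS => s ss.
  transitivity (wS k (fun t => \sum_i (c i (rk s) * x s)^* * (c i (rk t) * x t))).
    apply: eq_wS => t st; rewrite kword_cat // kxy_pker hc mulr_sumr mulr_suml.
    by apply: eq_bigr => i _; rewrite rmorphM /=; ring.
  by rewrite wS_sum; apply: eq_bigr => i _; rewrite wS_mull.
rewrite wS_sum; apply: eq_bigr => i _; rewrite /y wS_conj mulrC -wS_mull.
by apply: eq_wS => s _; rewrite mulrC.
Qed.

Lemma sum_tg (F : k.-tuple VG -> k.-tuple VH -> C) :
  wS k (fun s => F (tg1 s) (tg2 s)) = \sum_x \sum_u F x u.
Proof.
rewrite wS_tuple pair_bigA /=.
rewrite [RHS](reindex (fun t : k.-tuple S => (tg1 t, tg2 t))) //=.
exists (fun q : k.-tuple VG * k.-tuple VH => [tuple (tnth q.1 i, tnth q.2 i) | i < k]).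
  move=> t _; apply: eq_from_tnth => i; rewrite !tnth_mktuple -!tnth_nth.
  by case: (tnth t i).
move=> [x u] _; congr pair; apply: eq_from_tnth => i;
by rewrite tnth_mktuple -tnth_nth tnth_mktuple.
Qed.

Lemma kword_one : wS (k + k) kword = #|VG|%:R ^+ (k + k).
Proof.
rewrite wS_cat.
rewrite -(wS_rev k (fun s => wS k (fun t => kword (s ++ t)))).
transitivity (wS k (fun s => \sum_y \sum_v kxy (tg1 s) y (tg2 s) v)).
  apply: eq_wS => s ss; rewrite -(sum_tg (fun y v => kxy (tg1 s) y (tg2 s) v)).
  by apply: eq_wS => t st; rewrite kword_cat.
rewrite (sum_tg (fun x u => \sum_y \sum_v kxy x y u v)).
transitivity (\sum_l hs (A l) (@Jmx R _) * hs (@Jmx R _) (B l)).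
  transitivity (\sum_x \sum_u \sum_y \sum_v \sum_l (ent (A l) x y)^* * ent (B l) u v); first by [].
  under eq_bigr do under eq_bigr do under eq_bigr do rewrite exchange_big /=.
  under eq_bigr do under eq_bigr do rewrite exchange_big /=.
  under eq_bigr do rewrite exchange_big /=.
  rewrite exchange_big /=; apply: eq_bigr => l _.
  rewrite -[hs (A l) _]hs_conj -!sum_entries rmorph_sum mulr_suml; apply: eq_bigr => x _.
  rewrite exchange_big /= rmorph_sum mulr_suml; apply: eq_bigr => y _.
  rewrite mulr_sumr; apply: eq_bigr => u _.
  by rewrite mulr_sumr.
(* [J] is paired with [J], so the sum over the family is Parseval's identity for [J], with value
   [(#|VG| ^ k) ^ 2]. *)
transitivity (hs (@Jmx R (dimk k VG)) (@Jmx R _)).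
  have WJ : W (@Jmx R _) (@Jmx R _) by exact: inW_J.
  have [E _] := expand WJ; rewrite [X in _ = hs _ X]E.
  rewrite hs_sumr; apply: eq_bigr => l _; rewrite hsZr; congr (_ * _).
  by apply/esym/(inW_hs k0 indist) => //; apply: inW_J.
rewrite -sum_entries; under eq_bigr do under eq_bigr do rewrite ent_J.
by rewrite !sumr_const card_tuple -mulrnA -expnD natrX.
Qed.

Lemma kword_npa : npa_cert k eG eH (fun s t => pmarg (k + k) kword (rev s ++ t)).
Proof.
exact: (pmarg_npa_cert g0 kword_rot kword_zero kword_sum kword_one kword_herm kword_psd).
Qed.

End IndistToNpa.

(** Without vertices averaging would divide by zero and there is no default letter. Only the empty
    word remains, and the constant [1] is a certificate. *)
Lemma npa_cert_card0 (R : realType) (k : nat) (VG VH : finType) (eG : rel VG) (eH : rel VH) :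
  (VG -> False) -> @npa_cert R k VG VH eG eH (fun _ _ => 1).
Proof.
move=> nG; split=> //.
- by move=> s t _ _; rewrite conjC1.
- move=> x; rewrite (_ : wsum _ _ = (wsum k x)^* * wsum k x).
    by rewrite mulrC mul_conjC_ge0.
  rewrite /wsum rmorph_sum mulr_suml; apply: eq_bigr => i _.
  rewrite rmorph_sum mulr_suml; apply: eq_bigr => s _.
  rewrite mulr_sumr; apply: eq_bigr => j _.
  by rewrite mulr_sumr; apply: eq_bigr => t _; rewrite mulr1.
Qed.

Theorem theorem1p1 (R : realType) (VG VH : finType) (eG : rel VG) (eH : rel VH) (k : nat) :
  symmetric eG -> irreflexive eG -> symmetric eH -> irreflexive eH ->
  #|VG| = #|VH| -> (0 < k)%N ->
  [<-> exists M, @npa_cert R k VG VH eG eH M;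
       exists Phi, @qi_map R k VG VH eG eH Phi;
       @alg_equiv R k VG VH eG eH;
       hom_indist_P k eG eH].
Proof.
move=> sG iG sH iH cGH k0; tfae.
- case=> M cert; exists (npa_map M).
  exact: (npa_qi_map sG iG sH iH cGH k0 cert).
- by case=> Phi qi; exists Phi; apply: qi_map_alg_iso.
- exact: alg_equiv_hom_indist.
move=> indist.
have [g0 _|nG] := pickP (fun _ : VG => true); last first.
  by exists (fun _ _ => 1); apply: npa_cert_card0 => g; have := nG g.
have [h0 _] := card_inhabited g0 (esym cGH).
have [m [A [B [[WAB _] expand]]]] :=
  onb_exists (inW_0 R k eG eH) (@inW_lin R k VG VH eG eH) (inW_hs k0 indist).
have cert := kword_npa sG sH k0 g0 h0 indist WAB expand.
by eexists; exact: cert.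
Qed.
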